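(* For every index set $I$ and every Hilbert space $H$, we have $$\mathfrak C_I\otimes_{\min}B(H)=\mathfrak C_I\otimes_{\max}B(H).$$
   Context: Operator systems are abstract (Choi–Effros) operator systems, not assumed complete. Tensor products: for operator systems $\mathcal S,\mathcal T$ the following are operator systems with underlying space the algebraic tensor product $\mathcal S\otimes\mathcal T$ and unit $1_{\mathcal S}\otimes1_{\mathcal T}$. $M_n(\mathcal S\otimes_{\min}\mathcal T)^+$ is the set of $X\in M_n(\mathcal S\otimes\mathcal T)$ with $(\varphi\otimes\psi)_n(X)\in M_{nkl}^+$ for all unital completely positive $\varphi:\mathcal S\to M_k$, $\psi:\mathcal T\to M_l$, $k,l\in\mathbb N$. $M_n(\mathcal S\otimes_{\max}\mathcal T)^+$ is the set of $X$ such that for all $\varepsilon>0$, $X+\varepsilon I_n\otimes1_{\mathcal S}\otimes1_{\mathcal T}$ has the form $\alpha(P\otimes Q)\alpha^*$ with $P\in M_k(\mathcal S)^+$, $Q\in M_l(\mathcal T)^+$, $\alpha\in M_{n,kl}$, $k,l\in\mathbb N$. An equality of tensor products means that the positive cones coincide at every matrix level. Coproduct: for a family $\{\mathcal S_\lambda\}_{\lambda\in\Lambda}$ of operator systems, $\oplus_1\{\mathcal S_\lambda:\lambda\in\Lambda\}$ is the algebraic direct sum (finitely supported families) modulo the subspace spanned by the differences $n_{\lambda_1}-n_{\lambda_2}$, where $n_\lambda$ is $1_{\mathcal S_\lambda}$ in coordinate $\lambda$ and $0$ elsewhere (so all units are identified). Elements of $M_n$ of it are written $\sum_{\lambda\in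 F}x_\lambda$ with $F\subset\Lambda$ finite and $x_\lambda\in M_n(\mathcal S_\lambda)$; the involution is $(\sum x_\lambda)^*=\sum x_\lambda^*$, and $\sum_{\lambda\in F}x_\lambda\ge0$ iff $\sum_{\lambda\in F}\omega_\lambda(x_\lambda)\ge0$ for every family of states $\omega_\lambda$ on $M_n(\mathcal S_\lambda)$, $\lambda\in F$, whose restrictions to $M_n\cong M_n\otimes\mathbb C1_{\mathcal S_\lambda}$ all coincide. The order unit is the common class of the $n_\lambda$. The operator system $\mathfrak C_I$: let $I$ be a (nonempty) index set and $\{I_k\}_{k\in\mathbb N}$ a sequence of index sets, each of the same cardinality as $I$. For $\iota_k\in I_k$ let $\mathfrak C_{\iota_k}$ be the operator subsystem of (a copy, labelled $\iota_k$, of) $M_k(C([0,1]))$ spanned by $e_{ij}\otimes1$ and $e_{ij}\otimes t$, $1\le i,j\le k$, where $1,t\in C([0,1])$ are the constant function and the coordinate function. Then $\mathfrak C_I:=\oplus_1\{\mathfrak C_{\iota_k}:k\in\mathbb N,\iota_k\in I_k\}$. *)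

(* Defs.v *)
From HB Require Import structures.
From mathcomp Require Import all_boot all_order all_algebra.
From mathcomp Require Import all_classical all_reals all_analysis.
From mathcomp Require Import finmap generic_quotient ring_quotient complex mxtens.

Set Implicit Arguments.
Unset Strict Implicit.
Unset Printing Implicit Defensive.

Import Order.TTheory GRing.Theory Num.Theory.
Import numFieldNormedType.Exports.

Local Open Scope classical_set_scope.
Local Open Scope ring_scope.
Local Open Scope quotient_scope.

(* Subspaces and quotients: [spanned E] is the span of [E] as a module and
   [qspan E] the quotient of the ambient module by the span of [E]. *)
Section span.
Variables (K : pzRingType) (V : lmodType K) (E : set V).

Definition subspace_of (W : set V) :=
  W 0 /\ forall a u v, W u -> W v -> W (a *: u + v).

Definition span : {pred V} := [pred v | `[< smallest subspace_of E v >]].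

Fact span_submod_closed : submod_closed span.
Proof.
split=> [|a u v /asboolP Eu /asboolP Ev]; apply/asboolP => W [sW EW].
  exact: sW.1.
by apply: sW.2; [apply: Eu | apply: Ev].
Qed.
HB.instance Definition _ := GRing.isSubmodClosed.Build K V span
  span_submod_closed.

Lemma mem_span v : E v -> v \in span.
Proof. by move=> Ev; apply/asboolP => W [_]; apply. Qed.

Record spanned := Spanned { spanned_val :> V; _ : spanned_val \in span }.
HB.instance Definition _ := [isSub for spanned_val].
HB.instance Definition _ := [Choice of spanned by <:].
HB.instance Definition _ := [SubChoice_isSubLmodule of spanned by <:].

Definition qspan : Type := Quotient.quot span.
HB.instance Definition _ := GRing.Zmodule.on qspan.

Definition qclass (v : V) : qspan := \pi_(Quotient.quot span) v.
Definition qrepr (x : qspan) : V := repr (x : Quotient.quot span).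

Lemma qreprK : cancel qrepr qclass. Proof. exact: reprK. Qed.

Lemma qclass_eq u v : qclass u = qclass v <-> u - v \in span.
Proof.
by split=> [/eqP|uv]; [|apply/eqP]; rewrite -Quotient.idealrBE.
Qed.

Fact qclassD : {morph qclass : u v / u + v}.
Proof. by move=> u v; rewrite /qclass !piE. Qed.

Definition qscale (a : K) (x : qspan) := qclass (a *: qrepr x).

Fact qclassZ a v : qclass (a *: v) = qscale a (qclass v).
Proof.
apply/qclass_eq; rewrite -scalerBr rpredZ//.
by apply/qclass_eq; rewrite qreprK.
Qed.

Fact qscaleA a b x : qscale a (qscale b x) = qscale (a * b) x.
Proof. by rewrite -[x]qreprK -!qclassZ scalerA. Qed.
Fact qscale1 : left_id 1 qscale.
Proof. by move=> x; rewrite -[x]qreprK -qclassZ scale1r. Qed.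
Fact qscaleDr : right_distributive qscale +%R.
Proof.
by move=> a x y; rewrite -[x]qreprK -[y]qreprK -qclassD -!qclassZ scalerDr qclassD.
Qed.
Fact qscaleDl x : {morph qscale^~ x : a b / a + b}.
Proof.
by move=> a b; rewrite -[x]qreprK -!qclassZ scalerDl qclassD.
Qed.
HB.instance Definition _ := GRing.Zmodule_isLmodule.Build K qspan
  qscaleA qscale1 qscaleDr qscaleDl.

Fact qclass_linear : linear qclass.
Proof. by move=> a u v; rewrite qclassD qclassZ. Qed.
HB.instance Definition _ := GRing.isLinear.Build K V qspan *:%R qclass
  qclass_linear.

End span.
Arguments span {K V} E.
Arguments spanned {K V} E.
Arguments qspan {K V} E.
Arguments qclass {K V} E v.
Arguments qrepr {K V} E x.

(* Algebraic direct sum: finitely supported families. *)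
Section direct_sum.
Variables (K : pzRingType) (L : Type) (V : L -> lmodType K).

Record dsum := Dsum {
  dsum_fun :> forall l, V l;
  dsum_finite : finite_set [set l | dsum_fun l != 0] }.

Lemma dsumP (f g : dsum) : (forall l, f l = g l) -> f = g.
Proof.
case: f g => [f ff] [g fg] /= E.
have {}E : f = g by apply: functional_extensionality_dep.
by subst g; rewrite (Prop_irrelevance ff fg).
Qed.

HB.instance Definition _ := gen_eqMixin dsum.
HB.instance Definition _ := gen_choiceMixin dsum.

Fact dsum_zero_finite : finite_set [set l | (0 : V l) != 0].
Proof.
by rewrite (_ : [set _ | _] = set0)//; apply/seteqP; split=> l //=; rewrite eqxx.
Qed.
Definition dsum_zero := Dsum dsum_zero_finite.

Fact dsum_opp_finite (f : dsum) : finite_set [set l | - f l != 0].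
Proof.
by apply: sub_finite_set (dsum_finite f) => l /=; rewrite oppr_eq0.
Qed.
Definition dsum_opp f := Dsum (dsum_opp_finite f).

Fact dsum_add_finite (f g : dsum) : finite_set [set l | f l + g l != 0].
Proof.
have := conj (dsum_finite f) (dsum_finite g); rewrite -finite_setU.
apply: sub_finite_set => l /=.
by have [->|] := eqVneq (f l) 0; [rewrite add0r; right | left].
Qed.
Definition dsum_add f g := Dsum (dsum_add_finite f g).

Fact dsum_scale_finite a (f : dsum) : finite_set [set l | a *: f l != 0].
Proof.
apply: sub_finite_set (dsum_finite f) => l /=.
by apply: contra_neq => ->; rewrite scaler0.
Qed.
Definition dsum_scale a f := Dsum (dsum_scale_finite a f).

Fact dsum_addA : associative dsum_add.
Proof. by move=> f g h; apply: dsumP => l /=; rewrite addrA. Qed.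
Fact dsum_addC : commutative dsum_add.
Proof. by move=> f g; apply: dsumP => l /=; rewrite addrC. Qed.
Fact dsum_add0 : left_id dsum_zero dsum_add.
Proof. by move=> f; apply: dsumP => l /=; rewrite add0r. Qed.
Fact dsum_addN : left_inverse dsum_zero dsum_opp dsum_add.
Proof. by move=> f; apply: dsumP => l /=; rewrite addNr. Qed.
HB.instance Definition _ := GRing.isZmodule.Build dsum
  dsum_addA dsum_addC dsum_add0 dsum_addN.

Fact dsum_scaleA a b f : dsum_scale a (dsum_scale b f) = dsum_scale (a * b) f.
Proof. by apply: dsumP => l /=; rewrite scalerA. Qed.
Fact dsum_scale1 : left_id 1 dsum_scale.
Proof. by move=> f; apply: dsumP => l /=; rewrite scale1r. Qed.
Fact dsum_scaleDr : right_distributive dsum_scale +%R.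
Proof. by move=> a f g; apply: dsumP => l /=; rewrite scalerDr. Qed.
Fact dsum_scaleDl f : {morph dsum_scale^~ f : a b / a + b}.
Proof. by move=> a b; apply: dsumP => l /=; rewrite scalerDl. Qed.
HB.instance Definition _ := GRing.Zmodule_isLmodule.Build K dsum
  dsum_scaleA dsum_scale1 dsum_scaleDr dsum_scaleDl.

Definition dsingle_fun l0 (v : V l0) l : V l :=
  if pselect (l0 = l) is left e then eq_rect l0 V v l e else 0.

Fact dsingle_finite l0 (v : V l0) :
  finite_set [set l | dsingle_fun v l != 0].
Proof.
apply: sub_finite_set (finite_set1 l0) => l /=; rewrite /dsingle_fun.
by case: pselect => [/esym//|_]; rewrite eqxx.
Qed.
Definition dsingle l v : dsum := Dsum (@dsingle_finite l v).

End direct_sum.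
Arguments dsum {K L} V.
Arguments dsingle {K L V} l v.

(* [lmx V n] is M_n(V) as a module over the scalars of V (the library only
   makes 'M[V]_n a module when V is a ring). *)
Section matrices_over_module.
Variables (K : pzRingType) (V : lmodType K).

Definition lmx n : Type := 'M[V]_n.
HB.instance Definition _ n := GRing.Zmodule.on (lmx n).

Definition lmx_scale n (a : K) (X : lmx n) : lmx n := map_mx ( *:%R a) X.

Fact lmx_scaleA n a b (X : lmx n) :
  lmx_scale a (lmx_scale b X) = lmx_scale (a * b) X.
Proof. by apply/matrixP => i j; rewrite !mxE scalerA. Qed.
Fact lmx_scale1 n : left_id 1 (@lmx_scale n).
Proof. by move=> X; apply/matrixP => i j; rewrite !mxE scale1r. Qed.
Fact lmx_scaleDr n : right_distributive (@lmx_scale n) +%R.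
Proof. by move=> a X Y; apply/matrixP => i j; rewrite !mxE scalerDr. Qed.
Fact lmx_scaleDl n (X : lmx n) : {morph (@lmx_scale n)^~ X : a b / a + b}.
Proof. by move=> a b; apply/matrixP => i j; rewrite !mxE scalerDl. Qed.
HB.instance Definition _ n := GRing.Zmodule_isLmodule.Build K (lmx n)
  (@lmx_scaleA n) (@lmx_scale1 n) (@lmx_scaleDr n) (@lmx_scaleDl n).

(* The element A (x) v of M_{m,n}(V). *)
Definition mxtensv m n (A : 'M[K]_(m, n)) (v : V) : 'M[V]_(m, n) :=
  map_mx (fun a => a *: v) A.

(* The identification M_n(M_k(V)) = M_{nk}(V). *)
Definition mxflat n k (X : 'M['M[V]_k]_n) : 'M[V]_(n * k) :=
  \matrix_(i, j) X (mxtens_unindex i).1 (mxtens_unindex j).1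
                   (mxtens_unindex i).2 (mxtens_unindex j).2.

End matrices_over_module.

Section operator_systems.
Variable R : realType.
Local Notation C := R[i].

(* A X A^* for a scalar matrix A. *)
Definition mxcongr (V : lmodType C) m n (A : 'M[C]_(m, n)) (X : 'M[V]_n) :
    'M[V]_m :=
  \matrix_(i, j) \sum_k \sum_l (A i k * (A j l)^* ) *: X k l.

(* The data of an abstract operator system: a complex space with involution,
   unit and a cone M_n(S)^+ at each matrix level.  Nothing below uses more
   than these data, so the Choi-Effros axioms (Archimedean matrix order unit,
   proper cones compatible with congruences) are not bundled: they are theorems
   about the concrete systems defined below. Matrix sizes range over
   all of nat below; the sizes k, l = 0 change none of the cones. *)
Record opsys := Opsys {
  os_sort :> lmodType C;
  os_star : os_sort -> os_sort;
  os_unit : os_sort;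
  os_pos : forall n, set 'M[os_sort]_n }.

Definition completely_positive (S T : opsys) (phi : {linear S -> T}) :=
  forall n (X : 'M[S]_n), os_pos X -> os_pos (map_mx phi X).

Definition ucp (S T : opsys) (phi : {linear S -> T}) :=
  phi (os_unit S) = os_unit T /\ completely_positive phi.

(* States on M_n(S). *)
Definition state_mx (S : opsys) n (omega : {linear lmx S n -> C}) :=
  omega (mxtensv 1%:M (os_unit S)) = 1 /\
  forall X : 'M[S]_n, os_pos X -> 0 <= omega X.

Definition psd n (A : 'M[C]_n) :=
  forall v : 'I_n -> C, 0 <= \sum_i \sum_j (v i)^* * A i j * v j.

(* The operator system of complex numbers; M_n(C)^+ is [psd]. *)
Definition scalars : opsys := @Opsys C Num.conj 1 psd.

(* M_k(S) as an operator system. *)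
Definition ampliation k (S : opsys) : opsys :=
  @Opsys (lmx S k)
    (fun X => \matrix_(i, j) os_star (X j i))
    (mxtensv 1%:M (os_unit S))
    (fun n X => os_pos (mxflat X)).

Definition Mat k : opsys := ampliation k scalars.

(* C(X), ordered pointwise at each matrix level. *)
Section continuous_functions.
Variable X : topologicalType.
Local Notation CX := (continuousType X C^o).

Lemma ctsP (f g : CX) : (forall x, f x = g x) -> f = g.
Proof. by move=> fg; apply/continuousEP. Qed.

Fact cts_add_subproof (f g : CX) : continuous (fun x => f x + g x : C^o).
Proof. by move=> x; apply: cvgD; apply: cts_fun. Qed.
Fact cts_opp_subproof (f : CX) : continuous (fun x => - f x : C^o).
Proof. by move=> x; apply: cvgN; apply: cts_fun. Qed.
Fact cts_scale_subproof (a : C) (f : CX) : continuous (fun x => a * f x : C^o).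
Proof. by move=> x; apply: cvgMr; apply: cts_fun. Qed.
Fact cts_conj_subproof (f : CX) : continuous (fun x => (f x)^* : C^o).
Proof.
move=> x; apply/cvgrPdist_lt => e e0.
have /cvgrPdist_lt/(_ e e0) := @cts_fun _ _ f x.
by apply: filterS => y /=; rewrite -rmorphB/= norm_conjC.
Qed.

Definition cts_cst (a : C) : CX := mkcts (@cst_continuous X C^o a).
Definition cts_add f g : CX := mkcts (@cts_add_subproof f g).
Definition cts_opp f : CX := mkcts (@cts_opp_subproof f).
Definition cts_scale a f : CX := mkcts (@cts_scale_subproof a f).
Definition cts_conj f : CX := mkcts (@cts_conj_subproof f).

Fact cts_addA : associative cts_add.
Proof. by move=> f g h; apply: ctsP => x /=; rewrite /mkcts/= addrA. Qed.
Fact cts_addC : commutative cts_add.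
Proof. by move=> f g; apply: ctsP => x /=; rewrite /mkcts/= addrC. Qed.
Fact cts_add0 : left_id (cts_cst 0) cts_add.
Proof. by move=> f; apply: ctsP => x /=; rewrite /mkcts/= add0r. Qed.
Fact cts_addN : left_inverse (cts_cst 0) cts_opp cts_add.
Proof. by move=> f; apply: ctsP => x /=; rewrite /mkcts/= addNr. Qed.
HB.instance Definition _ := GRing.isZmodule.Build CX
  cts_addA cts_addC cts_add0 cts_addN.

Fact cts_scaleA a b f : cts_scale a (cts_scale b f) = cts_scale (a * b) f.
Proof. by apply: ctsP => x /=; rewrite /mkcts/= mulrA. Qed.
Fact cts_scale1 : left_id 1 cts_scale.
Proof. by move=> f; apply: ctsP => x /=; rewrite /mkcts/= mul1r. Qed.
Fact cts_scaleDr : right_distributive cts_scale +%R.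
Proof. by move=> a f g; apply: ctsP => x /=; rewrite /mkcts/= mulrDr. Qed.
Fact cts_scaleDl f : {morph cts_scale^~ f : a b / a + b}.
Proof. by move=> a b; apply: ctsP => x /=; rewrite /mkcts/= mulrDl. Qed.
HB.instance Definition _ := GRing.Zmodule_isLmodule.Build C CX
  cts_scaleA cts_scale1 cts_scaleDr cts_scaleDl.

Definition Cfun : opsys := @Opsys CX cts_conj (cts_cst 1)
  (fun n F => forall x : X, psd (map_mx (fun f : CX => f x : C) F)).

End continuous_functions.

Local Notation itv01 := (set_type (`[0, 1] : set R)).

Fact real_complex_continuous : continuous (fun x : R => x%:C%C : C^o).
Proof.
move=> x; apply/cvgrPdist_lt => e e0.
have eE : e = (complex.Re e)%:C%C by apply/esym/RRe_real; exact: gtr0_real.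
move: e0; rewrite eE (ltcR 0) => e0.
near=> y; rewrite -rmorphB/= normc_def/= expr0n/= addr0 sqrtr_sqr ltcR.
near: y; exact: cvgr_dist_lt.
Unshelve. all: by end_near. Qed.

Fact coord_continuous : continuous (fun x : itv01 => (val x)%:C%C : C^o).
Proof.
move=> x; apply: continuous_comp; last exact: real_complex_continuous.
exact: initial_continuous.
Qed.
Definition coord : continuousType itv01 C^o := mkcts coord_continuous.

Section affine_generators.
Variable k : nat.
Local Notation amb := (ampliation k (Cfun itv01)).

(* Generators e_ij (x) 1 and e_ij (x) t inside M_k(C([0,1])). *)
Definition frakc_gens : set amb :=
  [set X | exists i j f,
    (f = cts_cst itv01 1 \/ f = coord) /\ X = mxtensv (delta_mx i j) f].

Fact frakc_unit_subproof : os_unit amb \in span frakc_gens.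
Proof.
have -> : os_unit amb = \sum_i (mxtensv (delta_mx i i) (cts_cst itv01 1) : amb).
  apply/matrixP => i j; rewrite [RHS]summxE !mxE (bigD1 i)//= big1 => [|l li].
    by rewrite addr0 !mxE eqxx eq_sym.
  by rewrite !mxE eq_sym (negPf li) scale0r.
by apply: rpred_sum => i _; apply: mem_span; exists i, i, (cts_cst itv01 1);
  split=> //; left.
Qed.

Fact amb_star0 : os_star (0 : amb) = 0.
Proof. by apply/matrixP => i j; rewrite !mxE; apply: ctsP => x; exact: rmorph0. Qed.

Fact amb_starP (a : C) (u v : amb) :
  os_star (a *: u + v) = a^* *: os_star u + os_star v.
Proof.
apply/matrixP => i j; rewrite !mxE; apply: ctsP => x.
by rewrite /= /mkcts/= rmorphD rmorphM.
Qed.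

Fact amb_star_gen i j (f : Cfun itv01) : f = cts_cst itv01 1 \/ f = coord ->
  os_star (mxtensv (delta_mx i j) f : amb) = mxtensv (delta_mx j i) f.
Proof.
move=> fE; apply/matrixP => p q; rewrite !mxE andbC; apply: ctsP => x.
rewrite /= /mkcts/= rmorphM/=; congr (_ * _).
  by case: andb => /=; rewrite ?rmorph1 ?rmorph0.
case: fE => ->; rewrite /= /mkcts/= ?rmorph1//.
by rewrite conj_Creal//; apply/complex_realP; exists (val x).
Qed.

Fact frakc_star_subproof (X : spanned frakc_gens) :
  os_star (val X) \in span frakc_gens.
Proof.
case: X => X /= /asboolP.
apply: (_ : _ `<=` [set X : amb | os_star X \in span frakc_gens]).
apply: smallest_sub; first split.
- by rewrite /mkset amb_star0 rpred0.
- by move=> a u v su sv; rewrite /mkset amb_starP rpredD ?rpredZ.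
- move=> _ [i [j [f [fE ->]]]]; rewrite /mkset amb_star_gen//.
  by apply: mem_span; exists j, i, f.
Qed.

Definition frakc : opsys := @Opsys (spanned frakc_gens)
  (fun X => Spanned (frakc_star_subproof X))
  (Spanned frakc_unit_subproof)
  (fun n X => os_pos (map_mx (@spanned_val _ _ _) X)).

End affine_generators.

(* The inner product is linear in its first argument. *)
Record hilbert := Hilbert {
  hil_sort :> completeNormedModType C;
  hil_dot : {dot hil_sort for Num.conj};
  hil_norm : forall x : hil_sort, `|x| ^+ 2 = hil_dot x x }.

Section bounded_operators.
Variable H : hilbert.

Definition is_bounded_operator : {pred (H -> H)} :=
  [pred A | `[< linear A /\ exists M : C, forall x, `|A x| <= M * `|x| >]].

Fact is_bounded_operator_submod_closed : submod_closed is_bounded_operator.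
Proof.
split=> [|a A B /asboolP[lA [M AM]] /asboolP[lB [N BN]]]; apply/asboolP; split.
- by move=> a u v; rewrite /= /GRing.zero/= scaler0 addr0.
- by exists 0 => x; rewrite mul0r normr_le0.
- move=> b u v; have E x : (a *: A + B) x = a *: A x + B x by [].
  rewrite !E lA lB !scalerDr !scalerA [b * a]mulrC -!addrA; congr (_ + _).
  by rewrite addrCA.
- exists (`|a| * M + N) => x; rewrite mulrDl (le_trans (ler_normD _ _))//.
  by rewrite lerD// normrZ -mulrA ler_wpM2l.
Qed.
HB.instance Definition _ := GRing.isSubmodClosed.Build C (H -> H)
  is_bounded_operator is_bounded_operator_submod_closed.

Record bop := Bop { bop_fun :> H -> H; _ : bop_fun \in is_bounded_operator }.
HB.instance Definition _ := [isSub for bop_fun].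
HB.instance Definition _ := [Choice of bop by <:].
HB.instance Definition _ := [SubChoice_isSubLmodule of bop by <:].

Fact idop_subproof : id \in is_bounded_operator.
Proof.
by apply/asboolP; split=> //; exists 1 => x; rewrite mul1r.
Qed.

(* The involution sends A to its adjoint, which exists by the Riesz theorem.
   The cone at level n consists of the positive operators on H^n. *)
Definition BH : opsys := @Opsys bop
  (fun A => xget 0 [set B : bop | forall x y, hil_dot H (A x) y = hil_dot H x (B y)])
  (Bop idop_subproof)
  (fun n X => forall h : 'I_n -> H,
     0 <= \sum_i \sum_j hil_dot H (X i j (h j)) (h i)).

End bounded_operators.

Section coproduct.
Variables (L : Type) (S : L -> opsys).

Definition unit_differences : set (dsum S) :=
  [set w | exists l1 l2,
    w = dsingle l1 (os_unit (S l1)) - dsingle l2 (os_unit (S l2))].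

Local Notation coprod_sort := (qspan unit_differences).

Definition coprod_inj l (x : S l) : coprod_sort :=
  qclass unit_differences (dsingle l x).

(* The involution is applied to the representative chosen by the quotient; the
   result depends only on the class, because units are self-adjoint.
   [{classic L}] only provides a choiceType structure to sum over. *)
Definition coprod_star (x : coprod_sort) : coprod_sort :=
  let f := qrepr unit_differences x in
  \sum_(l \in [set l : {classic L} | f l != 0]) coprod_inj (os_star (f l)).

(* The common class of all the units (and 0 if there is no summand). *)
Definition coprod_unit : coprod_sort :=
  xget 0 [set u | exists l, u = coprod_inj (os_unit (S l))].

(* The finite subset F of L is enumerated by an injection [l : 'I_m -> L].
   The condition does not depend on the decomposition of X: compatible states
   extend to larger F, and agree on the multiples of the common unit. *)
Definition coprod_pos n : set 'M[coprod_sort]_n :=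
  [set X | exists m (l : 'I_m -> L) (x : forall a, 'M[S (l a)]_n),
    [/\ injective l,
        X = \matrix_(i, j) \sum_a coprod_inj (x a i j) &
        forall omega : forall a, {linear lmx (S (l a)) n -> C},
          (forall a, state_mx (omega a)) ->
          (forall a b (A : 'M[C]_n),
            omega a (mxtensv A (os_unit (S (l a)))) =
            omega b (mxtensv A (os_unit (S (l b))))) ->
          0 <= \sum_a omega a (x a)]].

Definition coprod : opsys :=
  @Opsys coprod_sort coprod_star coprod_unit coprod_pos.

End coproduct.

(* [I_ k] labels the copies of the system of (k+1) x (k+1) matrices, so that the
   matrix sizes are the positive integers. *)
Definition frakC (I_ : nat -> Type) : opsys :=
  @coprod {k : nat & I_ k} (fun i => frakc (tag i).+1).

(* Algebraic tensor product: the free vector space on S x T modulo the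
   bilinearity relations. *)
Section tensor.
Variables S T : opsys.
Local Notation free := (dsum (fun _ : S * T => C : lmodType C)).

Definition bilinear_relations : set free :=
  [set w | (exists a s s' t, w = dsingle (a *: s + s', t) 1
             - (a *: dsingle (s, t) 1 + dsingle (s', t) 1)) \/
           (exists a s t t', w = dsingle (s, a *: t + t') 1
             - (a *: dsingle (s, t) 1 + dsingle (s, t') 1))].

Definition tensor := qspan bilinear_relations.

Definition tens (s : S) (t : T) : tensor :=
  qclass bilinear_relations (dsingle (s, t) 1).

Definition free_lift (U : lmodType C) (f : S -> T -> U) (w : free) : U :=
  \sum_(p \in [set: S * T]) w p *: f p.1 p.2.

(* The linear map S (x) T -> U induced by a bilinear f; see [tensor_liftE] and
   [tensor_lift_linear]. *)
Definition tensor_lift (U : lmodType C) (f : S -> T -> U) (z : tensor) : U :=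
  free_lift f (qrepr bilinear_relations z).

Section lift_theory.
Variables (U : lmodType C) (f : S -> T -> U).
Hypotheses (fl : forall t, linear (f^~ t)) (fr : forall s, linear (f s)).

Lemma free_liftP (w w' : free) a :
  free_lift f (a *: w + w') = a *: free_lift f w + free_lift f w'.
Proof.
set D := [set p | w p != 0] `|` [set p | w' p != 0].
have finD : finite_set D by rewrite finite_setU; split; exact: dsum_finite.
have E (v : free) : (forall p, v p != 0 -> D p) ->
    free_lift f v = \sum_(p <- fset_set D) v p *: f p.1 p.2.
  move=> vD; apply: fsbigTE => p; rewrite in_fset_set// => /negP pD.
  have [->|/vD Dp] := eqVneq (v p) 0; first by rewrite scale0r.
  by case: pD; apply/mem_set.
rewrite !E => [|p|p|p].
- rewrite scaler_sumr -big_split/=; apply: eq_bigr => p _.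
  by rewrite scalerA -scalerDl.
- by move=> ?; right.
- by move=> ?; left.
- have [w0|? _] := eqVneq (w p) 0; last by left.
  have [w'0|? _] := eqVneq (w' p) 0; last by right.
  by rewrite /= w0 w'0 scaler0 addr0 eqxx.
Qed.

Lemma free_lift_single s t : free_lift f (dsingle (s, t) 1) = f s t.
Proof.
rewrite /free_lift (fsbigTE [fset (s, t)]%fset); last first.
  move=> p; rewrite inE => /eqP pst; rewrite /= /dsingle_fun.
  by case: pselect => [e|_]; rewrite ?scale0r//; case: pst.
rewrite big_seq_fset1 /= /dsingle_fun; case: pselect => //= e.
by rewrite (Prop_irrelevance e erefl)/= scale1r.
Qed.

Lemma tensor_lift_class w :
  tensor_lift f (qclass bilinear_relations w) = free_lift f w.
Proof.
rewrite /tensor_lift; set w' := qrepr _ _.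
have : w' - w \in span bilinear_relations by apply/qclass_eq; rewrite qreprK.
have f0 : free_lift f 0 = 0.
  by have := free_liftP 0 0 (-1); rewrite scaler0 addr0 scaleN1r addNr.
move=> /asboolP ww'.
suff : free_lift f (w' - w) = 0.
  rewrite addrC -scaleN1r free_liftP scaleN1r addrC => /eqP.
  by rewrite subr_eq0 => /eqP.
apply: (_ : _ `<=` [set v | free_lift f v = 0]) ww'.
apply: smallest_sub; first split=> [//|a u v /= u0 v0].
  by rewrite free_liftP u0 v0 scaler0 addr0.
move=> _ [] [a [s [s' [t ->]]]]; rewrite /mkset -scaleN1r addrC !free_liftP
  !free_lift_single scaleN1r; last by rewrite fr addNr.
by rewrite fl addNr.
Qed.

Lemma tensor_liftE s t : tensor_lift f (tens s t) = f s t.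
Proof. by rewrite tensor_lift_class free_lift_single. Qed.

Lemma tensor_lift_linear : linear (tensor_lift f).
Proof.
move=> a x y; rewrite -[x in LHS]qreprK -[y in LHS]qreprK -linearP.
by rewrite tensor_lift_class free_liftP.
Qed.

End lift_theory.

Definition tensor_star (z : tensor) : tensor :=
  let w := qrepr bilinear_relations z in
  \sum_(p \in [set p | w p != 0]) (w p)^* *: tens (os_star p.1) (os_star p.2).

(* P (x) Q in M_{kl}(S (x) T). *)
Definition mxtens k l (P : 'M[S]_k) (Q : 'M[T]_l) : 'M[tensor]_(k * l) :=
  \matrix_(i, j) tens (P (mxtens_unindex i).1 (mxtens_unindex j).1)
                      (Q (mxtens_unindex i).2 (mxtens_unindex j).2).

(* phi (x) psi, with M_k (x) M_l = M_{kl} through Kronecker products. *)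
Definition tensor_map k l (phi : S -> 'M[C]_k) (psi : T -> 'M[C]_l) :
    tensor -> 'M[C]_(k * l) :=
  tensor_lift (fun s t => tensmx (phi s) (psi t)).

Lemma tensor_mapE k l (phi : {linear S -> Mat k}) (psi : {linear T -> Mat l})
    s t :
  tensor_map phi psi (tens s t) = tensmx (phi s) (psi t).
Proof.
apply: tensor_liftE => [t'|s'] a u v; rewrite linearP; apply/matrixP => i j.
  by rewrite !mxE mulrDl -mulrA.
by rewrite !mxE mulrDr mulrCA.
Qed.

Definition min_pos n : set 'M[tensor]_n :=
  [set X | forall k l (phi : {linear S -> Mat k}) (psi : {linear T -> Mat l}),
    ucp phi -> ucp psi ->
    os_pos (map_mx (tensor_map phi psi : tensor -> Mat (k * l)) X)].

Definition max_pos n : set 'M[tensor]_n :=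
  [set X | forall e : R, 0 < e ->
    exists k l (P : 'M[S]_k) (Q : 'M[T]_l) (A : 'M[C]_(n, k * l)),
      [/\ os_pos P, os_pos Q &
          X + mxtensv (e%:C%C)%:M (tens (os_unit S) (os_unit T)) =
          mxcongr A (mxtens P Q)]].

Definition min_tensor : opsys :=
  @Opsys tensor tensor_star (tens (os_unit S) (os_unit T)) min_pos.

Definition max_tensor : opsys :=
  @Opsys tensor tensor_star (tens (os_unit S) (os_unit T)) max_pos.

End tensor.

End operator_systems.

(* Main.v *)
From HB Require Import structures.
Require Import Defs.
From mathcomp Require Import all_boot all_order all_algebra.
From mathcomp Require Import all_classical all_reals all_analysis.
From mathcomp Require Import finmap complex mxtens ring lra.

(** The cones of the max tensor product are always contained in those of the min
    tensor product, since Kronecker products of positive matrices are positive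
    and the min cones are closed. The converse rests on the structure of the
    summands. An element of the system spanned by the [e_ij (x) 1] and
    [e_ij (x) t] is affine in [t], so it is positive as soon as its values at
    the two endpoints of [[0, 1]] are: the summands are direct sums of two full
    matrix algebras [M_k], and the generators used below are
    [e_ab (x) (1 - t)] and [e_ab (x) t].

    An element [X] of the tensor product with [B(H)] involves finitely many
    summands. Its coefficients form a block diagonal matrix [x] of operators, and
    [x] is determined up to adding [1 (x) y_a] to the block of the [a]-th summand
    with [sum_a y_a = 0], because only the units are identified in the coproduct
    ([null_blocks]). It suffices to make the blocks positive by such a change:
    a positive block is the Choi matrix of a completely positive map, and
    [sum_ab e_ab (x) q_ab] with [(q_ab)] positive has the form
    [alpha (P (x) Q) alpha^*] with [P = (e_ab)] and [Q = (q_ab)]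
    ([max_factorization]).

    The change exists by duality. The finite rank functionals on matrices of
    operators that vanish on [null_blocks] form a subspace, on which evaluation
    at [x] does not depend on the choice of [x]. If such a functional is
    nonnegative on positive matrices, the spectral theorem writes it as a sum of
    squares [z |-> sum_r <z v_r, v_r>] ([comb_sum_squares]). Its restrictions to
    the summands have Choi matrices which define completely positive maps into
    matrices, and these have the same value at all units because the functional
    vanishes on [null_blocks]. After a small perturbation that value is positive
    definite; normalising it to 1 yields a unital completely positive map on the
    coproduct ([coprod_ucp], [min_pos_choi]). Together with the compression of
    [B(H)] to a finite dimensional subspace, this map shows that a min-positive
    [X] gives the functional a nonnegative value ([blocks_pos]).

    By the extension theorem of M. Riesz ([riesz_extension]) the evaluation at
    [x] then extends to a functional which is nonnegative on all positive finite
    rank functionals; here every such functional is dominated by a weighted trace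
    that vanishes on [null_blocks]. The extension is the quadratic form of a
    positive matrix of bounded operators ([positive_extension]), because bounded
    sesquilinear forms on a Hilbert space come from operators
    ([form_operator]). This matrix agrees with [x] up to [null_blocks]
    ([min_decomposition]). *)

Set Implicit Arguments.
Unset Strict Implicit.
Unset Printing Implicit Defensive.

Import Order.TTheory GRing.Theory Num.Theory.
Import numFieldNormedType.Exports.

Local Open Scope classical_set_scope.
Local Open Scope ring_scope.

Local Notation Re := complex.Re.
Local Notation Im := complex.Im.

(** * Extension of positive functionals *)

Section riesz_extension.
Variables (R : realType) (V : lmodType R) (K M : set V) (f : V -> R).
Hypothesis K0 : K 0.
Hypothesis KD : forall u v, K u -> K v -> K (u + v).
Hypothesis KZ : forall a u, 0 <= a -> K u -> K (a *: u).
Hypothesis M_sub : subspace_of M.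
Hypothesis f_lin : forall a u v, M u -> M v -> f (a *: u + v) = a * f u + f v.
Hypothesis f_pos : forall u, M u -> K u -> 0 <= f u.
Hypothesis M_dom : forall v, exists2 m, M m & K (m - v).

(** Partial extensions are represented by their graphs. *)
Let admissible (G : set (V * R^o)) :=
  [/\ forall a u v, G u -> G v -> G (a *: u + v),
      forall u, M u -> G (u, f u) &
      forall u, G u -> K u.1 -> 0 <= u.2].

(** Positivity makes such a graph single valued. *)
Let adm_fun G : admissible G -> forall v r s, G (v, r) -> G (v, s) -> r = s.
Proof.
case=> Gl _ Gp v.
have le r s : G (v, r) -> G (v, s) -> r <= s.
  move=> Gr Gs; rewrite -subr_ge0.
  have := Gp _ (Gl (-1) _ _ Gr Gs); rewrite /= scaleN1r addNr => /(_ K0).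
  by rewrite addrC [(-1) *: _]mulN1r.
by move=> r s Gr Gs; apply/eqP; rewrite eq_le !le.
Qed.

Let adm_extend G v0 : admissible G -> (forall r, ~ G (v0, r)) ->
  exists2 G', admissible G' & G `<` G'.
Proof.
move=> aG Gv0; have [Gl GM Gp] := aG.
have M0 := M_sub.1.
have f0 : f 0 = 0.
  by have := f_lin (-1) M0 M0; rewrite scaler0 addr0 mulN1r addNr.
have G0 : G 0 by have := GM _ M0; rewrite f0.
(* An admissible value [c] at [v0] has to satisfy [- u.2 <= c] when
   [u.1 + v0] is in [K] and [c <= u.2] when [u.1 - v0] is in [K]; the supremum
   of the lower bounds does, because these two sums add up in [K]. *)
pose A : set R := [set - u.2 | u in [set u | G u /\ K (u.1 + v0)]].
have A0 : A !=set0.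
  have [m Mm Km] := M_dom (- v0).
  by exists (- f m), (m, f m) => //=; split; [exact: GM | rewrite -[v0]opprK].
have Aub (u : V * R^o) : G u -> K (u.1 - v0) -> ubound A u.2.
  move=> Gu Ku _ [w [Gw Kw] <-]; rewrite -subr_ge0 opprK.
  have := Gp _ (Gl 1 _ _ Gu Gw); rewrite scale1r /=; apply.
  by have := KD Ku Kw; rewrite addrACA addNr addr0.
have hA : has_sup A.
  split=> //; have [m Mm Km] := M_dom v0.
  by exists (f m); apply: (Aub (m, f m)) => //; exact: GM.
pose c := sup A.
have c1 u : G u -> K (u.1 + v0) -> 0 <= u.2 + c.
  move=> Gu Ku; rewrite -lerBlDl sub0r.
  by apply: (sup_upper_bound hA); exists u.
have c2 u : G u -> K (u.1 - v0) -> 0 <= u.2 - c.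
  move=> Gu Ku; rewrite subr_ge0; apply: ge_sup => //.
  exact: Aub.
exists [set w | exists u t, G u /\ w = (u.1 + t *: v0, u.2 + t * c)].
  split.
  - move=> a _ _ [u [t [Gu ->]]] [u' [t' [Gu' ->]]].
    exists (a *: u + u'), (a * t + t'); split; first exact: Gl.
    congr pair => /=.
      by rewrite scalerDr addrACA scalerA -scalerDl.
    by rewrite [a *: _](mulrDr a) addrACA mulrDl mulrA.
  - move=> u Mu; exists (u, f u), 0; split; first exact: GM.
    by rewrite scale0r mul0r !addr0.
  - move=> _ [u [t [Gu ->]]] /=.
    have [t0|t0|->] := ltgtP t 0.
    + move=> Ku; have ti : 0 <= (- t)^-1 by rewrite invr_ge0 oppr_ge0 ltW.
      have tn : (- t)^-1 * t = -1 by rewrite invrN mulNr mulVf// lt_eqF.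
      have Gw : G ((- t)^-1 *: u) by have := Gl (- t)^-1 _ _ Gu G0; rewrite addr0.
      have := c2 _ Gw; rewrite /= -[X in K (_ + X)]scaleN1r -tn -scalerA -scalerDr.
      move=> /(_ (KZ ti Ku)); rewrite -[X in _ - X]mul1r -mulNr -tn -mulrA.
      by rewrite -mulrDr pmulr_rge0// invr_gt0 oppr_gt0.
    + move=> Ku; have ti : 0 <= t^-1 by rewrite invr_ge0 ltW.
      have tn : t^-1 * t = 1 by rewrite mulVf// gt_eqF.
      have Gw : G (t^-1 *: u) by have := Gl t^-1 _ _ Gu G0; rewrite addr0.
      have := c1 _ Gw; rewrite /= -[X in K (_ + X)]scale1r -tn -scalerA -scalerDr.
      move=> /(_ (KZ ti Ku)); rewrite -[X in _ + X]mul1r -tn -mulrA.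
      by rewrite -mulrDr pmulr_rge0// invr_gt0.
    + by rewrite scale0r mul0r !addr0; exact: Gp.
split.
  move=> u Gu; exists u, 0; split=> //.
  by rewrite scale0r mul0r !addr0; case: u Gu.
move=> /(_ (v0, c)) /= H; apply: (Gv0 c); apply: H.
by exists 0, 1; split=> //=; rewrite scale1r mul1r !add0r.
Qed.

(** The extension theorem of M. Riesz: a functional on the subspace [M] which is
    nonnegative on [M] and [K] extends to a functional nonnegative on the cone
    [K], provided that every vector is dominated by an element of [M]. *)
Lemma riesz_extension : exists g : V -> R,
  [/\ forall a u v, g (a *: u + v) = a * g u + g v,
      forall u, M u -> g u = f u &
      forall u, K u -> 0 <= g u].
Proof.
pose G0 : set (V * R^o) := [set u | M u.1 /\ u.2 = f u.1].
have aG0 : admissible G0.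
  split=> //.
  - move=> a [u r] [v s] [/= Mu ->] [/= Mv ->]; split=> /=.
      exact: M_sub.2.
    by rewrite f_lin.
  - by move=> [u r] [/= Mu ->]; exact: f_pos.
pose P G := G = set0 \/ admissible G.
have [C PC tC|G [PG Gmax]] := @Zorn_bigcup _ P.
  have [[G CG aG]|nex] := pselect (exists2 G, C G & admissible G); last first.
    left; apply/seteqP; split=> // x [G CG Gx].
    by case: (PC _ CG) => [G0E|aG]; [rewrite G0E in Gx | case: nex; exists G].
  right; split.
  - move=> a u v [G1 CG1 Gu] [G2 CG2 Gv].
    have adm G' w : C G' -> G' w -> admissible G'.
      by move=> CG'; case: (PC _ CG') => [->|].
    have [a1 a2] := (adm _ _ CG1 Gu, adm _ _ CG2 Gv).
    case: (tC _ _ CG1 CG2) => s12.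
      by exists G2 => //; case: a2 => l _ _; apply: l => //; exact: s12.
    by exists G1 => //; case: a1 => l _ _; apply: l => //; exact: s12.
  - by move=> u Mu; exists G => //; case: aG => _ h _; exact: h.
  - move=> u [G1 CG1 Gu]; case: (PC _ CG1) => [G1E|[_ _ h]]; last exact: h.
    by rewrite G1E in Gu.
have aG : admissible G.
  case: PG => // GE; exfalso; apply: (Gmax G0); last by right.
  rewrite GE; split=> // /(_ (0, f 0)); apply; split=> //=; exact: M_sub.1.
have Gtot v : exists r, G (v, r).
  apply: contrapT => nG; have [|G' aG' GG'] := adm_extend (v0 := v) aG.
    by move=> r Gr; apply: nG; exists r.
  by apply: (Gmax _ GG'); right.
pose g v := projT1 (cid (Gtot v)).
have gP v : G (v, g v) by rewrite /g; case: cid.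
have [Gl GM Gp] := aG.
exists g; split.
- by move=> a u v; apply: (adm_fun aG (gP _)); exact: (Gl a (u, _) (v, _)).
- by move=> u Mu; apply: (adm_fun aG (gP _)); exact: GM.
- by move=> u; exact: (Gp (u, _)).
Qed.

End riesz_extension.

(** * Real parts, and inner products on a Hilbert space *)

Section real_part.
Variable R : realType.
Implicit Types (z : R[i]) (r : R).

Lemma ReD z z' : Re (z + z') = Re z + Re z'. Proof. by case: z; case: z'. Qed.
Lemma ReN z : Re (- z) = - Re z. Proof. by case: z. Qed.
Lemma Re0 : Re (0 : R[i]) = 0. Proof. by []. Qed.
Lemma ReZ r z : Re (r%:C%C * z) = r * Re z.
Proof. by case: z => a b /=; rewrite mul0r subr0. Qed.
Lemma Re_conj z : Re (z^*) = Re z.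
Proof. by case: z. Qed.
Lemma Re_sum (J : Type) (s : seq J) (P : pred J) (F : J -> R[i]) :
  Re (\sum_(j <- s | P j) F j) = \sum_(j <- s | P j) Re (F j).
Proof. exact: (big_morph _ ReD Re0). Qed.
Lemma Re_ge0 z : 0 <= z -> 0 <= Re z.
Proof. by rewrite lecE => /andP[]. Qed.
Lemma conj_real_complex r : (r%:C%C)^* = r%:C%C.
Proof. exact: conjc_real. Qed.
Lemma Re_i z : Re ('i%C * z) = - Im z.
Proof. by case: z => a b /=; rewrite mul0r mul1r sub0r. Qed.

Lemma conj_i : ('i%C : R[i])^* = - 'i%C.
Proof. by apply/eqP; rewrite eq_complex /= oppr0 !eqxx. Qed.

Lemma complex_eqP z z' : Re z = Re z' -> Re ('i%C * z) = Re ('i%C * z') -> z = z'.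
Proof.
by rewrite !Re_i; case: z z' => a b [c d] /= -> /oppr_inj ->.
Qed.

End real_part.

Section inner_product.
Variables (R : realType) (H : hilbert R).
Local Notation C := R[i].
Implicit Types x y z : H.

(** The inner product, linear in its first argument. *)
Definition ip x y : C := hil_dot H x y.

Lemma ipC x y : ip x y = (ip y x)^*.
Proof. by rewrite /ip hermC expr0 mul1r. Qed.
Lemma ipDl x y z : ip (x + y) z = ip x z + ip y z.
Proof. exact: linearDl. Qed.
Lemma ipZl a x z : ip (a *: x) z = a * ip x z.
Proof. exact: linearZl_LR. Qed.
Lemma ipDr x y z : ip z (x + y) = ip z x + ip z y.
Proof. by rewrite ipC ipDl rmorphD (ipC z x) (ipC z y). Qed.
Lemma ipZr a x z : ip z (a *: x) = a^* * ip z x.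
Proof. by rewrite ipC ipZl rmorphM (ipC z x). Qed.
Lemma ip0l z : ip 0 z = 0.
Proof. by rewrite -(scale0r (0 : H)) ipZl mul0r. Qed.
Lemma ip0r z : ip z 0 = 0.
Proof. by rewrite ipC ip0l rmorph0. Qed.
Lemma ipNl x z : ip (- x) z = - ip x z.
Proof. by rewrite -scaleN1r ipZl mulN1r. Qed.
Lemma ipNr x z : ip z (- x) = - ip z x.
Proof. by rewrite ipC ipNl rmorphN (ipC z x). Qed.
Lemma ip_suml (J : Type) (s : seq J) (P : pred J) (F : J -> H) z :
  ip (\sum_(j <- s | P j) F j) z = \sum_(j <- s | P j) ip (F j) z.
Proof. exact: (big_morph (ip^~ z) (fun x y => ipDl x y z) (ip0l z)). Qed.
Lemma ip_sumr (J : Type) (s : seq J) (P : pred J) (F : J -> H) z :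
  ip z (\sum_(j <- s | P j) F j) = \sum_(j <- s | P j) ip z (F j).
Proof. exact: (big_morph (ip z) (fun x y => ipDr x y z) (ip0r z)). Qed.
Lemma ip_norm x : `|x| ^+ 2 = ip x x. Proof. exact: hil_norm. Qed.
Lemma ip_ge0 x : 0 <= ip x x. Proof. by rewrite -ip_norm exprn_ge0. Qed.
Lemma ip_eq0 x : (ip x x == 0) = (x == 0).
Proof. by rewrite -ip_norm sqrf_eq0 normr_eq0. Qed.
Lemma ip_inj x y : (forall z, ip x z = ip y z) -> x = y.
Proof.
move=> xy; apply/eqP; rewrite -subr_eq0 -ip_eq0 ipDl ipNl.
by rewrite xy subrr.
Qed.

(** The squared norm as a real number. *)
Definition sqn x : R := Re (ip x x).

Lemma sqnE x : ip x x = (sqn x)%:C%C.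
Proof. by rewrite /sqn RRe_real// ger0_real ?ip_ge0. Qed.
Lemma sqn_ge0 x : 0 <= sqn x. Proof. exact/Re_ge0/ip_ge0. Qed.
Lemma sqnZ (r : R) x : sqn (r%:C%C *: x) = r ^+ 2 * sqn x.
Proof. by rewrite /sqn ipZl ipZr conj_real_complex !ReZ mulrA expr2. Qed.
Lemma Re_ip_sym x y : Re (ip x y) = Re (ip y x).
Proof. by rewrite [in LHS]ipC Re_conj. Qed.
Lemma sqnD x y : sqn (x + y) = sqn x + sqn y + 2 * Re (ip x y).
Proof. by rewrite /sqn ipDl !ipDr !ReD (Re_ip_sym y x); ring. Qed.
Lemma sqnN x : sqn (- x) = sqn x.
Proof. by rewrite /sqn ipNl ipNr opprK. Qed.

Lemma sqn_lt (x : H) (e : R) : 0 < e -> sqn x < e ^+ 2 -> `|x| < e%:C%C.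
Proof.
move=> e0 xe; have e0' : 0 <= e%:C%C by rewrite ler0c ltW.
rewrite -(@ltr_pXn2r _ 2) ?nnegrE//.
by rewrite ip_norm sqnE -rmorphXn/= ltcR.
Qed.

Lemma lt_sqn (x : H) (e : R) : 0 < e -> `|x| < e%:C%C -> sqn x < e ^+ 2.
Proof.
move=> e0; have e0' : 0 <= e%:C%C by rewrite ler0c ltW.
rewrite -(@ltr_pXn2r _ 2) ?nnegrE//.
by rewrite ip_norm sqnE -rmorphXn/= ltcR.
Qed.

(** The functional [f] is represented by the minimiser of
    [sqn x - 2 Re (f x)], which exists by the parallelogram law. *)
Lemma riesz_representation (f : H -> C) (c : R) :
  (forall a x y, f (a *: x + y) = a * f x + f y) ->
  (forall x, Re (f x) <= c * (1 + sqn x)) ->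
  exists w, forall x, f x = ip x w.
Proof.
move=> f_lin f_bd.
have fD x y : f (x + y) = f x + f y by rewrite -[x]scale1r f_lin mul1r scale1r.
have f0 : f 0 = 0.
  by have := f_lin (-1) 0 0; rewrite scaler0 addr0 mulN1r addNr.
have fZ a x : f (a *: x) = a * f x by rewrite -[a *: x]addr0 f_lin f0 addr0.
pose J x := sqn x - 2 * Re (f x).
have [c' [c'0 c'P]] : exists c', 0 < c' /\ forall x, Re (f x) <= c' * (1 + sqn x).
  exists (`|c| + 1); split=> [|x]; first by rewrite ltr_wpDl.
  apply: le_trans (f_bd x) _; rewrite ler_wpM2r ?addr_ge0 ?sqn_ge0//.
  by rewrite ler_wpDr// ler_norm.
have J_bd x : - (4 * c' ^+ 2) <= J x.
  have c20 : 0 < 2 * c' by rewrite mulr_gt0.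
  have := c'P ((2 * c')^-1%:C%C *: x); rewrite fZ ReZ sqnZ.
  rewrite -(ler_pM2l (mulr_gt0 c20 (ltr0n R 2))) => h.
  have E1 : 2 * c' * 2 * ((2 * c')^-1 * Re (f x)) = 2 * Re (f x).
    by field; rewrite ?gt_eqF// ltr0n.
  have E2 : 2 * c' * 2 * (c' * (1 + (2 * c')^-1 ^+ 2 * sqn x)) =
     4 * c' ^+ 2 + sqn x.
    by field; rewrite ?gt_eqF.
  rewrite E1 E2 in h; rewrite /J; lra.
pose A := range J.
have hA : has_inf A.
  split; first by exists (J 0), 0.
  by exists (- (4 * c' ^+ 2)) => _ [x _ <-].
pose d := inf A.
have dJ x : d <= J x by apply: (inf_lbound hA.2); exists x.
have xP n : exists x, J x < d + n.+1%:R^-1.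
  have n0 : 0 < n.+1%:R^-1 :> R by rewrite invr_gt0.
  by have [_ [x _ <-] xd] := inf_adherent n0 hA; exists x.
pose x_ n := projT1 (cid (xP n)).
have x_P n : J (x_ n) < d + n.+1%:R^-1 by rewrite /x_; case: cid.
(* By the parallelogram law the sets [J x < d + e] have small diameter. *)
have par x y e : J x < d + e -> J y < d + e -> sqn (x - y) <= 4 * e.
  move=> xe ye; have := dJ ((2^-1)%:C%C *: (x + y)).
  move: xe ye; rewrite /J sqnZ fZ ReZ fD ReD !sqnD sqnN ipNr ReN; lra.
have inv_near (e : R) : 0 < e -> \forall n \near \oo, n.+1%:R^-1 < e.
  by move=> e0; exact: (near_infty_natSinv_lt (PosNum e0)).
have cx : cvg (x_ @ \oo).
  apply: cauchy_cvg; apply: cauchy_exP => e e0; rewrite /fmapE -ball_normE /ball_.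
  have eE : e = (Re e)%:C%C by rewrite RRe_real// gtr0_real.
  have {}e0 : 0 < Re e by move: e0; rewrite eE ltcR.
  have e20 : 0 < Re e ^+ 2 / 8 by rewrite divr_gt0// exprn_gt0.
  have [N _ NP] := inv_near _ e20.
  exists (x_ N), N => // n /= Nn; rewrite eE; apply: sqn_lt => //.
  have xlt m : (N <= m)%N -> J (x_ m) < d + Re e ^+ 2 / 8.
    by move=> /NP /= mN; rewrite (lt_trans (x_P m))// ltrD2l.
  apply: le_lt_trans (par _ _ _ (xlt _ (leqnn N)) (xlt _ Nn)) _; lra.
pose w := lim (x_ @ \oo).
have lim_w (e : R) : 0 < e -> exists n, n.+1%:R^-1 + sqn (x_ n - w) < e.
  move=> e0; have s0 : 0 < Num.sqrt (e / 2) by rewrite sqrtr_gt0 divr_gt0.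
  have e20 : 0 < e / 2 by rewrite divr_gt0.
  have /cvgrPdist_lt/(_ (Num.sqrt (e / 2))%:C%C) : x_ @ \oo --> w by [].
  rewrite ltcR => /(_ s0) [N1 _ NP1]; have [N2 _ NP2] := inv_near _ e20.
  pose n := maxn N1 N2; exists n.
  have := NP2 n (leq_maxr _ _); have := NP1 n (leq_maxl _ _).
  rewrite /= distrC => /(lt_sqn s0); rewrite (sqr_sqrtr (ltW e20)).
  by rewrite -/n => h1 h2; rewrite (splitr e) ltrD.
(* [J] is almost minimal at [x_ n], so [t |-> J (x_ n + t x)] is almost minimal
   at [t = 0]; in the limit its derivative vanishes. *)
have key x : Re (f x) = Re (ip x w).
  pose D := Re (ip x w) - Re (f x).
  have D_ge (t : R) : 0 <= 2 * t ^+ 2 * sqn x + 2 * t * D.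
    apply/ler_addgt0Pr => e /lim_w[n nP].
    have Jle := dJ (x_ n + t%:C%C *: x).
    move: (n.+1%:R^-1) (x_P n) nP => a xle nP.
    have := sqn_ge0 ((x_ n - w) - t%:C%C *: x).
    rewrite sqnD sqnN ipNr ReN ipZr conj_real_complex ReZ sqnZ ipDl ReD ipNl ReN.
    move: Jle xle; rewrite /J sqnD fD fZ ReD ipZr conj_real_complex !ReZ sqnZ.
    rewrite /D -(Re_ip_sym w). lra.
  have D0 : D = 0.
    pose s := 2 * (sqn x + 1).
    have s0 : 0 < s by rewrite mulr_gt0// ltr_wpDl ?sqn_ge0.
    have := D_ge (- D / s).
    have -> : 2 * (- D / s) ^+ 2 * sqn x + 2 * (- D / s) * D =
        - (2 * (D / s) ^+ 2 * (sqn x + 2)).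
      by rewrite /s; field; rewrite gt_eqF// ltr_wpDl ?sqn_ge0.
    rewrite oppr_ge0 pmulr_lle0 ?ltr_wpDl ?sqn_ge0//.
    rewrite pmulr_rle0// => h.
    have : (D / s) ^+ 2 == 0 by rewrite eq_le h sqr_ge0.
    by rewrite sqrf_eq0 mulf_eq0 invr_eq0 (gt_eqF s0) orbF => /eqP.
  by move: D0; rewrite /D => /eqP; rewrite subr_eq0 => /eqP.
exists w => x; apply: complex_eqP => //.
by rewrite -fZ key ipZl.
Qed.

(** A bounded sesquilinear form is the form of a bounded operator. Only a bound
    by the sum of the squared norms is assumed; rescaling the two arguments by
    [s] and [s^-1] gives the usual bound by the product of the norms. *)
Lemma form_operator (q : H -> H -> C) (c : R) :
  (forall a x x' y, q (a *: x + x') y = a * q x y + q x' y) ->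
  (forall a x y y', q x (a *: y + y') = a^* * q x y + q x y') ->
  (forall x y, Re (q x y) <= c * (sqn x + sqn y)) ->
  exists Q : BH H, forall x y, ip (Q x) y = q x y.
Proof.
move=> ql qr q_bd.
have {c q_bd} [c c0 q_bd] : exists2 c, 0 < c &
    forall x y, Re (q x y) <= c * (sqn x + sqn y).
  exists (`|c| + 1) => [|x y]; first by rewrite ltr_wpDl.
  apply: le_trans (q_bd x y) _; rewrite ler_wpM2r ?addr_ge0 ?sqn_ge0//.
  by rewrite ler_wpDr// ler_norm.
have qZZ (s : R) x y : s != 0 ->
    q (s%:C%C *: x) (s^-1%:C%C *: y) = q x y.
  move=> s0.
  have q0l z : q 0 z = 0.
    by have := ql (-1) 0 0 z; rewrite scaler0 addr0 mulN1r addNr.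
  have q0r z : q z 0 = 0.
    by have := qr (-1) z 0 0; rewrite scaler0 addr0 rmorphN1 mulN1r addNr.
  rewrite -[s%:C%C *: x]addr0 ql q0l addr0.
  rewrite -[s^-1%:C%C *: y]addr0 qr q0r addr0 conj_real_complex mulrA.
  by rewrite -rmorphM/= mulfV// mul1r.
have wP x : exists w, forall y, ip w y = q x y.
  have [||w wP] := @riesz_representation (fun y => (q x y)^*) (c * (1 + sqn x)).
  - by move=> a y y'; rewrite qr rmorphD rmorphM/= conjCK.
  - move=> y; rewrite Re_conj (le_trans (q_bd x y))// -mulrA ler_wpM2l ?ltW//.
    have := mulr_ge0 (sqn_ge0 x) (sqn_ge0 y); rewrite mulrDl !mulrDr; lra.
  - by exists w => y; rewrite ipC -wP conjCK.
pose Q x := projT1 (cid (wP x)).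
have QP x y : ip (Q x) y = q x y by rewrite /Q; case: cid.
have Q_bd x : sqn (Q x) <= 4 * c ^+ 2 * sqn x.
  pose s := Num.sqrt (2 * c).
  have cc0 : 0 < 2 * c by rewrite mulr_gt0.
  have s0 : s != 0 by rewrite gt_eqF// sqrtr_gt0.
  have s2 : s ^+ 2 = 2 * c by rewrite sqr_sqrtr// ltW.
  have := q_bd (s%:C%C *: x) (s^-1%:C%C *: Q x).
  rewrite qZZ// -QP -/(sqn _) !sqnZ exprVn s2.
  have -> : c * (2 * c * sqn x + (2 * c)^-1 * sqn (Q x)) =
     2 * c ^+ 2 * sqn x + 2^-1 * sqn (Q x) by field; rewrite gt_eqF.
  lra.
have Qb : Q \in @is_bounded_operator R H.
  apply/asboolP; split.
    by move=> a x y; apply: ip_inj => z; rewrite ipDl ipZl !QP ql.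
  exists (2 * c)%:C%C => x; rewrite -(@ler_pXn2r _ 2) ?nnegrE ?mulr_ge0//.
    rewrite exprMn !ip_norm !sqnE -rmorphXn -rmorphM/= lecR.
    by rewrite exprMn -natrX (le_trans (Q_bd x))//.
  by rewrite ler0c mulr_ge0// ltW.
by exists (Bop Qb).
Qed.

(** Orthonormal families indexed by an initial segment. *)
Definition orthonormal l (e : 'I_l -> H) :=
  forall i j, ip (e i) (e j) = (i == j)%:R.

(** Gram-Schmidt: a finite family lies in the span of a finite orthonormal one. *)
Lemma orthonormal_basis (J : finType) (u : J -> H) :
  exists l (e : 'I_l -> H), orthonormal e /\
    exists c : J -> 'I_l -> C, forall p, u p = \sum_i c p i *: e i.
Proof.
have span_seq (s : seq H) : exists l (e : 'I_l -> H), orthonormal e /\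
    forall x, x \in s -> exists c : 'I_l -> C, x = \sum_i c i *: e i.
  elim: s => [|x s [l [e [oe es]]]].
    by exists 0, (fun=> 0); split=> // - [].
  pose y := x - \sum_i ip x (e i) *: e i.
  have xE : x = y + \sum_i ip x (e i) *: e i by rewrite subrK.
  have yo i : ip y (e i) = 0.
    rewrite /y ipDl ipNl ip_suml (bigD1 i)//= big1 => [|j ji].
      by rewrite ipZl oe eqxx mulr1 addr0 subrr.
    by rewrite ipZl oe (negPf ji) mulr0.
  have [y0|y0] := eqVneq y 0.
    exists l, e; split=> // z; rewrite inE => /predU1P[->|/es//].
    by exists (fun i => ip x (e i)); rewrite [LHS]xE y0 add0r.
  have ny : 0 < `|y| by rewrite normr_gt0.
  pose e' (i : 'I_l.+1) := oapp e (`|y|^-1 *: y) (unlift ord0 i).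
  have e'0 : e' ord0 = `|y|^-1 *: y by rewrite /e' unlift_none.
  have e'S i : e' (lift ord0 i) = e i by rewrite /e' liftK.
  exists l.+1, e'; split.
    move=> i j; have [i'|] := unliftP ord0 i; have [j'|] := unliftP ord0 j.
    - by move=> -> ->; rewrite !e'S oe (inj_eq lift_inj).
    - move=> -> ->; rewrite e'S e'0 ipZr ipC yo rmorph0 mulr0.
      by rewrite eq_sym (negPf (neq_lift _ _)).
    - move=> -> ->; rewrite e'S e'0 ipZl yo mulr0.
      by rewrite (negPf (neq_lift _ _)).
    - move=> -> ->; rewrite e'0 ipZl ipZr -ip_norm eqxx.
      rewrite conj_Creal ?realV ?normr_real// mulrA -invfM -expr2 mulVf//.
      by rewrite expf_neq0// gt_eqF.
  move=> z; rewrite inE => /predU1P[->|/es[c ->]].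
    exists (fun i => oapp (fun i => ip x (e i)) `|y| (unlift ord0 i)).
    rewrite big_ord_recl unlift_none/= e'0 scalerA mulfV ?gt_eqF// scale1r.
    rewrite [LHS]xE; congr (_ + _); apply: eq_bigr => i _.
    by rewrite liftK e'S.
  exists (fun i => oapp c 0 (unlift ord0 i)).
  rewrite big_ord_recl unlift_none/= scale0r add0r.
  by apply: eq_bigr => i _; rewrite liftK e'S.
have [l [e [oe es]]] := span_seq [seq u p | p <- enum J].
exists l, e; split=> //.
have cP p : exists c : 'I_l -> C, u p = \sum_i c i *: e i.
  by apply: es; apply: map_f; rewrite mem_enum.
by exists (fun p => projT1 (cid (cP p))) => p; case: cid.
Qed.

End inner_product.

(** * Factorization of positive matrices *)

Section positive_matrices.
Local Open Scope sesquilinear_scope.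
Variable R : realType.
Local Notation C := R[i].

(** Positivity of a matrix indexed by an arbitrary finite type. *)
Definition fpsd (J : finType) (Z : J -> J -> C) :=
  forall v : J -> C, 0 <= \sum_p \sum_q (v p)^* * Z p q * v q.

Lemma psd_herm n (A : 'M[C]_n) : psd A -> forall i j, A i j = (A j i)^*.
Proof.
move=> psdA.
pose dl i j : C := (i == j :> 'I_n)%:R.
have dlE i (F : 'I_n -> C) : \sum_j F j * dl i j = F i.
  rewrite (bigD1 i)//= big1 ?addr0 /dl ?eqxx ?mulr1// => j ji.
  by rewrite eq_sym (negPf ji) mulr0.
(* The form at [a e_i + b e_j]; comparing [(a, b) = (1, 1)] and [(1, 'i)] with
   the fact that its values are real identifies [A j i]. *)
have form a b i j : \sum_p \sum_q (a * dl i p + b * dl j p)^* * A p q *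
      (a * dl i q + b * dl j q) =
    a^* * a * A i i + a^* * b * A i j + b^* * a * A j i + b^* * b * A j j.
  have dlC x y : (dl x y)^* = dl x y by rewrite /dl rmorph_nat.
  transitivity (\sum_p (a * dl i p + b * dl j p)^* * (a * A p i + b * A p j)).
    apply: eq_bigr => p _; rewrite -[A p i](dlE i) -[A p j](dlE j).
    rewrite !mulr_sumr -big_split/= mulr_sumr; apply: eq_bigr => q _; ring.
  transitivity (\sum_p (a^* * (a * A p i + b * A p j)) * dl i p +
                \sum_p (b^* * (a * A p i + b * A p j)) * dl j p).
    rewrite -big_split/=; apply: eq_bigr => p _.
    by rewrite rmorphD !rmorphM/= !dlC; ring.
  rewrite !dlE; ring.
have real a b i j : (a^* * a * A i i + a^* * b * A i j + b^* * a * A j i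
    + b^* * b * A j j)^* = a^* * a * A i i + a^* * b * A i j + b^* * a * A j i
    + b^* * b * A j j.
  apply: conj_Creal; apply: ger0_real; rewrite -form; exact: psdA.
have diag i : (A i i)^* = A i i.
  have := real 1 0 i i; rewrite !rmorph0 !rmorph1 ?(mul0r, mulr0, mul1r, addr0).
  done.
move=> i j.
have h1 := real 1 1 i j.
have h2 := real 1 'i i j.
move: h1 h2; rewrite !(rmorphD, rmorphM)/= !conjCK !diag !rmorph1 conjCi !mul1r.
move=> h1 h2.
have i0 : 'i != 0 :> C by exact: neq0Ci.
have e1 : (A i j)^* + (A j i)^* = A i j + A j i.
  by apply: (addrI (A i i)); apply: (addIr (A j j)); rewrite !addrA.
have e2 : - (A i j)^* + (A j i)^* = A i j - A j i.
  apply: (mulfI i0); apply: (addrI (A i i)); apply: (addIr (A j j)).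
  have -> : A i i + 'i * (- (A i j)^* + (A j i)^*) + A j j =
    A i i + - 'i * (A i j)^* + 'i * (A j i)^* + A j j by ring.
  have -> : A i i + 'i * (A i j - A j i) + A j j =
    A i i + 'i * A i j + - 'i * A j i + A j j by ring.
  have i1 : - 'i * 'i = 1 :> C by rewrite mulNr -expr2 sqrCi opprK.
  by move: h2; rewrite (mulrC 'i (- 'i)) i1 !mul1r !mulr1.
have two : (2 : C) != 0 by rewrite pnatr_eq0.
apply: (mulfI two); transitivity ((A i j + A j i) + (A i j - A j i)); first ring.
rewrite -e1 -e2; ring.
Qed.

Lemma psd_factor n (A : 'M[C]_n) : psd A -> exists B : 'M[C]_n, A = B *m B ^t*.
Proof.
move=> psdA.
have Ah : A \is hermsymmx.
  apply/is_hermitianmxP; rewrite expr0 scale1r; apply/matrixP => i j.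
  by rewrite !mxE; exact: psd_herm.
have /hermitian_normalmx /orthomx_spectralP := Ah.
set P := spectralmx A; set D := spectral_diag A.
have Pu : P \is unitarymx := spectral_unitarymx A.
rewrite invmx_unitary// => AE.
have PAP : P *m A *m P ^t* = diag_mx D.
  rewrite AE !mulmxA (unitarymxP Pu) mul1mx -mulmxA (unitarymxP Pu) mulmx1//.
have D_ge0 i : 0 <= D 0 i.
  have := psdA (fun j => (P i j)^*).
  have -> : D 0 i = (P *m A *m P ^t*) i i by rewrite PAP mxE eqxx mulr1n.
  rewrite !mxE exchange_big/=; congr (0 <= _); apply: eq_bigr => k _.
  rewrite !mxE mulr_suml; apply: eq_bigr => j _.
  by rewrite conjCK.
pose sD : 'rV[C]_n := \row_i sqrtC (D 0 i).
exists (P ^t* *m diag_mx sD).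
rewrite trmx_mul map_mxM tr_diag_mx map_diag_mx/= map_trmx trmxK -map_mx_comp.
rewrite (map_mx_id (@conjCK _)) mulmxA -[_ *m diag_mx sD *m _]mulmxA mulmx_diag.
rewrite [LHS]AE; congr (_ *m diag_mx _ *m _).
apply/rowP => i; rewrite !mxE conj_Creal ?ger0_real ?sqrtC_ge0//.
by rewrite -expr2 sqrtCK.
Qed.

(** A matrix bounded below by a positive multiple [d] of the identity. *)
Lemma posdef_factor n (A : 'M[C]_n) (d : C) : 0 < d ->
  (forall v : 'I_n -> C, d * \sum_i (v i)^* * v i <=
     \sum_i \sum_j (v i)^* * A i j * v j) ->
  exists2 B : 'M[C]_n, B \in unitmx & A = B *m B ^t*.
Proof.
move=> d0 Ad.
have n0 (v : 'I_n -> C) i : 0 <= (v i)^* * v i by rewrite mulrC mul_conjC_ge0.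
have [|B AE] := @psd_factor _ A.
  move=> v; apply: le_trans (Ad v); apply: mulr_ge0; first exact: ltW.
  by apply: sumr_ge0 => i _; exact: n0.
exists B => //.
suff : A \in unitmx by rewrite AE unitmx_mul => /andP[].
rewrite -row_free_unit; apply: inj_row_free => v vA.
have := Ad (fun i => (v 0 i)^*); rewrite exchange_big/= [leRHS]big1 => [|j _].
  rewrite pmulr_rle0// => le0.
  have : \sum_i (v 0 i)^*^* * (v 0 i)^* == 0.
    by rewrite eq_le le0/= sumr_ge0// => i _; exact: (n0 (fun i => (v 0 i)^*)).
  rewrite psumr_eq0 => [/allP v0|i _]; last exact: (n0 (fun i => (v 0 i)^*)).
  apply/rowP => i; rewrite mxE; have := v0 i (mem_index_enum _).
  by rewrite /= conjCK mul_conjC_eq0 => /eqP.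
have /rowP/(_ j) := vA; rewrite !mxE => vAj.
rewrite -mulr_suml; under eq_bigr do rewrite conjCK.
by rewrite vAj mul0r.
Qed.

Lemma fpsd_factor (J : finType) (Z : J -> J -> C) : fpsd Z ->
  exists B : J -> J -> C, forall p q, Z p q = \sum_s B p s * (B q s)^*.
Proof.
move=> psdZ; pose A : 'M[C]_#|J| := \matrix_(i, j) Z (enum_val i) (enum_val j).
have [|B AE] := @psd_factor _ A.
  move=> v; have := psdZ (v \o enum_rank); congr (0 <= _).
  rewrite (reindex_onto enum_val enum_rank)/=; last by move=> *; rewrite enum_rankK.
  under eq_bigl do rewrite enum_valK eqxx.
  apply: eq_bigr => i _.
  rewrite (reindex_onto enum_val enum_rank)/=; last by move=> *; rewrite enum_rankK.
  under eq_bigl do rewrite enum_valK eqxx.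
  by apply: eq_bigr => j _; rewrite !enum_valK mxE.
exists (fun p q => B (enum_rank p) (enum_rank q)) => p q.
have /matrixP/(_ (enum_rank p) (enum_rank q)) := AE.
rewrite !mxE !enum_rankK => ->.
rewrite (reindex_onto enum_rank enum_val)/=; last by move=> *; rewrite enum_valK.
under eq_bigl do rewrite enum_rankK eqxx.
by apply: eq_bigr => s _; rewrite !mxE.
Qed.

End positive_matrices.

(** * Positive kernels *)

Lemma sum_pair (V : nmodType) (A B : finType) (F : A * B -> V) :
  \sum_k F k = \sum_a \sum_b F (a, b).
Proof. by rewrite pair_bigA; apply: eq_bigr => -[]. Qed.

Lemma sum_pair_fst (V : nmodType) (A B : finType) (F : A * B -> V) a :
  \sum_k (if k.1 == a then F k else 0) = \sum_b F (a, b).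
Proof.
rewrite sum_pair (bigD1 a)//= [X in _ + X]big1 ?addr0 => [|a' /negPf aa].
  by apply: eq_bigr => b _; rewrite eqxx.
by rewrite big1// => b _; rewrite aa.
Qed.

Section positive_kernels.
Variable R : realType.
Local Notation C := R[i].

Lemma fpsd_ext (J : finType) (Z Z' : J -> J -> C) :
  (forall p q, Z p q = Z' p q) -> fpsd Z -> fpsd Z'.
Proof.
move=> ZZ' Zp v; have := Zp v; congr (0 <= _).
by apply: eq_bigr => p _; apply: eq_bigr => q _; rewrite ZZ'.
Qed.

Lemma fpsd_congr (I J : finType) (A : I -> J -> C) (Z : J -> J -> C) : fpsd Z ->
  fpsd (fun i j => \sum_p \sum_q A i p * (A j q)^* * Z p q).
Proof.
move=> Zp v; have := Zp (fun p => \sum_i (A i p)^* * v i); congr (0 <= _).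
transitivity (\sum_p \sum_q \sum_i \sum_j
    (v i)^* * (A i p * (A j q)^* * Z p q) * v j).
  apply: eq_bigr => p _; apply: eq_bigr => q _.
  rewrite rmorph_sum mulr_suml mulr_suml; apply: eq_bigr => i _.
  rewrite mulr_sumr; apply: eq_bigr => j _.
  rewrite rmorphM/= conjCK; ring.
under eq_bigr do rewrite exchange_big/=.
rewrite exchange_big/=; apply: eq_bigr => i _.
transitivity (\sum_p \sum_j \sum_q (v i)^* * (A i p * (A j q)^* * Z p q) * v j).
  by apply: eq_bigr => p _; rewrite exchange_big.
rewrite exchange_big/=; apply: eq_bigr => j _.
rewrite mulr_sumr mulr_suml; apply: eq_bigr => p _.
by rewrite mulr_sumr mulr_suml.
Qed.

Lemma fpsd_comp (I J : finType) (f : I -> J) (Z : J -> J -> C) : fpsd Z ->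
  fpsd (fun i j => Z (f i) (f j)).
Proof.
move=> /(fpsd_congr (fun i p => (p == f i)%:R)); apply: fpsd_ext => i j.
rewrite (bigD1 (f i))//= [X in _ + X]big1 ?addr0 => [|p /negPf pi]; last first.
  by rewrite big1// => q _; rewrite pi !mul0r.
rewrite (bigD1 (f j))//= [X in _ + X]big1 ?addr0 => [|q /negPf qj].
  by rewrite !eqxx rmorph_nat !mul1r.
by rewrite qj rmorph_nat mulr0 mul0r.
Qed.

Lemma fpsd_sum (I J : finType) (Z : I -> J -> J -> C) : (forall i, fpsd (Z i)) ->
  fpsd (fun p q => \sum_i Z i p q).
Proof.
move=> Zp v; have : 0 <= \sum_i \sum_p \sum_q (v p)^* * Z i p q * v q.
  by apply: sumr_ge0 => i _; exact: Zp.
congr (0 <= _); rewrite exchange_big/=; apply: eq_bigr => p _.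
rewrite exchange_big/=; apply: eq_bigr => q _.
by rewrite mulr_sumr mulr_suml.
Qed.

Lemma fpsdD (J : finType) (Z Z' : J -> J -> C) : fpsd Z -> fpsd Z' ->
  fpsd (fun p q => Z p q + Z' p q).
Proof.
move=> Zp Zp' v; have := addr_ge0 (Zp v) (Zp' v); congr (0 <= _).
rewrite -big_split/=; apply: eq_bigr => p _; rewrite -big_split/=.
by apply: eq_bigr => q _; rewrite mulrDr mulrDl.
Qed.

Lemma fpsdZ (J : finType) (a : C) (Z : J -> J -> C) : 0 <= a -> fpsd Z ->
  fpsd (fun p q => a * Z p q).
Proof.
move=> a0 Zp v; have := mulr_ge0 a0 (Zp v); congr (0 <= _).
rewrite mulr_sumr; apply: eq_bigr => p _; rewrite mulr_sumr.
by apply: eq_bigr => q _; ring.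
Qed.

Lemma fpsd_rank_one (J : finType) (b : J -> C) : fpsd (fun p q => b p * (b q)^*).
Proof.
move=> v; have : 0 <= (\sum_p (v p)^* * b p) * (\sum_p (v p)^* * b p)^*.
  exact: mul_conjC_ge0.
congr (0 <= _); rewrite mulr_suml; apply: eq_bigr => p _.
rewrite rmorph_sum mulr_sumr; apply: eq_bigr => q _.
rewrite rmorphM/= conjCK; ring.
Qed.

Lemma fpsd_id (J : finType) : fpsd (fun p q : J => (p == q)%:R : C).
Proof.
move=> v; have : 0 <= \sum_p v p * (v p)^*.
  by apply: sumr_ge0 => p _; exact: mul_conjC_ge0.
congr (0 <= _); apply: eq_bigr => p _.
rewrite (bigD1 p)//= big1 ?addr0 => [|q /negPf qp].
  by rewrite eqxx mulr1 mulrC.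
by rewrite eq_sym qp mulr0 mul0r.
Qed.

(** Contraction of two positive kernels along a common index: the Schur product
    theorem in block form. *)
Lemma fpsd_contract (I J K : finType) (X : I * K -> I * K -> C)
    (Z : K * J -> K * J -> C) : fpsd X -> fpsd Z ->
  fpsd (fun p q : I * J =>
    \sum_a \sum_b X (p.1, a) (q.1, b) * Z (a, p.2) (b, q.2)).
Proof.
move=> /fpsd_factor[B BE] Zp.
have : fpsd (fun p q : I * J => \sum_r \sum_k \sum_k'
   ((k.2 == p.2)%:R * B (p.1, k.1) r) * ((k'.2 == q.2)%:R * B (q.1, k'.1) r)^* * Z k k').
  by apply: fpsd_sum => r; apply: fpsd_congr.
apply: fpsd_ext => -[i j] [i' j'] /=.
transitivity (\sum_a \sum_b \sum_r B (i, a) r * (B (i', b) r)^* * Z (a, j) (b, j')).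
  transitivity (\sum_r \sum_a \sum_b B (i, a) r * (B (i', b) r)^* * Z (a, j) (b, j')).
    apply: eq_bigr => r _; rewrite sum_pair; apply: eq_bigr => a _.
    rewrite (bigD1 j)//= [X in _ + X]big1 ?addr0 => [|l /negPf lj]; last first.
      by rewrite big1// => k' _; rewrite lj !mul0r.
    rewrite sum_pair; apply: eq_bigr => b _.
    rewrite (bigD1 j')//= [X in _ + X]big1 ?addr0 => [|l /negPf lj].
      by rewrite !eqxx !mul1r.
    by rewrite lj mul0r rmorph0 mulr0 mul0r.
  rewrite exchange_big/=; apply: eq_bigr => a _.
  by rewrite exchange_big.
apply: eq_bigr => a _; apply: eq_bigr => b _.
by rewrite BE mulr_suml.
Qed.

Lemma fpsd_kron (I J : finType) (X : I -> I -> C) (Z : J -> J -> C) :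
  fpsd X -> fpsd Z -> fpsd (fun p q : I * J => X p.1 q.1 * Z p.2 q.2).
Proof.
move=> Xp Zp.
have h1 := fpsd_comp (fun k : I * unit => k.1) Xp.
have h2 := fpsd_comp (fun k : unit * J => k.2) Zp.
apply: fpsd_ext (fpsd_contract h1 h2) => p q.
by rewrite !(big_pred1 tt) => [|[]|[]].
Qed.

(** The cone of nonnegative reals is closed. *)
Lemma complex_limit (z w : C) : (forall d : R, 0 < d -> 0 <= z + d%:C%C * w) -> 0 <= z.
Proof.
move=> zw; have i1 := zw 1 ltr01; have i2 := zw 2 (ltr0n _ 2).
case: z w zw i1 i2 => a b [c d] zw; rewrite !lecE /=.
rewrite !mul0r !addr0 => /andP[/eqP h1 _] /andP[/eqP h2 _].
have -> : b = 0 by lra.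
rewrite eqxx/=; apply/ler_addgt0Pr => e e0.
have c1 : 0 < `|c| + 1 by rewrite ltr_wpDl.
have := zw (e / (`|c| + 1)) (divr_gt0 e0 c1).
rewrite lecE /= !mul0r subr0 => /andP[_ h].
apply: le_trans h _; rewrite lerD2l mulrAC ler_pdivrMr//.
apply: ler_wpM2l; first exact: ltW.
by rewrite (le_trans (ler_norm c))// lerDl.
Qed.

(** The cone of positive kernels is closed. *)
Lemma fpsd_limit (J : finType) (Z D : J -> J -> C) :
  (forall d : R, 0 < d -> fpsd (fun p q => Z p q + d%:C%C * D p q)) -> fpsd Z.
Proof.
move=> ZD v; apply: (@complex_limit _ (\sum_p \sum_q (v p)^* * D p q * v q)) => d d0.
have := ZD d d0 v; congr (0 <= _).
rewrite mulr_sumr -big_split/=; apply: eq_bigr => p _.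
rewrite mulr_sumr -big_split/=; apply: eq_bigr => q _; ring.
Qed.

Lemma psd_mxflat n k (Y : 'M['M[C]_k]_n) :
  psd (mxflat (Y : 'M[lmx C k]_n)) <->
  fpsd (fun p q : 'I_n * 'I_k => Y p.1 q.1 p.2 q.2).
Proof.
split=> [Yp|Yp].
  apply: fpsd_ext (fpsd_comp (@mxtens_index n k) (Yp : fpsd _)) => p q.
  by rewrite mxE !mxtens_indexK.
apply: fpsd_ext (fpsd_comp (@mxtens_unindex n k) Yp) => p q.
by rewrite mxE.
Qed.

End positive_kernels.

Lemma fpsd_congr_snd (R : realType) (I J J' : finType) (A : J' -> J -> R[i])
    (Z : I * J -> I * J -> R[i]) : fpsd Z ->
  fpsd (fun P Q : I * J' => \sum_s \sum_t A P.2 s * (A Q.2 t)^* * Z (P.1, s) (Q.1, t)).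
Proof.
move=> /(fpsd_congr (fun (P : I * J') (Q : I * J) => (P.1 == Q.1)%:R * A P.2 Q.2)).
apply: fpsd_ext => -[a s] [b t] /=.
rewrite sum_pair (bigD1 a)//= [X in _ + X]big1 ?addr0 => [|a' /negPf aa]; last first.
  by rewrite big1// => i _; rewrite big1// => k _; rewrite eq_sym aa !mul0r.
apply: eq_bigr => i _.
rewrite sum_pair (bigD1 b)//= [X in _ + X]big1 ?addr0 => [|b' /negPf bb]; last first.
  by rewrite big1// => j _; rewrite (eq_sym b) bb mul0r rmorph0 mulr0 mul0r.
by apply: eq_bigr => j _; rewrite !eqxx !mul1r.
Qed.

(** * Bounded operators *)

Section bounded_operators.
Variables (R : realType) (H : hilbert R).
Local Notation C := R[i].
Implicit Types A B : bop H.

Lemma bopP A a x y : A (a *: x + y) = a *: A x + A y.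
Proof. by case: A => A /= /asboolP[lA _]; exact: lA. Qed.
Lemma bop0 A : A 0 = 0.
Proof. by have := bopP A (-1) 0 0; rewrite scaler0 addr0 scaleN1r addNr. Qed.
Lemma bopD A x y : A (x + y) = A x + A y.
Proof. by rewrite -[x in LHS]scale1r bopP scale1r. Qed.
Lemma bopZ A a x : A (a *: x) = a *: A x.
Proof. by rewrite -[a *: x in LHS]addr0 bopP bop0 addr0. Qed.
Lemma bop_sum A (K : Type) (s : seq K) (P : pred K) (F : K -> H) :
  A (\sum_(j <- s | P j) F j) = \sum_(j <- s | P j) A (F j).
Proof. exact: (big_morph A (bopD A) (bop0 A)). Qed.
Lemma bop_DE A B x : (A + B) x = A x + B x.
Proof. by rewrite -[LHS]/(val (A + B) x) raddfD. Qed.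
Lemma bop_ZE a A x : (a *: A) x = a *: A x.
Proof. by rewrite -[LHS]/(val (a *: A) x) linearZ. Qed.
Lemma bop_0E x : (0 : bop H) x = 0.
Proof. by rewrite -[LHS]/(val (0 : bop H) x) raddf0. Qed.
Lemma bop_NE A x : (- A) x = - A x.
Proof. by rewrite -[LHS]/(val (- A) x) raddfN. Qed.
Lemma bop_sumE (K : Type) (s : seq K) (P : pred K) (F : K -> bop H) x :
  (\sum_(j <- s | P j) F j) x = \sum_(j <- s | P j) F j x.
Proof.
exact: (big_morph (fun A : bop H => A x) (fun A B => bop_DE A B x) (bop_0E x)).
Qed.

Lemma bop_eqP A B : (forall x, A x = B x) -> A = B.
Proof. by move=> AB; apply/val_inj/funext. Qed.

Lemma bop_sqn A : exists M : R, forall x, sqn (A x) <= M * sqn x.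
Proof.
case: A => A /= /asboolP[_ [M MP]].
have M2 : (Re (`|M| ^+ 2))%:C%C = `|M| ^+ 2.
  by apply: RRe_real; apply: ger0_real; apply: exprn_ge0.
exists (Re (`|M| ^+ 2)) => x; rewrite -lecR rmorphM/= M2 -!sqnE.
rewrite -!ip_norm -exprMn lerXn2r ?nnegrE ?mulr_ge0//.
have Mx : 0 <= M * `|x| by apply: le_trans (MP x).
by rewrite (le_trans (MP x))// -(ger0_norm Mx) normrM normr_id.
Qed.

Lemma ip_CauchySchwarz (x b : H) : `|ip x b| ^+ 2 <= ip x x * ip b b.
Proof.
have [->|b0] := eqVneq b 0; first by rewrite !ip0r normr0 expr0n mulr0.
have bb : 0 < ip b b by rewrite lt_def ip_eq0 b0 ip_ge0.
have bC : (ip b b)^* = ip b b by rewrite conj_Creal// gtr0_real.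
rewrite -(ler_pM2l bb) -subr_ge0.
have -> : ip b b * (ip x x * ip b b) - ip b b * `|ip x b| ^+ 2 =
   ip (ip b b *: x - ip x b *: b) (ip b b *: x - ip x b *: b).
  rewrite !(ipDl, ipDr, ipNl, ipNr, ipZl, ipZr) bC normCK (ipC b x); ring.
exact: ip_ge0.
Qed.

(** The operator [h |-> <h, b> a]. *)
Lemma rank_one (a b : H) : exists A : bop H, forall h, A h = ip h b *: a.
Proof.
pose A h := ip h b *: a.
have Ab : A \in @is_bounded_operator R H.
  apply/asboolP; split=> [c x y|].
    by rewrite /A ipDl ipZl scalerDl scalerA.
  exists (`|a| * `|b|) => x; rewrite -(@ler_pXn2r _ 2) ?nnegrE ?mulr_ge0//.
  rewrite normrZ !exprMn.
  have -> : `|a| ^+ 2 * `|b| ^+ 2 * `|x| ^+ 2 = `|x| ^+ 2 * `|b| ^+ 2 * `|a| ^+ 2.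
    ring.
  by rewrite ler_wpM2r ?exprn_ge0// !ip_norm ip_CauchySchwarz.
by exists (Bop Ab).
Qed.

End bounded_operators.

(** * Matrices of operators and their quadratic forms *)

Section operator_matrices.
Variables (R : realType) (H : hilbert R) (J : finType).
Local Notation C := R[i].
Local Notation Y := (J -> J -> bop H).
Implicit Types (y : Y) (u v : J -> H).

(** The sesquilinear form on [H^J] of a matrix of operators. *)
Definition opform y u v : C := \sum_p \sum_q ip (y p q (u q)) (v p).

(** Positive matrices of operators. *)
Definition oppos y := forall u, 0 <= opform y u u.

Lemma opformDl y u u' v : opform y (u + u') v = opform y u v + opform y u' v.
Proof.
rewrite /opform -big_split; apply: eq_bigr => p _; rewrite -big_split/=.
by apply: eq_bigr => q _; rewrite bopD ipDl.
Qed.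
Lemma opformDr y u v v' : opform y u (v + v') = opform y u v + opform y u v'.
Proof.
rewrite /opform -big_split; apply: eq_bigr => p _; rewrite -big_split/=.
by apply: eq_bigr => q _; rewrite ipDr.
Qed.
Lemma opformZl y a u v : opform y (a *: u) v = a * opform y u v.
Proof.
rewrite /opform mulr_sumr; apply: eq_bigr => p _; rewrite mulr_sumr.
by apply: eq_bigr => q _; rewrite bopZ ipZl.
Qed.
Lemma opformZr y a u v : opform y u (a *: v) = a^* * opform y u v.
Proof.
rewrite /opform mulr_sumr; apply: eq_bigr => p _; rewrite mulr_sumr.
by apply: eq_bigr => q _; rewrite ipZr.
Qed.
Lemma opformNl y u v : opform y (- u) v = - opform y u v.
Proof. by rewrite -scaleN1r opformZl mulN1r. Qed.
Lemma opformNr y u v : opform y u (- v) = - opform y u v.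
Proof. by rewrite -scaleN1r opformZr rmorphN1 mulN1r. Qed.
(** The vector of [H^J] with single entry [h] in position [p]. *)
Definition at_ (p : J) (h : H) : J -> H := fun q => if q == p then h else 0.

Lemma at_linear p a h h' : at_ p (a *: h + h') = a *: at_ p h + at_ p h'.
Proof.
apply/funext => q; rewrite /at_ -[RHS]/(a *: at_ p h q + at_ p h' q) /at_.
by case: eqP; rewrite // scaler0 addr0.
Qed.

Lemma at_sum u : u = \sum_p at_ p (u p).
Proof.
apply/funext => q; rewrite fct_sumE (bigD1 q)//= big1 => [|p pq].
  by rewrite addr0 /at_ eqxx.
by rewrite /at_ eq_sym (negPf pq).
Qed.

Lemma opform_at y p q h h' : opform y (at_ q h) (at_ p h') = ip (y p q h) h'.
Proof.
rewrite /opform (bigD1 p)//= [X in _ + X]big1 => [|p' pp'].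
  rewrite (bigD1 q)//= [X in _ + X + _]big1 => [|q' qq'].
    by rewrite !addr0 /at_ !eqxx.
  by rewrite /at_ (negPf qq') bop0 ip0l.
by rewrite big1// => q' _; rewrite /at_ (negPf pp') ip0r.
Qed.

(** Finite real combinations of the quadratic forms [y |-> <y u, u>]. *)
Definition comb (s : seq (R * (J -> H))) y : C :=
  \sum_(r <- s) r.1%:C%C * opform y r.2 r.2.

Lemma comb_cat s s' y : comb (s ++ s') y = comb s y + comb s' y.
Proof. by rewrite /comb big_cat. Qed.

(** A combination which is nonnegative on positive matrices is a sum of
    squares, by the spectral theorem on the span of the vectors involved. *)
Lemma comb_sum_squares (s : seq (R * (J -> H))) :
  (forall y, oppos y -> 0 <= Re (comb s y)) ->
  exists (S : finType) (v : S -> J -> H),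
    forall y, comb s y = \sum_t opform y (v t) (v t).
Proof.
move=> s_pos; pose n := size s.
pose c (r : 'I_n) := (tnth (in_tuple s) r).1.
pose u (r : 'I_n) := (tnth (in_tuple s) r).2.
have combE y : comb s y = \sum_r (c r)%:C%C * opform y (u r) (u r).
  by rewrite /comb big_tnth.
have [l [e [oe [a aP]]]] := orthonormal_basis (fun rp : 'I_n * J => u rp.1 rp.2).
have {}aP r p : u r p = \sum_i a (r, p) i *: e i by rewrite -aP.
pose Z (k k' : J * 'I_l) : C := \sum_r (c r)%:C%C * a (r, k.1) k.2 * (a (r, k'.1) k'.2)^*.
have expand (b b' : J * 'I_l -> C) y :
    opform y (fun q => \sum_j b (q, j) *: e j) (fun p => \sum_i b' (p, i) *: e i) =
    \sum_k \sum_k' b k * (b' k')^* * ip (y k'.1 k.1 (e k.2)) (e k'.2).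
  rewrite /opform exchange_big/= sum_pair; apply: eq_bigr => q _.
  under [RHS]eq_bigr do rewrite sum_pair.
  rewrite [RHS]exchange_big/=; apply: eq_bigr => p _.
  rewrite bop_sum ip_suml; apply: eq_bigr => j _.
  rewrite ip_sumr; apply: eq_bigr => i _.
  by rewrite bopZ ipZl ipZr mulrA.
have ZE y : comb s y = \sum_k \sum_k' Z k k' * ip (y k'.1 k.1 (e k.2)) (e k'.2).
  transitivity (\sum_r \sum_k \sum_k' (c r)%:C%C * a (r, k.1) k.2 *
      (a (r, k'.1) k'.2)^* * ip (y k'.1 k.1 (e k.2)) (e k'.2)).
    rewrite combE; apply: eq_bigr => r _.
    have uE : u r = fun p => \sum_i a (r, p) i *: e i.
      by apply/funext => p; exact: aP.
    rewrite uE (expand (fun k => a (r, k.1) k.2) (fun k => a (r, k.1) k.2)).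
    rewrite mulr_sumr; apply: eq_bigr => k _.
    by rewrite mulr_sumr; apply: eq_bigr => k' _; rewrite !mulrA.
  rewrite exchange_big/=; apply: eq_bigr => k _.
  rewrite exchange_big/=; apply: eq_bigr => k' _.
  by rewrite /Z mulr_suml.
(* Test [s] on the matrices of rank one operators [h |-> <h, b q> b p]. *)
have Zpsd : fpsd Z.
  move=> v; pose b p : H := \sum_i v (p, i) *: e i.
  pose y : Y := fun p q => projT1 (cid (rank_one (b p) (b q))).
  have yE p q h : y p q h = ip h (b q) *: b p by rewrite /y; case: cid.
  have be p i : ip (b p) (e i) = v (p, i).
    rewrite /b ip_suml (bigD1 i)//= big1 => [|j ji].
      by rewrite ipZl oe eqxx mulr1 addr0.
    by rewrite ipZl oe (negPf ji) mulr0.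
  have ypos : oppos y.
    move=> h; suff -> : opform y h h =
        (\sum_q ip (h q) (b q)) * (\sum_q ip (h q) (b q))^*.
      exact: mul_conjC_ge0.
    rewrite /opform exchange_big/= mulr_suml; apply: eq_bigr => q _.
    rewrite rmorph_sum mulr_sumr; apply: eq_bigr => p _.
    by rewrite yE ipZl (ipC (b p) (h p)).
  have -> : \sum_k \sum_k' (v k)^* * Z k k' * v k' = comb s y.
    rewrite ZE; apply: eq_bigr => -[q j] _; apply: eq_bigr => -[p i] _ /=.
    by rewrite yE ipZl be (ipC (e j)) be mulrA [_ * (v _)^*]mulrC.
  have real : comb s y \is Num.real.
    apply: rpred_sum => r _; apply: rpredM; last exact/ger0_real/ypos.
    by apply/complex_realP; exists r.1.
  by rewrite -(RRe_real real) ler0c s_pos.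
have [B BE] := fpsd_factor Zpsd.
exists (J * 'I_l)%type, (fun t p => \sum_i B (p, i) t *: e i) => y.
rewrite ZE.
transitivity (\sum_t \sum_k \sum_k' B k t * (B k' t)^* *
    ip (y k'.1 k.1 (e k.2)) (e k'.2)); last first.
  by apply: eq_bigr => t _; rewrite (expand (B^~ t) (B^~ t)).
rewrite [RHS]exchange_big/=; apply: eq_bigr => k _.
rewrite [RHS]exchange_big/=; apply: eq_bigr => k' _.
by rewrite BE mulr_suml.
Qed.

End operator_matrices.

(** * Positive extension of a matrix of operators *)

Section spanned_values.
Variables (K : pzRingType) (V : lmodType K) (E : set V).
Implicit Types u v : spanned E.

Lemma spanned_valD u v : spanned_val (u + v) = spanned_val u + spanned_val v.
Proof. exact: (raddfD (\val : spanned E -> V)). Qed.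
Lemma spanned_valN u : spanned_val (- u) = - spanned_val u.
Proof. exact: (raddfN (\val : spanned E -> V)). Qed.
Lemma spanned_valZ a u : spanned_val (a *: u) = a *: spanned_val u.
Proof. exact: (linearZ_LR (\val : spanned E -> V)). Qed.
Lemma spanned_val0 : spanned_val (0 : spanned E) = 0.
Proof. exact: (raddf0 (\val : spanned E -> V)). Qed.

End spanned_values.

Section extension.
Variables (R : realType) (H : hilbert R) (J : finType).
Local Notation C := R[i].
Local Notation Y := (J -> J -> bop H).
Variables (N : set Y) (x : Y) (w : J -> R).
Implicit Types (y z : Y) (u v : J -> H) (s : seq (R * (J -> H))).
Hypothesis N_i : forall z, N z -> N (fun p q => 'i%C *: z p q).
Hypothesis w_gt0 : forall p, 0 < w p.
Hypothesis N_w : forall z h, N z -> \sum_p (w p)%:C%C * ip (z p p h) h = 0.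
Hypothesis x_pos : forall (S : finType) (v : S -> J -> H),
  (forall z, N z -> \sum_t opform z (v t) (v t) = 0) ->
  0 <= \sum_t opform x (v t) (v t).

(** The quadratic form of [u] as a real function of the matrix. *)
Let qfun u : Y -> R^o := fun y => Re (opform y u u).
Let qfuns : set (Y -> R^o) := range qfun.
Local Notation W := (spanned qfuns).
Let qW u : W := Spanned (mem_span (imageT qfun u)).

Let W_comb (f : W) : exists s, forall y, spanned_val f y = Re (comb s y).
Proof.
case: f => f /= /asboolP.
apply: (_ : _ `<=` [set f : Y -> R^o | exists s, forall y, f y = Re (comb s y)]).
apply: smallest_sub; first split.
- by exists [::] => y; rewrite /comb big_nil.
- move=> a f1 f2 [s1 E1] [s2 E2].
  exists ([seq (a * r.1, r.2) | r <- s1] ++ s2) => y.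
  rewrite -[LHS]/(a * f1 y + f2 y) E1 E2 comb_cat ReD; congr (_ + _).
  rewrite /comb big_map -ReZ mulr_sumr; congr (Re _); apply: eq_bigr => r _.
  by rewrite rmorphM/= mulrA.
- move=> _ [u _ <-]; exists [:: (1, u)] => y.
  by rewrite /comb big_seq1 mul1r.
Qed.

Let WP (f f' : W) : (forall y, spanned_val f y = spanned_val f' y) -> f = f'.
Proof. by move=> ff'; apply/val_inj/funext. Qed.

Let WD (f f' : W) y : spanned_val (f + f') y = spanned_val f y + spanned_val f' y.
Proof. by rewrite (spanned_valD f f'). Qed.
Let WN (f : W) y : spanned_val (- f) y = - spanned_val f y.
Proof. by rewrite (spanned_valN f). Qed.
Let WZ (a : R) (f : W) y : spanned_val (a *: f) y = a * spanned_val f y.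
Proof. by rewrite (spanned_valZ a f). Qed.
Let W0 y : spanned_val (0 : W) y = 0.
Proof. by rewrite spanned_val0. Qed.
Let W_sum (K : Type) (r : seq K) (P : pred K) (F : K -> W) y :
  spanned_val (\sum_(j <- r | P j) F j) y = \sum_(j <- r | P j) spanned_val (F j) y.
Proof.
exact: (big_morph (fun f : W => spanned_val f y) (fun f f' => WD f f' y) (W0 y)).
Qed.

(** The cone of the combinations that are nonnegative on positive matrices, and
    the subspace of those that vanish on [N]. *)
Let K : set W := [set f : W | forall y, oppos y -> 0 <= (spanned_val f y : R)].
Let M : set W := [set f : W | forall z, N z -> spanned_val f z = 0].

Let comb_i s z : comb s (fun p q => 'i%C *: z p q) = 'i%C * comb s z.
Proof.
rewrite /comb mulr_sumr; apply: eq_bigr => r _; rewrite mulrCA; congr (_ * _).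
rewrite /opform mulr_sumr; apply: eq_bigr => p _; rewrite mulr_sumr.
by apply: eq_bigr => q _; rewrite bop_ZE ipZl.
Qed.

Let comb_N (f : W) s : (forall y, spanned_val f y = Re (comb s y)) -> M f ->
  forall z, N z -> comb s z = 0.
Proof.
move=> fs Mf z Nz; apply: complex_eqP; first by rewrite -fs Mf.
by rewrite -comb_i -fs Mf ?mulr0//; exact: N_i.
Qed.

(** The hypothesis on [x] speaks of sums of squares only; by the spectral theorem
    it covers all of [K] and [M]. *)
Let comb_x (f : W) s : (forall y, spanned_val f y = Re (comb s y)) ->
  M f -> K f -> 0 <= comb s x.
Proof.
move=> fs Mf Kf.
have [y /Kf|S [v sv]] := @comb_sum_squares R H J s; first by rewrite fs.
rewrite sv; apply: x_pos => z Nz; rewrite -sv; exact: comb_N Mf _ Nz.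
Qed.

(** The functional [m_h], which dominates all quadratic forms and kills [N]. *)
Let mW h : W := \sum_p w p *: qW (at_ p h).

Let mWE h y : spanned_val (mW h) y = \sum_p w p * Re (ip (y p p h) h).
Proof.
rewrite W_sum; apply: eq_bigr => p _.
by rewrite WZ -[spanned_val _ y]/(Re (opform y (at_ p h) (at_ p h))) opform_at.
Qed.

Let M_mW h : M (mW h).
Proof.
move=> z Nz; rewrite mWE; have /(congr1 (@complex.Re R)) := N_w h Nz.
by rewrite Re_sum => E; rewrite -[RHS]E; apply: eq_bigr => p _; rewrite ReZ.
Qed.

Let diag_ge0 y p h : oppos y -> 0 <= Re (ip (y p p h) h).
Proof. by move=> /(_ (at_ p h)); rewrite opform_at => /Re_ge0. Qed.

Let diag_mW y p h : oppos y -> w p * Re (ip (y p p h) h) <= spanned_val (mW h) y.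
Proof.
move=> ypos; rewrite mWE (bigD1 p)//= lerDl sumr_ge0// => q _.
by rewrite mulr_ge0 ?diag_ge0// ltW.
Qed.

(** For a positive matrix the form of [u] is at most [#|J|] times the sum of the
    diagonal terms, by comparison of each pair of off-diagonal entries with the
    corresponding diagonal ones. *)
Let dominated u : exists2 m, M m & K (m - qW u).
Proof.
pose n : R := #|J|%:R.
exists (\sum_p (n / w p) *: mW (u p)).
  move=> z Nz; rewrite W_sum big1// => p _.
  by rewrite WZ M_mW// mulr0.
move=> y ypos; rewrite WD WN W_sum subr_ge0.
pose d p := Re (ip (y p p (u p)) (u p)).
apply: (@le_trans _ _ (n * \sum_p d p)); last first.
  rewrite mulr_sumr; apply: ler_sum => p _; rewrite WZ -mulrA; apply: ler_wpM2l.
    exact: ler0n.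
  by rewrite mulrC ler_pdivlMr// mulrC diag_mW.
have cross p q : Re (ip (y p q (u q)) (u p)) + Re (ip (y q p (u p)) (u q)) <=
    d p + d q.
  have := ypos (at_ p (u p) - at_ q (u q)).
  rewrite opformDl !opformDr !opformNl !opformNr !opform_at.
  by move=> /Re_ge0; rewrite !(ReD, ReN) /d; lra.
rewrite -[spanned_val _ y]/(Re (opform y u u)) /opform Re_sum.
under eq_bigr do rewrite Re_sum.
have double : 2 * (\sum_p \sum_q Re (ip (y p q (u q)) (u p))) <=
    \sum_p \sum_q (d p + d q).
  rewrite mulrDl !mul1r [X in _ + X]exchange_big/= -big_split/=.
  apply: ler_sum => p _; rewrite -big_split/=.
  by apply: ler_sum => q _; exact: cross.
have E : \sum_p \sum_q (d p + d q) = 2 * (n * \sum_p d p).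
  have sc (a : R) : \sum_(q : J) a = n * a by rewrite sumr_const mulr_natl.
  under eq_bigr do rewrite big_split/= sc.
  by rewrite big_split/= sc -mulr_sumr mulrDl mul1r.
by move: double; rewrite E ler_pM2l ?ltr0n.
Qed.

(** The polarised form [y |-> Re (<y u, v> + <y v, u>) / 2]. *)
Let tW u v : W := (4^-1 : R) *: (qW (u + v) - qW (u - v)).

Let tWE u v y : spanned_val (tW u v) y = Re (opform y u v + opform y v u) / 2.
Proof.
rewrite WZ WD WN -[spanned_val _ y]/(Re (opform y (u + v) (u + v))).
rewrite -[spanned_val (qW (u - v)) y]/(Re (opform y (u - v) (u - v))).
rewrite !opformDl !opformDr !opformNl !opformNr !(ReD, ReN); lra.
Qed.

Let K0 : K 0. Proof. by move=> y _; rewrite W0. Qed.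
Let KD f f' : K f -> K f' -> K (f + f').
Proof. by move=> Kf Kf' y ypos; rewrite WD addr_ge0 ?Kf ?Kf'. Qed.
Let KZ (a : R) f : 0 <= a -> K f -> K (a *: f).
Proof. by move=> a0 Kf y ypos; rewrite WZ mulr_ge0 ?Kf. Qed.
Let M_sub : subspace_of M.
Proof.
split=> [z _|a f f' Mf Mf' z Nz]; first by rewrite W0.
by rewrite WD WZ Mf// Mf'// mulr0 addr0.
Qed.

Let K_qW u : K (qW u).
Proof. by move=> y /(_ u) /Re_ge0. Qed.

Let dominatedW (f : W) : exists2 m, M m & K (m - f) /\ K (m + f).
Proof.
have [s fs] := W_comb f.
have {fs} -> : f = \sum_(r <- s) r.1 *: qW r.2.
  apply: WP => y; rewrite fs W_sum /comb Re_sum; apply: eq_bigr => r _.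
  by rewrite ReZ WZ.
elim: s => [|[c u] s [m Mm [Km Km']]].
  by exists 0; [exact: M_sub.1 | rewrite big_nil addr0 subr0].
have [m' Mm' Km''] := dominated u.
have Kp : K (m' + qW u).
  by rewrite -(subrK (qW u) m') -addrA; apply: KD => //; apply: KD; exact: K_qW.
exists (`|c| *: m' + m); first exact: M_sub.2.
rewrite big_cons /= opprD addrACA [X in _ /\ K X]addrACA.
suff [Kc Kc'] : K (`|c| *: m' - c *: qW u) /\ K (`|c| *: m' + c *: qW u).
  by split; exact: KD.
have [c0|c0] := leP 0 c.
  by rewrite ger0_norm// -scalerBr -scalerDr; split; exact: KZ.
rewrite ltr0_norm// -[in - (c *: _)](opprK c) -[in X in _ /\ K (_ + X)](opprK c).
rewrite [- - c *: _]scaleNr opprK -scalerBr -scalerDr.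
by split; apply: KZ => //; rewrite oppr_ge0 ltW.
Qed.

(** If [x] is nonnegative on the sums of squares that vanish on [N], there is a
    positive matrix which agrees with [x] on all combinations vanishing on [N].
    The evaluation at [x] is extended from [M] to a functional on all
    combinations which is nonnegative on [K]; that functional is the quadratic
    form of a bounded matrix of operators. *)
Lemma positive_extension : exists Q : Y, oppos Q /\
  forall s, (forall z, N z -> comb s z = 0) -> comb s Q = comb s x.
Proof.
have x_lin (a : R) (f f' : W) : M f -> M f' ->
    spanned_val (a *: f + f') x = a * spanned_val f x + spanned_val f' x :> R.
  by rewrite WD WZ.
have x_ge0 f : M f -> K f -> 0 <= (spanned_val f x : R).
  by move=> Mf Kf; have [s fs] := W_comb f; rewrite fs; apply/Re_ge0/comb_x.
have M_dom f : exists2 m, M m & K (m - f).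
  by have [m Mm [Km _]] := dominatedW f; exists m.
have [g [g_lin g_M g_K]] := riesz_extension K0 KD KZ M_sub x_lin x_ge0 M_dom.
have gD f f' : g (f + f') = g f + g f' by rewrite -[f]scale1r g_lin mul1r scale1r.
have g0 : g 0 = 0.
  by have := g_lin (-1) 0 0; rewrite scaler0 addr0 mulN1r addNr.
have gZ a f : g (a *: f) = a * g f by rewrite -[a *: f]addr0 g_lin g0 addr0.
have gN f : g (- f) = - g f by rewrite -scaleN1r gZ mulN1r.
have g_sum (r : seq J) (F : J -> W) : g (\sum_(j <- r) F j) = \sum_(j <- r) g (F j).
  exact: (big_morph g gD g0).
have [T TE] : exists T : (J -> H) -> (J -> H) -> W, forall u v y,
    spanned_val (T u v) y = Re (opform y u v + opform y v u) / 2.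
  by exists tW; exact: tWE.
have iC := conj_i R.
have tC u v : T v u = T u v by apply: WP => y; rewrite !TE addrC.
have tI u v : T v ('i%C *: u) = - T u ('i%C *: v).
  apply: WP => y; rewrite WN !TE !opformZl !opformZr iC.
  by rewrite !mulNr !(ReD, ReN); lra.
have tN u v : T u (- v) = - T u v.
  by apply: WP => y; rewrite WN !TE !opformNl !opformNr !(ReD, ReN); lra.
have tl a u u' v : T (a *: u + u') v =
    Re a *: T u v + (- Im a) *: T u ('i%C *: v) + T u' v.
  apply: WP => y; rewrite !WD !WZ !TE !opformDl !opformDr !opformZl !opformZr iC.
  case: a => a b; case: (opform y u v) => c d; case: (opform y v u) => e f.
  rewrite !(ReD, ReN) /=; lra.
have tqW u : T u u = qW u.
  apply: WP => y; rewrite TE -[spanned_val (qW u) y]/(Re (opform y u u)) ReD; lra.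
(* The sesquilinear form with quadratic form [u |-> g (qW u)]. *)
pose q u v : C := (g (T u v) +i* g (T u ('i%C *: v)))%C.
have ql a u u' v : q (a *: u + u') v = a * q u v + q u' v.
  have ii : 'i%C *: ('i%C *: v) = - v.
    by rewrite scalerA -expr2 sqr_i scaleN1r.
  rewrite /q !tl ii tN !(gD, gZ, gN); case: a => a b /=.
  by congr (_ +i* _)%C; ring.
have qC u v : q v u = (q u v)^* by rewrite /q tC tI gN.
have qr a u v v' : q u (a *: v + v') = a^* * q u v + q u v'.
  by rewrite qC ql rmorphD rmorphM (qC v u) (qC v' u).
have q0l v : q 0 v = 0.
  by have := ql (-1) 0 0 v; rewrite scaler0 addr0 mulN1r addNr.
have qDl u u' v : q (u + u') v = q u v + q u' v.
  by rewrite -[u in LHS]scale1r ql mul1r.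
have q0r u : q u 0 = 0 by rewrite qC q0l rmorph0.
have qDr u v v' : q u (v + v') = q u v + q u v'.
  by rewrite -[v in LHS]scale1r qr rmorph1 mul1r.
have qE u : q u u = (g (qW u))%:C%C.
  have := tI u u => E; have : g (T u ('i%C *: u)) = 0.
    by have := congr1 g E; rewrite gN; lra.
  by rewrite /q => ->; rewrite tqW.
have q_bd u v : Re (q u v) <= (g (qW u) + g (qW v)) / 2.
  have E : qW (u - v) = qW u + qW v + (- 2) *: T u v.
    apply: WP => y; rewrite !WD WZ TE.
    rewrite -[spanned_val (qW (u - v)) y]/(Re (opform y (u - v) (u - v))).
    rewrite -[spanned_val (qW u) y]/(Re (opform y u u)).
    rewrite -[spanned_val (qW v) y]/(Re (opform y v v)).
    by rewrite !opformDl !opformDr !opformNl !opformNr !(ReD, ReN); lra.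
  have := g_K _ (@K_qW (u - v)); rewrite E !gD gZ /=; lra.
(* The bound comes from [w p * qW (at_ p h) <= mW h], as [g] is known on [mW h]. *)
have [c c0 qW_bd] : exists2 c, 0 <= c & forall p h, g (qW (at_ p h)) <= c * sqn h.
  have dM p : exists c : R, forall h, sqn (x p p h) <= c * sqn h by exact: bop_sqn.
  pose d p := projT1 (cid (dM p)).
  have dP p h : sqn (x p p h) <= d p * sqn h by rewrite /d; case: cid.
  have ipd p h : Re (ip (x p p h) h) <= (`|d p| + 1) * sqn h.
    have := sqn_ge0 (x p p h - h); rewrite sqnD sqnN ipNr ReN => h1.
    have h2 := dP p h; have := sqn_ge0 h.
    have : d p * sqn h <= `|d p| * sqn h by rewrite ler_wpM2r ?sqn_ge0// ler_norm.
    have := mulr_ge0 (normr_ge0 (d p)) (sqn_ge0 h).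
    by rewrite mulrDl mul1r; lra.
  pose e : R := \sum_p w p * (`|d p| + 1).
  have e0 : 0 <= e.
    by apply: sumr_ge0 => p _; rewrite mulr_ge0 ?addr_ge0// ltW.
  have g_mW h : g (mW h) <= e * sqn h.
    rewrite g_M; last exact: M_mW.
    rewrite mWE mulr_suml; apply: ler_sum => p _.
    by rewrite -mulrA ler_wpM2l// ltW.
  exists (\sum_p (w p)^-1 * e) => [|p h].
    by apply: sumr_ge0 => p _; rewrite mulr_ge0// invr_ge0 ltW.
  apply: (@le_trans _ _ ((w p)^-1 * e * sqn h)).
    rewrite -mulrA ler_pdivlMl//; apply: le_trans (g_mW h).
    rewrite -subr_ge0 -gZ -gN -gD; apply: g_K => y ypos.
    rewrite WD WN WZ -[spanned_val (qW _) y]/(Re (opform y (at_ p h) (at_ p h))).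
    by rewrite opform_at subr_ge0 diag_mW.
  rewrite ler_wpM2r ?sqn_ge0// (bigD1 p)//= lerDl sumr_ge0// => p' _.
  by rewrite mulr_ge0// invr_ge0 ltW.
have Qex p p' : exists Q : bop H, forall h h', ip (Q h) h' = q (at_ p' h) (at_ p h').
  apply: (@form_operator _ _ (fun h h' => q (at_ p' h) (at_ p h')) c).
  - by move=> a h k h'; rewrite at_linear ql.
  - by move=> a h k h'; rewrite at_linear qr.
  - move=> h h'; apply: le_trans (q_bd _ _) _.
    have := qW_bd p' h; have := qW_bd p h'.
    have := mulr_ge0 c0 (sqn_ge0 h); have := mulr_ge0 c0 (sqn_ge0 h'); lra.
pose Q p p' := projT1 (cid (Qex p p')).
have QE p p' h h' : ip (Q p p' h) h' = q (at_ p' h) (at_ p h').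
  by rewrite /Q; case: cid.
have Qform u : opform Q u u = (g (qW u))%:C%C.
  have suml v : q u v = \sum_p q (at_ p (u p)) v.
    by rewrite {1}(at_sum u) (big_morph (q^~ v) (fun v' v'' => qDl v' v'' v) (q0l v)).
  have sumr v : q v u = \sum_p q v (at_ p (u p)).
    by rewrite {1}(at_sum u) (big_morph _ (qDr _) (q0r _)).
  rewrite -qE suml /opform exchange_big/=; apply: eq_bigr => p' _; rewrite sumr.
  by apply: eq_bigr => p _; rewrite QE.
exists Q; split=> [u|s sN].
  by rewrite Qform ler0c g_K//; exact: K_qW.
pose f : W := \sum_(r <- s) r.1 *: qW r.2.
have fE y : spanned_val f y = Re (comb s y).
  rewrite W_sum /comb Re_sum; apply: eq_bigr => r _.
  by rewrite ReZ WZ.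
have Mf : M f by move=> z Nz; rewrite fE sN.
(* [m] and [m + f] are in [K] and [M], so [x] is real on both of them. *)
have real : comb s x \is Num.real.
  have [m Mm [Km Kp]] := dominatedW f.
  have [sm smE] := W_comb m.
  have Km' : K m.
    have -> : m = (2^-1 : R) *: ((m - f) + (m + f)).
      by apply: WP => y; rewrite WZ !WD WN; lra.
    by apply: KZ; [rewrite invr_ge0 | exact: KD].
  have h1 := comb_x smE Mm Km'.
  have h2 : 0 <= comb (sm ++ s) x.
    apply: (@comb_x (m + f)) => //; last first.
      by have := M_sub.2 1 _ _ Mm Mf; rewrite scale1r.
    by move=> y; rewrite comb_cat ReD WD smE fE.
  rewrite -[comb s x](addKr (comb sm x)) -comb_cat rpredD ?rpredN ?ger0_real//.
rewrite -(RRe_real real) -fE -(g_M _ Mf).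
rewrite /comb (big_morph g gD g0) rmorph_sum; apply: eq_bigr => r _.
by rewrite gZ Qform rmorphM.
Qed.

End extension.

(** * Direct sums, coproducts and tensor products *)

Section direct_sums.
Variables (K : pzRingType) (L : Type) (V : L -> lmodType K).

Lemma dsingleE l (v : V l) : dsingle l v l = v.
Proof.
rewrite /dsingle /= /dsingle_fun; case: pselect => // e.
by rewrite (Prop_irrelevance e erefl).
Qed.

Lemma dsingle_neq l l' (v : V l) : l <> l' -> dsingle l v l' = 0.
Proof. by rewrite /dsingle /= /dsingle_fun; case: pselect. Qed.

Lemma dsingle_linear l (a : K) (v v' : V l) :
  dsingle l (a *: v + v') = a *: dsingle l v + dsingle l v'.
Proof.
apply: dsumP => l'; rewrite -[RHS]/(a *: dsingle l v l' + dsingle l v' l').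
have [<-|ll'] := pselect (l = l'); first by rewrite !dsingleE.
by rewrite !dsingle_neq// scaler0 addr0.
Qed.

Lemma dsum_sumE (J : Type) (s : seq J) (P : pred J) (F : J -> dsum V) l :
  (\sum_(j <- s | P j) F j) l = \sum_(j <- s | P j) F j l.
Proof. exact: (big_morph (fun f : dsum V => f l)). Qed.

Lemma dsum_decomp (w : dsum V) (D : {fset {classic L}}) :
  (forall l : {classic L}, w l != 0 -> l \in D) ->
  w = \sum_(l <- D) dsingle (l : L) (w l).
Proof.
move=> wD; apply: dsumP => l; rewrite dsum_sumE.
have [lD|lD] := boolP ((l : {classic L}) \in D).
  rewrite (bigD1_seq (l : {classic L}))//= ?fset_uniq//.
  rewrite [X in X + _]dsingleE big1 ?addr0// => l' /eqP ll'.
  exact: dsingle_neq.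
rewrite big_seq big1 => [|l' l'D].
  by apply/eqP; apply: contraNT lD; exact: wD.
by apply: dsingle_neq => ll'; rewrite -ll' l'D in lD.
Qed.

(** The support, as a finite set over the classical choice structure of [L]. *)
Lemma dsum_supp (w : dsum V) : exists D : {fset {classic L}},
  forall l : {classic L}, (l \in D) = (w l != 0).
Proof.
have finw : finite_set [set l : {classic L} | w l != 0] := dsum_finite w.
exists (fset_set [set l : {classic L} | w l != 0]) => l.
by rewrite in_fset_set//; apply/idP/idP => [/set_mem|/mem_set].
Qed.

End direct_sums.

Section coproducts.
Variables (R : realType) (L : Type) (S : L -> opsys R).
Local Notation C := R[i].

Lemma coprod_inj_linear l (a : C) (x y : S l) :
  coprod_inj (a *: x + y) = a *: coprod_inj x + coprod_inj y.
Proof. by rewrite /coprod_inj dsingle_linear linearP. Qed.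

Lemma coprod_inj0 l : coprod_inj (0 : S l) = 0.
Proof.
have := @coprod_inj_linear l (-1) 0 0.
by rewrite scaler0 addr0 scaleN1r addNr.
Qed.

Lemma coprod_injZ l (a : C) (x : S l) : coprod_inj (a *: x) = a *: coprod_inj x.
Proof. by have := coprod_inj_linear a x 0; rewrite coprod_inj0 !addr0. Qed.

Lemma coprod_inj_sum l (J : Type) (s : seq J) (F : J -> S l) :
  coprod_inj (\sum_(j <- s) F j) = \sum_(j <- s) coprod_inj (F j).
Proof.
apply: (big_morph (@coprod_inj R L S l)) => [x y|]; last exact: coprod_inj0.
by have := coprod_inj_linear 1 x y; rewrite !scale1r.
Qed.

Lemma coprod_inj_unit l l' :
  coprod_inj (os_unit (S l)) = coprod_inj (os_unit (S l')).
Proof. by apply/qclass_eq/mem_span; exists l, l'. Qed.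

Lemma coprod_unitE l : os_unit (coprod S) = coprod_inj (os_unit (S l)).
Proof.
rewrite /= /coprod_unit; case: xgetP => [u _ [l' ->]|].
  exact: coprod_inj_unit.
by move=> /(_ (coprod_inj (os_unit (S l)))) []; exists l.
Qed.

Lemma coprod_decomp (z : coprod S) : exists (s : seq {classic L}) (f : forall l, S l),
  z = \sum_(l <- s) coprod_inj (f (l : L)).
Proof.
rewrite -[z](qreprK (E := @unit_differences R L S)); set w := qrepr _ z.
have [D wD] := dsum_supp w; exists D, w.
rewrite [in LHS](@dsum_decomp _ _ _ w D) => [|l]; last by rewrite wD.
exact: linear_sum.
Qed.

Section lift.
Variables (U : lmodType C) (phi : forall l, S l -> U) (u0 : U).
Hypothesis phi_lin : forall l a (x y : S l), phi (a *: x + y) = a *: phi x + phi y.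
Hypothesis phi_unit : forall l, phi (os_unit (S l)) = u0.

Let phi0 l : phi (0 : S l) = 0.
Proof.
have := phi_lin (-1) (0 : S l) 0.
by rewrite scaler0 addr0 scaleN1r addNr.
Qed.

(** The induced map on the direct sum. *)
Let dlift (w : dsum S) : U := \sum_(l \in [set: {classic L}]) phi (w (l : L)).

Let dliftE (w : dsum S) (D : {fset {classic L}}) :
  (forall l : {classic L}, w l != 0 -> l \in D) ->
  dlift w = \sum_(l <- D) phi (w (l : L)).
Proof.
move=> wD; apply: fsbigTE => l lD.
have [->|/wD l'] := eqVneq (w l) 0; first exact: phi0.
by rewrite l' in lD.
Qed.

Let dlift_linear : linear dlift.
Proof.
move=> a w w'; have [D DE] := dsum_supp w; have [D' DE'] := dsum_supp w'.
have sub (f : dsum S) : (forall l, f l != 0 -> w l != 0 \/ w' l != 0) ->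
    dlift f = \sum_(l <- (D `|` D')%fset) phi (f (l : L)).
  move=> fww'; apply: dliftE => l /fww'; rewrite in_fsetU DE DE'.
  by case=> ->; rewrite ?orbT.
rewrite !sub.
- rewrite scaler_sumr -big_split/=; apply: eq_bigr => l _.
  by rewrite -phi_lin.
- by move=> l; right.
- by move=> l; left.
move=> l; have [w0|] := eqVneq (w l) 0; last by left.
have [w'0|] := eqVneq (w' l) 0; last by right.
have -> : (a *: w + w' : dsum S) l = a *: w l + w' l by [].
by rewrite w0 w'0 scaler0 addr0 eqxx.
Qed.

Let dlift_single l (x : S l) : dlift (dsingle l x) = phi x.
Proof.
rewrite (@dliftE _ [fset (l : {classic L})]%fset).
  by rewrite big_seq_fset1 dsingleE.
move=> l'; rewrite inE => l'0; apply/eqP; apply: contrapT => ll'.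
by move: l'0; rewrite dsingle_neq ?eqxx// => E; apply: ll'.
Qed.

(** Linear maps on the summands that agree at the units induce a linear map on
    the coproduct. *)
Lemma coprod_lift : exists Phi : {linear coprod S -> U},
  forall l (x : S l), Phi (coprod_inj x) = phi x.
Proof.
have d0 : dlift 0 = 0.
  by have := dlift_linear (-1) 0 0; rewrite scaler0 addr0 scaleN1r addNr.
have dB w w' : dlift (w - w') = dlift w - dlift w'.
  by rewrite addrC -[- w']scaleN1r dlift_linear scaleN1r addrC.
have wd w : dlift (qrepr (@unit_differences R L S) (qclass _ w)) = dlift w.
  have : qrepr (@unit_differences R L S) (qclass _ w) - w \in Defs.span (@unit_differences R L S).
    by apply/qclass_eq; rewrite qreprK.
  set w' := qrepr _ _ => /asboolP ww'; apply/eqP; rewrite -subr_eq0 -dB; apply/eqP.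
  apply: (_ : _ `<=` [set v | dlift v = 0]) ww'.
  apply: smallest_sub; first split=> [//|a u v /= u0' v0].
    by rewrite dlift_linear u0' v0 scaler0 addr0.
  by move=> _ [l1 [l2 ->]]; rewrite /mkset dB !dlift_single !phi_unit subrr.
pose F (z : coprod S) : U := dlift (qrepr (@unit_differences R L S) z).
have Fl : linear F.
  move=> a z z'; rewrite /F -[z in LHS]qreprK -[z' in LHS]qreprK -linearP.
  by rewrite wd dlift_linear.
pose Phi : {linear coprod S -> U} := HB.pack_for {linear coprod S -> U} F
  (GRing.isLinear.Build C (coprod S) U *:%R F Fl).
exists Phi => l x /=; rewrite /Phi /=.
by rewrite /F /coprod_inj wd dlift_single.
Qed.

End lift.
End coproducts.

Section tensors.
Variables (R : realType) (S T : opsys R).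
Local Notation C := R[i].

Lemma tens_linearl (t : T) (a : C) (s s' : S) :
  tens (a *: s + s') t = a *: tens s t + tens s' t.
Proof.
rewrite /tens -linearP; apply/qclass_eq/mem_span; left.
by exists a, s, s', t.
Qed.

Lemma tens_linearr (s : S) (a : C) (t t' : T) :
  tens s (a *: t + t') = a *: tens s t + tens s t'.
Proof.
rewrite /tens -linearP; apply/qclass_eq/mem_span; right.
by exists a, s, t, t'.
Qed.

Lemma tens0l (t : T) : tens (0 : S) t = 0.
Proof.
have := tens_linearl t (-1) 0 0; rewrite scaler0 addr0 => E.
by rewrite E scaleN1r addNr.
Qed.
Lemma tens0r (s : S) : tens s (0 : T) = 0.
Proof.
have := tens_linearr s (-1) 0 0; rewrite scaler0 addr0 => E.
by rewrite E scaleN1r addNr.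
Qed.
Lemma tensDl (t : T) (s s' : S) : tens (s + s') t = tens s t + tens s' t.
Proof. by rewrite -[s in LHS]scale1r tens_linearl scale1r. Qed.
Lemma tensDr (s : S) (t t' : T) : tens s (t + t') = tens s t + tens s t'.
Proof. by rewrite -[t in LHS]scale1r tens_linearr scale1r. Qed.
Lemma tensZl (t : T) a (s : S) : tens (a *: s) t = a *: tens s t.
Proof. by rewrite -[a *: s in LHS]addr0 tens_linearl tens0l addr0. Qed.
Lemma tensZr (s : S) a (t : T) : tens s (a *: t) = a *: tens s t.
Proof. by rewrite -[a *: t in LHS]addr0 tens_linearr tens0r addr0. Qed.
Lemma tens_suml (J : Type) (r : seq J) (P : pred J) (F : J -> S) (t : T) :
  tens (\sum_(j <- r | P j) F j) t = \sum_(j <- r | P j) tens (F j) t.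
Proof. exact: (big_morph (fun s => tens s t) (tensDl t) (tens0l t)). Qed.
Lemma tens_sumr (J : Type) (r : seq J) (P : pred J) (F : J -> T) (s : S) :
  tens s (\sum_(j <- r | P j) F j) = \sum_(j <- r | P j) tens s (F j).
Proof. exact: (big_morph (tens s) (tensDr s) (tens0r s)). Qed.

(** A subspace containing the elementary tensors is everything. *)
Lemma tensor_ind (P : set (tensor S T)) : subspace_of P ->
  (forall s t, P (tens s t)) -> forall z, P z.
Proof.
move=> [P0 PD] Pt z; rewrite -[z](qreprK (E := @bilinear_relations R S T)).
set w := qrepr _ z; have [D wD] := dsum_supp w.
rewrite (@dsum_decomp _ _ _ w D) => [|l]; last by rewrite wD.
rewrite linear_sum/=; elim/big_ind: _ => // [x y Px Py|[s t] _].
  by have := PD 1 _ _ Px Py; rewrite scale1r.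
rewrite -[w _]mulr1 -[w _ * 1]addr0.
have -> : dsingle (V := fun=> C) (s, t) (w (s, t) * 1 + 0) =
    w (s, t) *: dsingle (V := fun=> C) (s, t) 1 + dsingle (V := fun=> C) (s, t) 0.
  exact: dsingle_linear.
have -> : dsingle (V := fun=> C) (s, t) 0 = 0.
  have := dsingle_linear (V := fun=> C) (-1 : C) (0 : C) (0 : C) (l := (s, t)).
  by rewrite scaler0 addr0 => E; rewrite E scaleN1r addNr.
rewrite linearP linear0; apply: PD => //; exact: Pt.
Qed.

End tensors.

(** * The operator system spanned by the e_ij and their multiples by t *)

Section frakc_basis.
Variables (R : realType) (k : nat).
Local Notation C := R[i].
Local Notation itv01 := (set_type (`[0, 1]%classic : set R)).
Local Notation CX := (continuousType itv01 C^o).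
Local Notation amb := (lmx (Cfun R itv01) k).

(** The endpoints of [0, 1]. *)
Fact end01_subproof (b : bool) : (b%:R : R) \in (`[0, 1]%classic : set R).
Proof.
by apply/mem_set; rewrite /= in_itv/=; case: b; rewrite !(lexx, ler01).
Qed.
Definition end01 (b : bool) : itv01 := SigSub (end01_subproof b).

Lemma itv01_ge0 (t : itv01) : 0 <= val t.
Proof. by case: t => t /= /set_mem; rewrite /= in_itv/= => /andP[]. Qed.
Lemma itv01_le1 (t : itv01) : val t <= 1.
Proof. by case: t => t /= /set_mem; rewrite /= in_itv/= => /andP[]. Qed.

(** [hat true] is the coordinate [t] and [hat false] is [1 - t]. *)
Definition hat (b : bool) : CX :=
  if b then Defs.coord R else cts_cst itv01 1 - Defs.coord R.

Lemma ctsD (f g : CX) t : (f + g) t = f t + g t. Proof. by []. Qed.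
Lemma ctsN (f : CX) t : (- f) t = - f t. Proof. by []. Qed.
Lemma ctsZ (a : C) (f : CX) t : (a *: f) t = a * f t. Proof. by []. Qed.
Lemma cts0 t : (0 : CX) t = 0. Proof. by []. Qed.
Lemma hatE b (t : itv01) :
  hat b t = (if b then val t else 1 - val t)%:C%C.
Proof.
case: b => //=; rewrite /hat /= ctsD ctsN -[cts_cst _ 1 t]/(1 : C).
by rewrite rmorphB rmorph1.
Qed.

Lemma hat_end b b' : hat b (end01 b') = (b == b')%:R.
Proof.
by rewrite hatE; case: b; case: b' => //=; rewrite ?subrr ?subr0.
Qed.

Lemma hat_ge0 b t : 0 <= hat b t.
Proof.
by rewrite hatE ler0c; case: b; rewrite ?subr_ge0 ?itv01_ge0 ?itv01_le1.
Qed.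

Lemma hat_sum t : \sum_(b : bool) hat b t = 1.
Proof. by rewrite big_bool !hatE /= -rmorphD /= addrC subrK. Qed.

(** The matrix [e_ab (x) hat eps]; it is 0 unless [a, b < k]. *)
Definition gen_mx eps (a b : nat) : amb :=
  mxtensv (\matrix_(i, j) ((i == a :> nat) && (j == b :> nat))%:R) (hat eps).

Lemma gen_mx_delta eps (a b : 'I_k) : gen_mx eps a b = mxtensv (delta_mx a b) (hat eps).
Proof. by congr mxtensv; apply/matrixP => i j; rewrite !mxE. Qed.

Fact gen_mx_span eps a b : gen_mx eps a b \in Defs.span (@frakc_gens R k).
Proof.
have [/andP[ak bk]|out] := boolP ((a < k)%N && (b < k)%N); last first.
  rewrite (_ : gen_mx _ _ _ = 0) ?rpred0//; apply/matrixP => i j; rewrite !mxE.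
  case: andP => [[/eqP ia /eqP jb]|_]; last by rewrite scale0r.
  by rewrite -ia -jb !ltn_ord in out.
have gen f : f = cts_cst itv01 1 \/ f = Defs.coord R ->
    (mxtensv (delta_mx (Ordinal ak) (Ordinal bk)) f : amb) \in
      Defs.span (@frakc_gens R k).
  by move=> fE; apply: mem_span; exists (Ordinal ak), (Ordinal bk), f.
rewrite (gen_mx_delta eps (Ordinal ak) (Ordinal bk)).
case: eps; first by apply: gen; right.
have -> : mxtensv (delta_mx (Ordinal ak) (Ordinal bk)) (hat false) =
   mxtensv (delta_mx (Ordinal ak) (Ordinal bk)) (cts_cst itv01 1) -
   (mxtensv (delta_mx (Ordinal ak) (Ordinal bk)) (Defs.coord R) : amb).
  by apply/matrixP => i j; rewrite !mxE scalerBr.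
by apply: rpredB; apply: gen; [left | right].
Qed.

(** The element [e_ab (x) hat eps] of the system. The indices are natural
    numbers, so that all matrix sizes can be treated with the same index sets. *)
Definition gen eps a b : frakc R k := Spanned (gen_mx_span eps a b).

Lemma frakc_eqP (X Y : frakc R k) :
  (forall i j t, spanned_val X i j t = spanned_val Y i j t) -> X = Y.
Proof.
by move=> XY; apply/val_inj/matrixP => i j; apply: ctsP => t; exact: XY.
Qed.

Lemma frakcDE (X Y : frakc R k) i j t :
  spanned_val (X + Y) i j t = spanned_val X i j t + spanned_val Y i j t.
Proof. by rewrite (spanned_valD X Y) mxE. Qed.
Lemma frakcZE (a : C) (X : frakc R k) i j t :
  spanned_val (a *: X) i j t = a * spanned_val X i j t.
Proof. by rewrite (spanned_valZ a X) mxE. Qed.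
Lemma frakc0E i j t : spanned_val (0 : frakc R k) i j t = 0.
Proof. by rewrite spanned_val0 mxE. Qed.
Lemma frakc_sumE (J : Type) (s : seq J) (P : pred J) (F : J -> frakc R k) i j t :
  spanned_val (\sum_(m <- s | P m) F m) i j t =
  \sum_(m <- s | P m) spanned_val (F m) i j t.
Proof.
exact: (big_morph (fun X : frakc R k => spanned_val X i j t)
  (fun X Y => frakcDE X Y i j t) (frakc0E i j t)).
Qed.

Lemma genE eps a b i j t :
  spanned_val (gen eps a b) i j t =
  ((i == a :> nat) && (j == b :> nat))%:R * hat eps t.
Proof. by rewrite /= mxE ctsZ mxE. Qed.

(** The entries of an element are affine in [t], hence determined by their values
    at the two endpoints. *)
Lemma frakc_affine (X : frakc R k) i j t :
  spanned_val X i j t = \sum_(eps : bool) spanned_val X i j (end01 eps) * hat eps t.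
Proof.
case: X => X /= /asboolP XE; move: i j t; move: X XE.
apply: (_ : _ `<=` [set X : amb | forall i j t,
   X i j t = \sum_(eps : bool) X i j (end01 eps) * hat eps t]).
apply: smallest_sub; first split.
- by move=> i j t; rewrite big1 => [|eps _]; rewrite mxE cts0 ?mul0r.
- move=> a u v uE vE i j t; rewrite !mxE ctsD ctsZ uE vE.
  rewrite mulr_sumr -big_split/=; apply: eq_bigr => eps _.
  by rewrite ctsD ctsZ mulrDl mulrA.
- move=> _ [p [q [f [fE ->]]]] i j t.
  have fa : f t = \sum_(eps : bool) f (end01 eps) * hat eps t.
    case: fE => ->; last first.
      rewrite -[Defs.coord R]/(hat true) big_bool !hat_end eqxx mul1r.
      by rewrite (_ : (true == false)%:R = 0 :> C)// mul0r /= addr0.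
    rewrite -[cts_cst _ 1 t]/(1 : C) -[LHS](hat_sum t); apply: eq_bigr => eps _.
    by rewrite -[cts_cst _ 1 _]/(1 : C) mul1r.
  rewrite mxE ctsZ fa mulr_sumr; apply: eq_bigr => eps _.
  by rewrite !mxE ctsZ mulrA.
Qed.

Lemma frakc_decomp (X : frakc R k) :
  X = \sum_(eps : bool) \sum_(a < k) \sum_(b < k)
        (spanned_val X a b (end01 eps) : C) *: gen eps a b.
Proof.
apply: frakc_eqP => i j t; rewrite frakc_affine frakc_sumE; apply: eq_bigr => eps _.
transitivity (\sum_(a < k) \sum_(b < k) (spanned_val X a b (end01 eps) : C) *
    (((i == a) && (j == b))%:R * hat eps t)); last first.
  rewrite frakc_sumE; apply: eq_bigr => a _; rewrite frakc_sumE.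
  by apply: eq_bigr => b _; rewrite frakcZE genE.
rewrite (bigD1 i)//= [X in _ + X]big1 ?addr0 => [|a ai].
  rewrite (bigD1 j)//= [X in _ + X]big1 ?addr0 => [|b bj].
    by rewrite !eqxx mul1r.
  by rewrite eqxx (eq_sym j) (negPf bj) mul0r mulr0.
by rewrite big1// => b _; rewrite (eq_sym i) (negPf ai) mul0r mulr0.
Qed.

Lemma frakc_unitE i j t : spanned_val (os_unit (frakc R k)) i j t = (i == j)%:R.
Proof.
rewrite /= mxE mxE ctsZ -[cts_cst _ 1 t]/(1 : C) mulr1.
by case: eqP.
Qed.

Lemma frakc_unit_gen K : (k <= K)%N ->
  os_unit (frakc R k) = \sum_(eps : bool) \sum_(a < K) gen eps a a.
Proof.
move=> kK; apply: frakc_eqP => i j t; rewrite frakc_unitE frakc_sumE.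
transitivity (\sum_(eps : bool) (i == j)%:R * hat eps t).
  by rewrite -mulr_sumr hat_sum mulr1.
apply: eq_bigr => eps _; rewrite frakc_sumE.
have iK : (i < K)%N by rewrite (leq_trans (ltn_ord i)).
rewrite (bigD1 (Ordinal iK))//= [X in _ + X]big1 ?addr0 => [|a ai].
  by rewrite genE /= eqxx /= eq_sym.
rewrite genE; case: eqP => [ia|_]; last by rewrite mul0r.
by case/eqP: ai; apply: val_inj.
Qed.

End frakc_basis.

(** * Completely positive maps on the summands and on their coproduct *)

Section choi_maps.
Variables (R : realType) (k p : nat).
Local Notation C := R[i].
Implicit Types c : bool -> nat -> nat -> 'M[C]_p.

Lemma frakc_posP n (X : 'M[frakc R k]_n) :
  os_pos X <-> forall t, fpsd (fun P Q : 'I_n * 'I_k =>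
    (spanned_val (X P.1 Q.1) P.2 Q.2 t : C)).
Proof.
split=> [Xp t|Xp t].
  apply: fpsd_ext (fpsd_comp (@mxtens_index n k) (Xp t : fpsd _)) => P Q.
  by rewrite !mxE !mxtens_indexK.
apply: fpsd_ext (fpsd_comp (@mxtens_unindex n k) (Xp t)) => P Q.
by rewrite !mxE.
Qed.

Lemma MatP (A B : Mat R p) : (forall i j, A i j = B i j) -> A = B.
Proof. by move=> AB; apply/matrixP. Qed.

Lemma Mat_linE (a : C) (A B : Mat R p) i j : (a *: A + B) i j = a * A i j + B i j.
Proof. by rewrite !mxE. Qed.

Lemma Mat_sumE (J : Type) (s : seq J) (Q : pred J) (F : J -> Mat R p) i j :
  (\sum_(r <- s | Q r) F r) i j = \sum_(r <- s | Q r) F r i j.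
Proof.
by apply: (big_morph (fun M : Mat R p => M i j)) => [A B|]; rewrite mxE.
Qed.

Lemma Mat_posP n (Y : 'M[Mat R p]_n) :
  os_pos Y <-> fpsd (fun P Q : 'I_n * 'I_p => (Y P.1 Q.1 : 'M[C]_p) P.2 Q.2).
Proof. exact: psd_mxflat. Qed.

Lemma Mat_unitE i j : (os_unit (Mat R p) : 'M[C]_p) i j = (i == j)%:R.
Proof. by rewrite !mxE -[_ *: _]/(_ * 1) mulr1. Qed.

(** The map of [frakc] with Choi matrices [c]: it sends [gen eps a b] to
    [c eps a b]. *)
Definition choi_map c (X : frakc R k) : Mat R p :=
  \matrix_(i, j) \sum_(eps : bool) \sum_(a < k) \sum_(b < k)
    (spanned_val X a b (end01 R eps) : C) * c eps a b i j.

Lemma choi_mapE c X i j : choi_map c X i j =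
  \sum_(eps : bool) \sum_(a < k) \sum_(b < k)
    (spanned_val X a b (end01 R eps) : C) * c eps a b i j.
Proof. by rewrite /choi_map mxE. Qed.

Lemma choi_map_linear c a (X Y : frakc R k) :
  choi_map c (a *: X + Y) = a *: choi_map c X + choi_map c Y.
Proof.
apply: MatP => i j; rewrite Mat_linE !choi_mapE mulr_sumr -big_split/=.
apply: eq_bigr => eps _; rewrite mulr_sumr -big_split/=.
apply: eq_bigr => q _; rewrite mulr_sumr -big_split/=.
by apply: eq_bigr => r _; rewrite [X in X * _](frakcDE (a *: X) Y q r (end01 R eps)) frakcZE mulrDl mulrA.
Qed.

Lemma choi_map_gen c eps (a b : 'I_k) i j :
  choi_map c (gen R k eps a b) i j = c eps a b i j.
Proof.
rewrite choi_mapE (bigD1 eps)//= [X in _ + X]big1 ?addr0 => [|eps' /negPf ee].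
  rewrite (bigD1 a)//= [X in _ + X]big1 ?addr0 => [|a' /negPf aa].
    rewrite (bigD1 b)//= [X in _ + X]big1 ?addr0 => [|b' /negPf bb].
      by rewrite genE hat_end !eqxx !mul1r.
    by rewrite genE (_ : (b' == b :> nat) = false) ?andbF ?mul0r.
  by rewrite big1// => b' _; rewrite genE (_ : (a' == a :> nat) = false) ?mul0r.
rewrite big1// => a' _; rewrite big1// => b' _.
by rewrite genE hat_end (eq_sym eps) ee mulr0 mul0r.
Qed.

Lemma choi_map_unit c i j : choi_map c (os_unit (frakc R k)) i j =
  \sum_(eps : bool) \sum_(a < k) c eps a a i j.
Proof.
rewrite choi_mapE; apply: eq_bigr => eps _; apply: eq_bigr => a _.
rewrite (bigD1 a)//= [X in _ + X]big1 ?addr0 => [|b /negPf ba].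
  by rewrite (frakc_unitE a a) eqxx mul1r.
by rewrite (frakc_unitE a b) eq_sym ba mul0r.
Qed.

(** Choi's criterion: positivity of the two Choi matrices makes the map completely
    positive. Only the positivity of [X] at the endpoints is used. *)
Lemma choi_map_cp c : (forall eps, fpsd (fun P Q : 'I_k * 'I_p =>
    c eps P.1 Q.1 P.2 Q.2)) ->
  forall n (X : 'M[frakc R k]_n), os_pos X ->
    fpsd (fun P Q : 'I_n * 'I_p => choi_map c (X P.1 Q.1) P.2 Q.2).
Proof.
move=> cp n X /frakc_posP Xp.
have := fpsd_sum (fun eps => fpsd_contract (Xp (end01 R eps)) (cp eps)).
by apply: fpsd_ext => P Q; rewrite choi_mapE.
Qed.

End choi_maps.

Section coproduct_maps.
Variables (R : realType) (L : Type) (S : L -> opsys R) (p : nat).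
Local Notation C := R[i].
Variable phi : forall l, S l -> Mat R p.
Hypothesis phi_lin : forall l a (x y : S l), phi (a *: x + y) = a *: phi x + phi y.
Hypothesis phi_unit : forall l, phi (os_unit (S l)) = os_unit (Mat R p).
Hypothesis phi_cp : forall l n (X : 'M[S l]_n), os_pos X ->
  fpsd (fun P Q : 'I_n * 'I_p => phi (X P.1 Q.1) P.2 Q.2).

(** Unital completely positive maps on the summands of a coproduct have a common
    unital completely positive extension. *)
Lemma coprod_ucp (l0 : L) : exists Phi : {linear coprod S -> Mat R p},
  ucp Phi /\ forall l (x : S l), Phi (coprod_inj x) = phi x.
Proof.
have [Phi PhiE] := coprod_lift phi_lin phi_unit; exists Phi; split=> //; split.
  by rewrite (coprod_unitE S l0) PhiE phi_unit.
move=> n X [m [l [x [l_inj XE X_pos]]]]; apply/Mat_posP => v.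
pose form lt (Y : lmx (S lt) n) : C :=
  \sum_P \sum_Q (v P)^* * phi (Y P.1 Q.1) P.2 Q.2 * v Q.
have form_lin lt : linear (@form lt).
  move=> a Y Z; transitivity (a * form lt Y + form lt Z) => //.
  rewrite /form mulr_sumr -big_split/=.
  apply: eq_bigr => P _; rewrite mulr_sumr -big_split/=; apply: eq_bigr => Q _.
  rewrite [(a *: Y + Z) _ _]mxE [(a *: Y) _ _]mxE phi_lin Mat_linE; ring.
have formE : \sum_P \sum_Q (v P)^* * (map_mx Phi X P.1 Q.1 : 'M[C]_p) P.2 Q.2 * v Q
    = \sum_a form (l a) (x a).
  transitivity (\sum_P \sum_Q \sum_a (v P)^* * phi (x a P.1 Q.1) P.2 Q.2 * v Q).
    apply: eq_bigr => P _; apply: eq_bigr => Q _.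
    have -> : map_mx Phi X P.1 Q.1 = \sum_a (phi (x a P.1 Q.1)).
      rewrite mxE XE mxE linear_sum; apply: eq_bigr => a _; exact: PhiE.
    rewrite Mat_sumE mulr_sumr mulr_suml.
    by apply: eq_bigr => a _.
  under eq_bigr do rewrite exchange_big/=.
  by rewrite exchange_big.
(* The functionals [form (l a)] agree on scalar matrices; divided by their common
   value at the unit they form a compatible family of states. *)
have [v0|v0] := eqVneq (\sum_P (v P)^* * v P) 0.
  have {}v0 P : v P = 0.
    have n0 Q : 0 <= (v Q)^* * v Q by rewrite mulrC mul_conjC_ge0.
    move/eqP: v0; rewrite psumr_eq0// => /allP/(_ P (mem_index_enum _)) /=.
    by rewrite mulrC mul_conjC_eq0 => /eqP.
  by rewrite big1// => P _; rewrite big1// => Q _; rewrite !v0 mulr0.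
have vge : 0 <= \sum_P (v P)^* * v P.
  by apply: sumr_ge0 => P _; rewrite mulrC mul_conjC_ge0.
set N := \sum_P (v P)^* * v P in v0 vge.
have Ni : 0 <= N^-1 by rewrite invr_ge0.
have om_lin a : linear (fun Y : lmx (S (l a)) n => N^-1 * form (l a) Y).
  move=> b Y Z; rewrite form_lin -[b *: _ in RHS]/(b * _).
  by rewrite -[b *: _]/(b * _); ring.
pose omega a : {linear lmx (S (l a)) n -> C} :=
  HB.pack_for {linear lmx (S (l a)) n -> C}
    (fun Y : lmx (S (l a)) n => N^-1 * form (l a) Y)
    (GRing.isLinear.Build C (lmx (S (l a)) n) C *:%R _ (om_lin a)).
have omegaE a Y : omega a Y = N^-1 * form (l a) Y by [].
have form_unit a A : form (l a) (mxtensv A (os_unit (S (l a)))) =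
    \sum_(P : 'I_n * 'I_p) \sum_(Q : 'I_n * 'I_p)
       (v P)^* * (A P.1 Q.1 * (P.2 == Q.2)%:R) * v Q.
  apply: eq_bigr => P _; apply: eq_bigr => Q _; congr (_ * _ * _).
  have phiZ b (y : S (l a)) : phi (b *: y) = b *: phi y :> Mat R p.
    have phi0 : phi (0 : S (l a)) = 0.
      have := phi_lin (-1) (0 : S (l a)) 0.
      by rewrite scaler0 addr0 scaleN1r addNr.
    by have := phi_lin b y (0 : S (l a)); rewrite phi0 !addr0.
  rewrite [mxtensv _ _ _ _]mxE phiZ phi_unit -[_ *: _]addr0 Mat_linE Mat_unitE.
  by rewrite [(0 : Mat R p) _ _]mxE addr0.
rewrite formE -[\sum_a _](mulVKf v0) mulr_ge0// mulr_sumr.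
apply: (X_pos omega) => [a|a b A]; last by rewrite !omegaE !form_unit.
split=> [|Y Yp]; rewrite omegaE; last first.
  by rewrite mulr_ge0//; exact: phi_cp.
rewrite form_unit (_ : \sum_P _ = N) ?mulVf//; apply: eq_bigr => P _.
rewrite (bigD1 P)//= big1 ?addr0 => [|Q QP].
  by rewrite mxE !eqxx !mulr1.
rewrite mxE; case: eqP => [E1|_]; last by rewrite mul0r mulr0 mul0r.
case: eqP => [E2|_]; last by rewrite !mulr0 mul0r.
by case/eqP: QP; case: P Q E1 E2 {v0 vge} => [? ?] [? ?] /= -> ->.
Qed.

End coproduct_maps.

(** * Matrix coefficients on tensor products, and max below min *)

Section min_max.
Variables (R : realType) (S T : opsys R).
Local Notation C := R[i].

Section matrix_coefficients.
Variables (k l : nat) (phi : {linear S -> Mat R k}) (psi : {linear T -> Mat R l}).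

(** Matrix coefficient of [phi (x) psi] at row [p] and column [q]. *)
Definition tmap (z : tensor S T) (p q : 'I_k * 'I_l) : C :=
  (tensor_map phi psi z : 'M[C]_(k * l)) (mxtens_index p) (mxtens_index q).

Lemma tmap_linear a z z' p q : tmap (a *: z + z') p q = a * tmap z p q + tmap z' p q.
Proof.
rewrite /tmap /tensor_map tensor_lift_linear; first by rewrite !mxE.
  by move=> t b s s'; apply/matrixP => i j; rewrite !mxE linearP !mxE mulrDl -mulrA.
by move=> s b t t'; apply/matrixP => i j; rewrite !mxE linearP !mxE mulrDr mulrCA.
Qed.

Lemma tmap0 p q : tmap 0 p q = 0.
Proof.
have := tmap_linear (-1) 0 0 p q; rewrite scaler0 addr0 mulN1r => E.
by rewrite E addNr.
Qed.
Lemma tmapD z z' p q : tmap (z + z') p q = tmap z p q + tmap z' p q.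
Proof. by rewrite -[z in LHS]scale1r tmap_linear mul1r. Qed.
Lemma tmapZ a z p q : tmap (a *: z) p q = a * tmap z p q.
Proof. by rewrite -[a *: z in LHS]addr0 tmap_linear tmap0 addr0. Qed.
Lemma tmap_sum (J : Type) (r : seq J) (P : pred J) (F : J -> tensor S T) p q :
  tmap (\sum_(j <- r | P j) F j) p q = \sum_(j <- r | P j) tmap (F j) p q.
Proof.
exact: (big_morph (fun z => tmap z p q) (fun z z' => tmapD z z' p q) (tmap0 p q)).
Qed.
Lemma tmap_tens s t p q : tmap (tens s t) p q =
  (phi s : 'M[C]_k) p.1 q.1 * (psi t : 'M[C]_l) p.2 q.2.
Proof. by rewrite /tmap tensor_mapE mxE !mxtens_indexK. Qed.

(** Positivity at level [n], in terms of matrix coefficients. *)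
Lemma tmap_pos n (X : 'M[tensor S T]_n) :
  os_pos (map_mx (tensor_map phi psi : tensor S T -> Mat R (k * l)) X) <->
  fpsd (fun P Q : 'I_n * ('I_k * 'I_l) => tmap (X P.1 Q.1) P.2 Q.2).
Proof.
split=> [/Mat_posP Xp|Xp].
  have := fpsd_comp (fun P : 'I_n * ('I_k * 'I_l) => (P.1, mxtens_index P.2)) Xp.
  by apply: fpsd_ext => P Q; rewrite mxE.
apply/Mat_posP.
have := fpsd_comp (fun P : 'I_n * 'I_(k * l) => (P.1, mxtens_unindex P.2)) Xp.
by apply: fpsd_ext => P Q; rewrite mxE /tmap /= !mxtens_unindexK.
Qed.

Hypotheses (phi_ucp : ucp phi) (psi_ucp : ucp psi).

Lemma tmap_unit p q : tmap (tens (os_unit S) (os_unit T)) p q = (p == q)%:R.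
Proof.
rewrite tmap_tens phi_ucp.1 psi_ucp.1 !Mat_unitE -natrM mulnb.
by case: p q => [a b] [c d].
Qed.

Lemma tmap_unit_mx n (e : R) (P Q : 'I_n * ('I_k * 'I_l)) :
  tmap (mxtensv (e%:C%C)%:M (tens (os_unit S) (os_unit T)) P.1 Q.1) P.2 Q.2 =
  e%:C%C * (P == Q)%:R.
Proof.
rewrite mxE tmapZ tmap_unit mxE.
by case: P Q => [a b] [c d] /=; rewrite -(mulr_natr e%:C%C) -mulrA -natrM mulnb.
Qed.

Lemma tmap_mxtens_pos k' l' (P : 'M[S]_k') (Q : 'M[T]_l') : os_pos P -> os_pos Q ->
  fpsd (fun p q : 'I_(k' * l') * ('I_k * 'I_l) => tmap (mxtens P Q p.1 q.1) p.2 q.2).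
Proof.
move=> /phi_ucp.2/Mat_posP hP /psi_ucp.2/Mat_posP hQ.
have := fpsd_comp (fun p : 'I_(k' * l') * ('I_k * 'I_l) =>
  (((mxtens_unindex p.1).1, p.2.1), ((mxtens_unindex p.1).2, p.2.2)))
  (fpsd_kron hP hQ).
by apply: fpsd_ext => p q; rewrite !mxE tmap_tens.
Qed.

End matrix_coefficients.

(** The max cones are contained in the min cones: Kronecker products of positive
    matrices are positive, and the min cones are closed. *)
Lemma max_pos_min_pos n (X : 'M[tensor S T]_n) : max_pos X -> min_pos X.
Proof.
move=> Xmax k l phi psi phi_ucp psi_ucp; apply/tmap_pos.
apply: (fpsd_limit (D := fun P Q : 'I_n * ('I_k * 'I_l) => (P == Q)%:R)) => d d0.
have [k' [l' [P [Q [A [Pp Qp E]]]]]] := Xmax d d0.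
have := fpsd_congr (fun i p : _ * ('I_k * 'I_l) => (i.2 == p.2)%:R * A i.1 p.1)
  (tmap_mxtens_pos phi_ucp psi_ucp Pp Qp).
apply: fpsd_ext => -[i a] [j b] /=.
have -> : tmap phi psi (X i j) a b + d%:C%C * ((i, a) == (j, b))%:R =
    tmap phi psi (mxcongr A (mxtens P Q) i j) a b.
  by rewrite -E mxE tmapD -(tmap_unit_mx phi_ucp psi_ucp d (i, a) (j, b)).
rewrite mxE tmap_sum sum_pair; apply: eq_bigr => p _.
rewrite (bigD1 a)//= [X in _ + X]big1 ?addr0 => [|c /negPf ca]; last first.
  by rewrite big1// => q _; rewrite eq_sym ca !mul0r.
rewrite tmap_sum sum_pair; apply: eq_bigr => q _.
rewrite (bigD1 b)//= [X in _ + X]big1 ?addr0 => [|c /negPf cb].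
  by rewrite !eqxx !mul1r tmapZ.
by rewrite (eq_sym b) cb mul0r rmorph0 mulr0 mul0r.
Qed.

Lemma min_pos_unit n (X : 'M[tensor S T]_n) (e : R) : 0 < e -> min_pos X ->
  min_pos (X + mxtensv (e%:C%C)%:M (tens (os_unit S) (os_unit T))).
Proof.
move=> e0 Xp k l phi psi phi_ucp psi_ucp; apply/tmap_pos.
have /tmap_pos h1 := Xp _ _ _ _ phi_ucp psi_ucp.
have e0' : 0 <= e%:C%C by rewrite ler0c ltW.
have h2 := fpsdZ e0' (@fpsd_id R ('I_n * ('I_k * 'I_l))%type).
apply: fpsd_ext (fpsdD h1 h2) => P Q.
by rewrite mxE tmapD -(tmap_unit_mx phi_ucp psi_ucp).
Qed.

End min_max.

(** * Expansion of tensors in generators *)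

Section representation.
Variables (R : realType) (I_ : nat -> Type).
Local Notation C := R[i].
Local Notation L := {k : nat & I_ k}.
Local Notation CI := (frakC R I_).

(** The matrix size of a summand. *)
Definition dimL (l : L) : nat := (tag l).+1.

(** The image of a generator in the coproduct. *)
Definition egen (l : L) eps a b : CI :=
  @coprod_inj R L (fun i => frakc R (tag i).+1) l (gen R (dimL l) eps a b).

Lemma frakC_unitE (l : L) : os_unit CI = 
  @coprod_inj R L (fun i => frakc R (tag i).+1) l (os_unit (frakc R (dimL l))).
Proof. exact: coprod_unitE. Qed.

Section with_factor.
Variables (T : opsys R) (n : nat) (X : 'M[tensor CI T]_n).
Local Notation G := ({classic L} * bool * nat * nat)%type.

Let e (g : G) : CI := egen g.1.1.1 g.1.1.2 g.1.2 g.2.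
Let inr (g : G) := (g.1.2 < dimL g.1.1.1)%N && (g.2 < dimL g.1.1.1)%N.

(** The elements that have such an expansion. *)
Let P : set (tensor CI T) := [set z | exists rs : seq (G * T),
  (forall r, r \in rs -> inr r.1) /\ z = \sum_(r <- rs) tens (e r.1) r.2].

Let P_sub : subspace_of P.
Proof.
split; first by exists [::]; rewrite big_nil.
move=> a _ _ [r1 [h1 ->]] [r2 [h2 ->]].
exists ([seq (r.1, a *: r.2) | r <- r1] ++ r2); split.
  by move=> r; rewrite mem_cat => /orP[/mapP[r' r'1 ->]|/h2//]; exact: (h1 r').
rewrite big_cat big_map scaler_sumr; congr (_ + _); apply: eq_bigr => r _.
by rewrite tensZr.
Qed.

Let PD z z' : P z -> P z' -> P (z + z').
Proof. by move=> Pz Pz'; rewrite -[z]scale1r; exact: P_sub.2. Qed.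

Let PZ a z : P z -> P (a *: z).
Proof. by move=> Pz; rewrite -[_ *: z]addr0; apply: P_sub.2 => //; exact: P_sub.1. Qed.

Let P_all z : P z.
Proof.
apply: (tensor_ind P_sub) => s t; have [ls [f ->]] := coprod_decomp s.
rewrite tens_suml; elim/big_ind: _ => [|z1 z2|l _]; [exact: P_sub.1|exact: PD|].
rewrite (frakc_decomp (f l)) coprod_inj_sum tens_suml.
elim/big_ind: _ => [|z1 z2|eps _]; [exact: P_sub.1|exact: PD|].
rewrite coprod_inj_sum tens_suml.
elim/big_ind: _ => [|z1 z2|a _]; [exact: P_sub.1|exact: PD|].
rewrite coprod_inj_sum tens_suml.
elim/big_ind: _ => [|z1 z2|b _]; [exact: P_sub.1|exact: PD|].
rewrite coprod_injZ tensZl; apply: PZ.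
exists [:: ((l : {classic L}, eps, a : nat, b : nat), t)]; split.
  by move=> r; rewrite inE => /eqP ->; rewrite /inr /= !ltn_ord.
by rewrite big_seq1.
Qed.

(** A matrix over the tensor product involves finitely many summands [l a] and has
    an expansion in their generators; [K] bounds their sizes, and the
    coefficients of the generators that are 0 are chosen to be 0. *)
Lemma frakC_representation (l0 : L) : exists (m K : nat) (l : 'I_m.+1 -> L)
    (x : 'I_m.+1 * bool * 'I_K -> 'I_K -> 'M[T]_n),
  [/\ injective l, forall a, (dimL (l a) <= K)%N,
      forall (P : 'I_m.+1 * bool * 'I_K) (b : 'I_K), ~~ ((P.2 < dimL (l P.1.1))%N && (b < dimL (l P.1.1))%N) ->
        x P b = 0 &
      forall i j, X i j =
        \sum_(P : 'I_m.+1 * bool * 'I_K) \sum_(b < K)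
          tens (egen (l P.1.1) P.1.2 P.2 b) (x P b i j)].
Proof.
pose rs i j := projT1 (cid (P_all (X i j))).
have rs_inr i j r : r \in rs i j -> inr r.1.
  by rewrite /rs; case: cid => s' h; exact: h.1.
have XE i j : X i j = \sum_(r <- rs i j) tens (e r.1) r.2.
  by rewrite /rs; case: cid => s' h; exact: h.2.
pose s : seq {classic L} := undup ((l0 : {classic L}) ::
  flatten [seq [seq r.1.1.1.1 | r <- rs ij.1 ij.2] | ij <- enum {: 'I_n * 'I_n}]).
have s_mem i j r : r \in rs i j -> r.1.1.1.1 \in s.
  move=> rij; rewrite mem_undup inE; apply/orP; right.
  apply/flattenP; exists [seq r.1.1.1.1 | r <- rs i j]; last exact: map_f.
  by apply/mapP; exists (i, j); rewrite ?mem_enum.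
have s0 : (0 < size s)%N.
  have : (l0 : {classic L}) \in s by rewrite mem_undup inE eqxx.
  by case: (s).
pose m := (size s).-1; have mE : m.+1 = size s by rewrite prednK.
pose l (a : 'I_m.+1) : L := nth (l0 : {classic L}) s a.
pose K := \max_(a < m.+1) dimL (l a).
have lK a : (dimL (l a) <= K)%N by exact: leq_bigmax.
pose g (Pb : 'I_m.+1 * bool * 'I_K * 'I_K) : G :=
  ((l Pb.1.1.1 : {classic L}), Pb.1.1.2, Pb.1.2 : nat, Pb.2 : nat).
have l_inj : injective l.
  move=> a b E.
  have : nth (l0 : {classic L}) s a == nth (l0 : {classic L}) s b by apply/eqP.
  rewrite nth_uniq -?mE ?ltn_ord ?undup_uniq// => /eqP; exact: val_inj.
have g_inj : injective g.
  move=> [[[a eps] p] q] [[[a' eps'] p'] q'] [/l_inj -> ->].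
  by move=> /val_inj -> /val_inj ->.
exists m, K, l, (fun P b => \matrix_(i, j) \sum_(r <- rs i j | r.1 == g (P, b)) r.2).
split=> // [Q b out|i j].
  apply/matrixP => i j; rewrite !mxE big_seq_cond big1// => r /andP[/rs_inr + /eqP E].
  by rewrite E /inr /= (negPf out).
rewrite XE; transitivity (\sum_(Qb : 'I_m.+1 * bool * 'I_K * 'I_K)
    \sum_(r <- rs i j) if r.1 == g Qb then tens (e r.1) r.2 else 0); last first.
  rewrite sum_pair; apply: eq_bigr => Q _; apply: eq_bigr => b _.
  by rewrite mxE tens_sumr -big_mkcond; apply: eq_bigr => r /eqP ->.
rewrite [RHS]exchange_big [LHS]big_seq [RHS]big_seq; apply: eq_bigr => r rij.
have [Qb rE] : exists Qb, r.1 = g Qb.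
  have /andP[pK qK] := rs_inr _ _ _ rij.
  have al : (index r.1.1.1.1 s < m.+1)%N by rewrite mE index_mem; exact: s_mem rij.
  have lE : l (Ordinal al) = r.1.1.1.1 by rewrite /l /= nth_index//; exact: s_mem rij.
  have p1 : (r.1.1.2 < K)%N by rewrite (leq_trans pK)// -lE.
  have q1 : (r.1.2 < K)%N by rewrite (leq_trans qK)// -lE.
  exists (Ordinal al, r.1.1.1.2, Ordinal p1, Ordinal q1).
  by rewrite /g /= lE; case: (r.1) => [[[]]].
have rQ : (r.1 == g Qb) = true by rewrite rE eqxx.
rewrite (bigD1 Qb) // rQ [X in _ = _ X]big1 => [|Qb' QQ]; first exact/esym/addr0.
by rewrite rE (inj_eq g_inj) eq_sym (negPf QQ).
Qed.

End with_factor.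
End representation.

(** * Min-positive elements under completely positive families *)

Section choi_families.
Local Open Scope sesquilinear_scope.
Variables (R : realType) (I_ : nat -> Type) (T : opsys R) (n p q : nat).
Local Notation C := R[i].
Local Notation L := {k : nat & I_ k}.
Local Notation CI := (frakC R I_).
Variables (l0 : L) (X : 'M[tensor CI T]_n).
Variables (J : finType) (g : J -> L * bool * nat * nat) (x : J -> 'M[T]_n).
Hypothesis x_out : forall r, ~~ (((g r).1.2 < dimL (g r).1.1.1)%N &&
  ((g r).2 < dimL (g r).1.1.1)%N) -> x r = 0.
Hypothesis XE : forall i j, X i j =
  \sum_r tens (egen R (g r).1.1.1 (g r).1.1.2 (g r).1.2 (g r).2) (x r i j).
Variables (psi : {linear T -> Mat R q}) (psi_ucp : ucp psi).
Variables (c : L -> bool -> nat -> nat -> 'M[C]_p) (rho : 'M[C]_p) (d : C).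
Hypothesis c_cp : forall l eps, fpsd (fun P Q : 'I_(dimL l) * 'I_p =>
  c l eps P.1 Q.1 P.2 Q.2).
Hypothesis c_unit : forall l, \sum_(eps : bool) \sum_(a < dimL l) c l eps a a = rho.
Hypothesis d_gt0 : 0 < d.
Hypothesis rho_posdef : forall v : 'I_p -> C,
  d * \sum_i (v i)^* * v i <= \sum_i \sum_j (v i)^* * rho i j * v j.

(** A min-positive element is sent to a positive matrix by every completely
    positive family with a common positive definite value at the units: such a
    family is congruent to a unital one. *)
Lemma min_pos_choi : min_pos X -> fpsd (fun P Q : 'I_n * ('I_p * 'I_q) =>
  \sum_r c (g r).1.1.1 (g r).1.1.2 (g r).1.2 (g r).2 P.2.1 Q.2.1 *
         (psi (x r P.1 Q.1) : 'M[C]_q) P.2.2 Q.2.2).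
Proof.
move=> Xmin; have [B Bu BE] := posdef_factor d_gt0 rho_posdef.
pose A := invmx B.
have AB : A *m B = 1%:M by exact: mulVmx.
have BA : B *m A = 1%:M by exact: mulmxV.
have ABt : B ^t* *m A ^t* = 1%:M by rewrite -map_mxM -trmx_mul AB trmx1 map_mx1.
pose c' l eps a b : 'M[C]_p := A *m c l eps a b *m A ^t*.
have mul3E (U V W : 'M[C]_p) s t :
    (U *m V *m W ^t*) s t = \sum_i \sum_j U s i * (W t j)^* * V i j.
  rewrite mxE [RHS]exchange_big; apply: eq_bigr => j _; rewrite !mxE mulr_suml.
  by apply: eq_bigr => i _; ring.
have c'_cp l eps : fpsd (fun P Q : 'I_(dimL l) * 'I_p => c' l eps P.1 Q.1 P.2 Q.2).
  apply: fpsd_ext (fpsd_congr_snd A (@c_cp l eps)) => P Q /=.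
  by rewrite mul3E.
have c'_unit l : choi_map (c' l) (os_unit (frakc R (dimL l))) = os_unit (Mat R p).
  apply: MatP => s t; rewrite choi_map_unit Mat_unitE.
  transitivity ((A *m rho *m A ^t*) s t); last first.
    by rewrite BE -!mulmxA ABt mulmx1 AB mxE.
  rewrite -(c_unit l) mulmx_sumr mulmx_suml summxE; apply: eq_bigr => eps _.
  by rewrite mulmx_sumr mulmx_suml summxE.
have [Phi [Phi_ucp PhiE]] := @coprod_ucp R L (fun i => frakc R (tag i).+1) p
  (fun l => choi_map (c' l)) (fun l => choi_map_linear (c' l)) c'_unit
  (fun l => choi_map_cp (c'_cp l)) l0.
have /tmap_pos Fp := Xmin _ _ Phi psi Phi_ucp psi_ucp.
have PhiE' r : ((g r).1.2 < dimL (g r).1.1.1)%N -> ((g r).2 < dimL (g r).1.1.1)%N ->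
    forall s t, (Phi (egen R (g r).1.1.1 (g r).1.1.2 (g r).1.2 (g r).2) : 'M[C]_p) s t =
    c' (g r).1.1.1 (g r).1.1.2 (g r).1.2 (g r).2 s t.
  move=> h1 h2 s t; rewrite PhiE.
  by have := choi_map_gen (c' (g r).1.1.1) (g r).1.1.2 (Ordinal h1) (Ordinal h2) s t.
have FE i j s t s' t' : tmap Phi psi (X i j) (s, t) (s', t') =
    \sum_r c' (g r).1.1.1 (g r).1.1.2 (g r).1.2 (g r).2 s s' *
      (psi (x r i j) : 'M[C]_q) t t'.
  rewrite XE tmap_sum; apply: eq_bigr => r _; rewrite tmap_tens.
  have [/andP[h1 h2]|/x_out ->] := boolP (((g r).1.2 < dimL (g r).1.1.1)%N &&
    ((g r).2 < dimL (g r).1.1.1)%N); first by rewrite PhiE'.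
  by rewrite mxE linear0 [(0 : Mat R q) _ _]mxE !mulr0.
have cE l eps a b : c l eps a b = B *m c' l eps a b *m B ^t*.
  by rewrite /c' !mulmxA BA mul1mx -mulmxA -map_mxM -trmx_mul BA trmx1 map_mx1 mulmx1.
have := fpsd_congr_snd B (fpsd_comp
  (fun P : ('I_n * 'I_q) * 'I_p => (P.1.1, (P.2, P.1.2))) Fp).
move=> /(fpsd_comp (fun P : 'I_n * ('I_p * 'I_q) => ((P.1, P.2.2), P.2.1))).
apply: fpsd_ext => -[i [s t]] [j [s' t']] /=.
transitivity (\sum_u \sum_v \sum_r B s u * (B s' v)^* *
   (c' (g r).1.1.1 (g r).1.1.2 (g r).1.2 (g r).2 u v * (psi (x r i j) : 'M[C]_q) t t')).
  by apply: eq_bigr => u _; apply: eq_bigr => v _; rewrite FE mulr_sumr.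
rewrite (eq_bigr _ (fun u _ => exchange_big _ _ _ _ _ _)) exchange_big /=.
apply: eq_bigr => r _.
rewrite cE mul3E mulr_suml; apply: eq_bigr => u _; rewrite mulr_suml.
by apply: eq_bigr => v _; rewrite mulrA.
Qed.

End choi_families.

(** * Compressions of B(H) *)

Section compression.
Variables (R : realType) (H : hilbert R) (q : nat) (e : 'I_q -> H).
Hypothesis oe : orthonormal e.
Local Notation C := R[i].

(** Compression to the span of an orthonormal family. *)
Lemma compression_ucp : exists psi : {linear BH H -> Mat R q}, ucp psi /\
  forall (A : bop H) t t', (psi A : 'M[C]_q) t t' = ip (A (e t')) (e t).
Proof.
pose f (A : BH H) : Mat R q := \matrix_(t, t') ip ((A : bop H) (e t')) (e t).
have fE (A : bop H) t t' : (f A : 'M[C]_q) t t' = ip (A (e t')) (e t) by rewrite mxE.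
have fl : linear f.
  move=> a A B; apply: MatP => t t'; rewrite Mat_linE !fE.
  by rewrite (bop_DE (a *: A : bop H) B) ipDl (bop_ZE a A) ipZl.
pose psi : {linear BH H -> Mat R q} := HB.pack_for {linear BH H -> Mat R q} f
  (GRing.isLinear.Build C (BH H) (Mat R q) *:%R f fl).
exists psi; split=> //; split.
  apply: MatP => t t'; rewrite -[psi _]/(f _) fE Mat_unitE.
  by rewrite [LHS](oe t' t) eq_sym.
move=> n X Xp; apply/Mat_posP => v.
pose h i : H := \sum_t v (i, t) *: e t.
have := Xp h; congr (0 <= _).
rewrite [RHS]sum_pair; apply: eq_bigr => i _.
transitivity (\sum_j \sum_t \sum_t' (v (i, t))^* * ip (X i j (e t')) (e t) * v (j, t')).
  apply: eq_bigr => j _; rewrite -[hil_dot _ _ _]/(ip _ _) {2}/h ip_sumr.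
  apply: eq_bigr => t _; rewrite ipZr /h bop_sum ip_suml mulr_sumr.
  by apply: eq_bigr => t' _; rewrite bopZ ipZl -mulrA [v _ * _]mulrC.
rewrite exchange_big; apply: eq_bigr => t _; rewrite [RHS]sum_pair.
by apply: eq_bigr => j _; apply: eq_bigr => t' _; rewrite mxE -[psi _]/(f _) fE.
Qed.

End compression.

(** * Positivity of functionals that vanish on null blocks *)

Section decomposition.
Variables (R : realType) (I_ : nat -> Type) (H : hilbert R) (n m K : nat).
Local Notation C := R[i].
Local Notation L := {k : nat & I_ k}.
Local Notation CI := (frakC R I_).
Local Notation J0 := ('I_m.+1 * bool * 'I_K)%type.
Local Notation J := (J0 * 'I_n)%type.
Local Notation Y := (J -> J -> bop H).
Variables (X : 'M[tensor CI (BH H)]_n) (l : 'I_m.+1 -> L).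
Variable x : J0 -> 'I_K -> 'M[BH H]_n.
Hypothesis l_inj : injective l.
Hypothesis l_K : forall a, (dimL (l a) <= K)%N.
Hypothesis x_out : forall (P : J0) (b : 'I_K),
  ~~ ((P.2 < dimL (l P.1.1))%N && (b < dimL (l P.1.1))%N) -> x P b = 0.
Hypothesis XE : forall i j, X i j =
  \sum_(P : J0) \sum_(b < K) tens (egen R (l P.1.1) P.1.2 P.2 b) (x P b i j).
Hypothesis X_min : min_pos X.

(** The entries of [X] as one matrix of operators, block diagonal over the
    summands and the endpoints of [0, 1]. *)
Definition blocks : Y :=
  fun p q => if p.1.1 == q.1.1 then x p.1 q.1.2 p.2 q.2 else 0.

(** The matrices [z] with diagonal blocks [1 (x) y_a] such that [sum_a y_a = 0].
    They represent 0 in the tensor product, because all units are identified in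
    the coproduct. The entries outside the diagonal blocks are arbitrary, and the
    entries beyond the size of a summand are 0. *)
Definition null_blocks : set Y := [set z |
  exists2 y : 'I_m.+1 -> 'I_n -> 'I_n -> bop H,
    forall i j, \sum_a y a i j = 0 &
    forall p q : J, p.1.1 = q.1.1 -> z p q =
      if (p.1.2 == q.1.2) && (p.1.2 < dimL (l p.1.1.1))%N
      then y p.1.1.1 p.2 q.2 else 0].

Lemma null_blocks_i z : null_blocks z -> null_blocks (fun p q => 'i%C *: z p q).
Proof.
move=> [y y0 zE]; exists (fun a i j => 'i%C *: y a i j).
  by move=> i j; rewrite -scaler_sumr y0 scaler0.
by move=> p q pq; rewrite zE//; case: ifP => //; rewrite scaler0.
Qed.

(** Multiplying by the weights turns the trace of [1 (x) y_a] into a multiple of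
    the trace of [y_a] that does not depend on [a]. *)
Definition weight (p : J) : R := (dimL (l p.1.1.1))%:R^-1.

Lemma weight_gt0 p : 0 < weight p.
Proof. by rewrite invr_gt0 ltr0n. Qed.

Lemma null_blocks_weight z h : null_blocks z ->
  \sum_p (weight p)%:C%C * ip (z p p h) h = 0.
Proof.
move=> [y y0 zE].
have dimC a : \sum_(b < K) (if (b < dimL (l a))%N then (dimL (l a))%:R^-1 else 0 : C) = 1.
  rewrite -big_mkcond -(big_ord_widen K (fun=> (dimL (l a))%:R^-1 : C))//.
  by rewrite sumr_const card_ord -(mulr_natr (_^-1)) mulVf// pnatr_eq0.
transitivity (\sum_(i < n) \sum_(eps : bool) \sum_a ip (y a i i h) h); last first.
  rewrite big1// => i _; rewrite big1// => eps _.
  by rewrite -ip_suml -bop_sumE y0 bop_0E ip0l.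
rewrite sum_pair exchange_big /=; apply: eq_bigr => i _.
rewrite sum_pair sum_pair exchange_big /=; apply: eq_bigr => eps _.
apply: eq_bigr => a _.
rewrite -[RHS]mul1r -(dimC a) mulr_suml; apply: eq_bigr => b _.
rewrite zE//= eqxx /=; case: ifP => _; last by rewrite bop_0E ip0l mulr0 mul0r.
by rewrite /weight /= fmorphV rmorph_nat.
Qed.

(** The form of a block diagonal matrix. *)
Lemma opform_blocks (z : Y) (f : J0 -> 'I_K -> 'M[bop H]_n) (v : J -> H) :
  (forall p q : J, z p q = if p.1.1 == q.1.1 then f p.1 q.1.2 p.2 q.2 else 0) ->
  opform z v v = \sum_(P : J0) \sum_(b < K) \sum_i \sum_j
    ip (f P b i j (v ((P.1, b), j))) (v (P, i)).
Proof.
move=> zE; rewrite /opform sum_pair; apply: eq_bigr => P _.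
rewrite [RHS]exchange_big /=; apply: eq_bigr => i _.
rewrite sum_pair.
rewrite sum_pair (bigD1 P.1)//= [X in _ + X]big1 ?addr0 => [|k /negPf kP]; last first.
  rewrite big1// => b _; rewrite big1// => j _.
  by rewrite zE /= eq_sym kP bop_0E ip0l.
by apply: eq_bigr => b _; apply: eq_bigr => j _; rewrite zE /= eqxx.
Qed.

Section positivity.
Variables (S0 : finType) (v : S0 -> J -> H).
Hypothesis v_null : forall z, null_blocks z -> \sum_t opform z (v t) (v t) = 0.
Variables (q : nat) (e : 'I_q -> H) (cf : S0 * J -> 'I_q -> C).
Hypothesis oe : orthonormal e.
Hypothesis vE : forall r p, v r p = \sum_t cf (r, p) t *: e t.
Local Notation V := ('I_n * 'I_q)%type.

(** The Choi matrices of the functional [z |-> sum_r <z v_r, v_r>] in the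
    orthonormal family [e]. *)
Let D (P Q : J0) (s s' : V) : C :=
  \sum_r (cf (r, (P, s.1)) s.2)^* * cf (r, (Q, s'.1)) s'.2.

Let sum_opform (z : Y) (f : J0 -> 'I_K -> 'M[bop H]_n) :
  (forall p q : J, z p q = if p.1.1 == q.1.1 then f p.1 q.1.2 p.2 q.2 else 0) ->
  \sum_r opform z (v r) (v r) = \sum_(P : J0) \sum_(b < K) \sum_(s : V) \sum_(s' : V)
    D P (P.1, b) s s' * ip (f P b s.1 s'.1 (e s'.2)) (e s.2).
Proof.
move=> zE; under eq_bigr do rewrite (opform_blocks _ zE).
rewrite exchange_big /=; apply: eq_bigr => P _.
rewrite exchange_big /=; apply: eq_bigr => b _.
rewrite sum_pair exchange_big /=; apply: eq_bigr => i _.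
transitivity (\sum_t \sum_j \sum_t' \sum_r ((cf (r, (P, i)) t)^* *
   cf (r, ((P.1, b), j)) t' * ip (f P b i j (e t')) (e t))); last first.
  apply: eq_bigr => t _; rewrite sum_pair; apply: eq_bigr => j _.
  by apply: eq_bigr => t' _; rewrite /D mulr_suml.
transitivity (\sum_r \sum_j \sum_t \sum_t' ((cf (r, (P, i)) t)^* *
   cf (r, ((P.1, b), j)) t' * ip (f P b i j (e t')) (e t))).
  apply: eq_bigr => r _; apply: eq_bigr => j _.
  rewrite !vE ip_sumr; apply: eq_bigr => t _.
  rewrite ipZr bop_sum ip_suml mulr_sumr; apply: eq_bigr => t' _.
  by rewrite bopZ ipZl mulrA.
rewrite exchange_big /= [RHS]exchange_big /=; apply: eq_bigr => j _.
rewrite exchange_big /=; apply: eq_bigr => t _.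
by rewrite exchange_big.
Qed.

(** The values at the units of the maps with Choi matrices [D]. *)
Let diag a s s' : C := \sum_(eps : bool) \sum_(b < K | (b < dimL (l a))%N)
  D (a, eps, b) (a, eps, b) s s'.

(** The maps have the same value at all units, since the functional kills
    [null_blocks]. *)
Let diagE a s s' : diag a s s' = diag ord0 s s'.
Proof.
have [A AE] := rank_one (e s.2) (e s'.2).
pose co (a' : 'I_m.+1) : C := (a' == a)%:R - (a' == ord0)%:R.
pose y (a' : 'I_m.+1) (i j : 'I_n) : bop H :=
  (co a' * ((i == s.1) && (j == s'.1))%:R) *: A.
pose f (P : J0) (b : 'I_K) : 'M[bop H]_n := \matrix_(i, j)
  (if (P.2 == b) && (P.2 < dimL (l P.1.1))%N then y P.1.1 i j else 0).
pose z : Y := fun p q => if p.1.1 == q.1.1 then f p.1 q.1.2 p.2 q.2 else 0.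
have zN : null_blocks z.
  exists y => [i j|p p' pp'].
    rewrite -scaler_suml -mulr_suml sumrB.
    have s1 (b : 'I_m.+1) : \sum_a' (a' == b)%:R = 1 :> C.
      by rewrite (bigD1 b)//= eqxx big1 ?addr0// => a' /negPf ->.
    by rewrite !s1 subrr mul0r scale0r.
  by rewrite /z pp' eqxx mxE pp'.
have /eqP := v_null zN; rewrite (@sum_opform z f) //.
have -> : \sum_P \sum_b \sum_s0 \sum_s0' D P (P.1, b) s0 s0' *
    ip (f P b s0.1 s0'.1 (e s0'.2)) (e s0.2) =
    \sum_(P : J0) (if (P.2 < dimL (l P.1.1))%N then co P.1.1 * D P P s s' else 0).
  apply: eq_bigr => -[[a' eps] b] _ /=.
  rewrite (bigD1 b)//= [X in _ + X]big1 ?addr0 => [|b' /negPf bb]; last first.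
    rewrite big1// => s1 _; rewrite big1// => s2 _.
    by rewrite mxE /= eq_sym bb bop_0E ip0l mulr0.
  have ipf s1 s2 : ip (f (a', eps, b) b s1.1 s2.1 (e s2.2)) (e s1.2) =
      (if (b < dimL (l a'))%N then co a' else 0) * ((s1 == s) && (s2 == s'))%:R.
    rewrite mxE /= eqxx /=; case: ifP => _; last by rewrite bop_0E ip0l mul0r.
    rewrite bop_ZE ipZl AE ipZl !oe (eq_sym s.2).
    rewrite -!mulrA -!natrM !mulnb; congr (_ * (_ : bool)%:R).
    have pe (t t' : V) : (t == t') = (t.1 == t'.1) && (t.2 == t'.2).
      by case: t t' => [? ?] [? ?].
    by rewrite !pe; do !case: (_ == _).
  rewrite (bigD1 s)//= [X in _ + X]big1 ?addr0 => [|s1 /negPf ss]; last first.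
    by rewrite big1// => s2 _; rewrite ipf ss mulr0 mulr0.
  rewrite (bigD1 s')//= [X in _ + X]big1 ?addr0 => [|s2 /negPf ss]; last first.
    by rewrite ipf ss andbF mulr0 mulr0.
  by rewrite ipf !eqxx mulr1; case: ifP => _; rewrite ?mulr0// mulrC.
have s1 (b : 'I_m.+1) : \sum_a' (a' == b)%:R * diag a' s s' = diag b s s'.
  by rewrite (bigD1 b)//= eqxx mul1r big1 ?addr0// => a' /negPf ->; rewrite mul0r.
rewrite !sum_pair.
have -> : \sum_(a0 < m.+1) \sum_(b : bool) \sum_(b0 < K) (if (b0 < dimL (l a0))%N then
      co a0 * D (a0, b, b0) (a0, b, b0) s s' else 0) =
    \sum_a0 ((a0 == a)%:R * diag a0 s s' - (a0 == ord0)%:R * diag a0 s s').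
  apply: eq_bigr => a0 _; rewrite -mulrBl -/(co a0) mulr_sumr.
  by apply: eq_bigr => eps _; rewrite -big_mkcond mulr_sumr.
by rewrite sumrB !s1 subr_eq0 => /eqP.
Qed.

Local Notation p := (n * q)%N.

(** The vectors of the Choi matrices, with natural numbers as indices. *)
Let cn (a : 'I_m.+1) (eps : bool) (b : nat) r (s : V) : C :=
  oapp (fun b' : 'I_K => cf (r, ((a, eps, b'), s.1)) s.2) 0 (insub b).

Let cnE a eps (b : 'I_K) r s : cn a eps b r s = cf (r, ((a, eps, b), s.1)) s.2.
Proof. by rewrite /cn valK. Qed.

(** The state of [frakc] that takes the upper left entry at [t = 0] has the Choi
    matrix [g eps b * g eps b']. *)
Let g (eps : bool) (b : nat) : C := (~~ eps && (b == 0%N))%:R.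

Let g_sum N : (0 < N)%N -> \sum_(eps : bool) \sum_(b < N) g eps b * g eps b = 1.
Proof.
case: N => // N _; rewrite big_bool /= [X in X + _]big1 => [|b _]; last first.
  by rewrite /g mul0r.
rewrite add0r big_ord_recl big1 ?addr0 => [|b _]; last by rewrite /g mul0r.
by rewrite /g mulr1.
Qed.

(** The common value at the units after a perturbation by [d] times that state;
    it is positive definite. *)
Let dg (d : R) (s s' : V) : C := diag ord0 s s' + d%:C%C * (s == s')%:R.

(** The family of Choi matrices on all summands: the perturbed matrices [D] on the
    summands [l a], and the state times the common value at the units on the
    others. *)
Let chm d (lam : L) (eps : bool) (b b' : nat) : 'M[C]_p :=
  \matrix_(s, s') (if [pick a | (l a : {classic L}) == lam] is Some a then
    \sum_r (cn a eps b r (mxtens_unindex s))^* * cn a eps b' r (mxtens_unindex s')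
      + d%:C%C * (g eps b * g eps b' * (s == s')%:R)
    else g eps b * g eps b' * dg d (mxtens_unindex s) (mxtens_unindex s')).

Let pickE a : [pick a' | (l a' : {classic L}) == l a] = Some a.
Proof.
case: pickP => [a' /eqP E|/(_ a)]; last by rewrite eqxx.
by rewrite (l_inj E).
Qed.

Let diag_psd a : fpsd (diag a).
Proof.
suff h : fpsd (fun s s' => \sum_(eps : bool) \sum_(b < K)
    (b < dimL (l a))%N%:R * D (a, eps, b) (a, eps, b) s s').
  apply: fpsd_ext h => s s'; apply: eq_bigr => eps _; rewrite [RHS]big_mkcond.
  by apply: eq_bigr => b _; case: ifP => _; rewrite ?mul1r ?mul0r.
apply: fpsd_sum => eps; apply: fpsd_sum => b; apply: fpsdZ; first exact: ler0n.
apply: fpsd_sum => r.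
apply: fpsd_ext (fpsd_rank_one (fun s : V => (cf (r, ((a, eps, b), s.1)) s.2)^*)) => s s'.
by rewrite conjCK.
Qed.

Let dg_psd d : 0 < d -> fpsd (dg d).
Proof.
move=> d0; apply: fpsdD; first exact: diag_psd.
by apply: fpsdZ (@fpsd_id _ _); rewrite ler0c ltW.
Qed.

Let g_psd eps N : fpsd (fun b b' : 'I_N => g eps b * g eps b').
Proof.
apply: fpsd_ext (fpsd_rank_one (fun b : 'I_N => g eps b)) => b b'.
by rewrite /g rmorph_nat.
Qed.

Let chm_cp d : 0 < d -> forall lam eps,
  fpsd (fun P Q : 'I_(dimL lam) * 'I_p => chm d lam eps P.1 Q.1 P.2 Q.2).
Proof.
move=> d0 lam eps; rewrite /chm.
have gk (Z : 'I_p -> 'I_p -> C) : fpsd Z ->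
    fpsd (fun P Q : 'I_(dimL lam) * 'I_p => g eps P.1 * g eps Q.1 * Z P.2 Q.2).
  by move=> Zp; exact: (fpsd_kron (@g_psd eps (dimL lam)) Zp).
case E: [pick a | _] => [a|].
  have h1 : fpsd (fun P Q : 'I_(dimL lam) * 'I_p =>
     \sum_r (cn a eps P.1 r (mxtens_unindex P.2))^* *
             cn a eps Q.1 r (mxtens_unindex Q.2)).
    apply: fpsd_sum => r.
    apply: fpsd_ext (fpsd_rank_one (fun P : 'I_(dimL lam) * 'I_p =>
      (cn a eps P.1 r (mxtens_unindex P.2))^*)) => P Q.
    by rewrite conjCK.
  have d0' : 0 <= d%:C%C by rewrite ler0c ltW.
  have h2 := fpsdZ d0' (gk _ (@fpsd_id _ _)).
  by apply: fpsd_ext (fpsdD h1 h2) => P Q; rewrite mxE.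
have := gk _ (fpsd_comp (@mxtens_unindex n q) (dg_psd d0)).
by apply: fpsd_ext => P Q; rewrite mxE.
Qed.

Let rho d : 'M[C]_p := \matrix_(s, s') dg d (mxtens_unindex s) (mxtens_unindex s').

Let chm_unit d lam : \sum_(eps : bool) \sum_(b < dimL lam) chm d lam eps b b = rho d.
Proof.
apply/matrixP => s s'; rewrite summxE mxE.
under eq_bigr do rewrite summxE.
case E: [pick a | (l a : {classic L}) == lam] => [a|]; last first.
  transitivity (\sum_(eps : bool) \sum_(b < dimL lam) g eps b * g eps b *
      dg d (mxtens_unindex s) (mxtens_unindex s')).
    by apply: eq_bigr => eps _; apply: eq_bigr => b _; rewrite mxE E.
  under eq_bigr do rewrite -mulr_suml.
  by rewrite -mulr_suml g_sum// mul1r.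
have lE : lam = l a by move: E; case: pickP => // a' /eqP lE [<-].
transitivity (\sum_(eps : bool) \sum_(b < dimL lam)
    (\sum_r (cn a eps b r (mxtens_unindex s))^* * cn a eps b r (mxtens_unindex s')
     + d%:C%C * (s == s')%:R * (g eps b * g eps b))).
  apply: eq_bigr => eps _; apply: eq_bigr => b _; rewrite mxE E.
  by congr (_ + _); ring.
under eq_bigr do rewrite big_split -mulr_sumr.
rewrite big_split -mulr_sumr g_sum// mulr1 /dg (inj_eq (can_inj (@mxtens_unindexK _ _))).
congr (_ + _); rewrite -(diagE a); apply: eq_bigr => eps _.
rewrite lE (big_ord_widen K (fun b => \sum_r (cn a eps b r (mxtens_unindex s))^* *
  cn a eps b r (mxtens_unindex s'))) //.
by apply: eq_bigr => b _; apply: eq_bigr => r _; rewrite !cnE.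
Qed.

Let rho_posdef d (u : 'I_p -> C) : d%:C%C * \sum_i (u i)^* * u i <=
  \sum_i \sum_j (u i)^* * rho d i j * u j.
Proof.
have h := fpsd_comp (@mxtens_unindex n q) (diag_psd ord0).
have -> : \sum_i \sum_j (u i)^* * rho d i j * u j =
    \sum_i \sum_j (u i)^* * diag ord0 (mxtens_unindex i) (mxtens_unindex j) * u j +
    d%:C%C * \sum_i (u i)^* * u i.
  rewrite mulr_sumr -big_split; apply: eq_bigr => i _ /=.
  transitivity (\sum_j ((u i)^* * diag ord0 (mxtens_unindex i) (mxtens_unindex j) * u j
      + d%:C%C * (u i)^* * (i == j)%:R * u j)).
    apply: eq_bigr => j _; rewrite mxE /dg.
    rewrite (inj_eq (can_inj (@mxtens_unindexK _ _))); ring.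
  rewrite big_split; congr (_ + _).
  rewrite (bigD1 i)//= big1 ?addr0 => [|j /negPf ji].
    by rewrite eqxx mulr1 mulrA.
  by rewrite eq_sym ji mulr0 mul0r.
by rewrite lerDr; exact: h.
Qed.

(** The functional is nonnegative at [X]: it is a vector functional of the image
    of [X] under the family above and the compression to the span of [e], up to
    a perturbation which tends to 0 with [d]. *)
Lemma blocks_pos_basis : 0 <= \sum_r opform blocks (v r) (v r).
Proof.
have [psi [psi_ucp psiE]] := compression_ucp oe.
rewrite (@sum_opform blocks x) //.
pose w : C := \sum_(s : V) \sum_(s' : V) \sum_(r : J0 * 'I_K)
  g r.1.1.2 r.1.2 * g r.1.1.2 r.2 * (s == s')%:R *
  ip ((x r.1 r.2 s.1 s'.1 : bop H) (e s'.2)) (e s.2).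
apply: (@complex_limit _ _ w) => d d0.
have d0' : 0 < d%:C%C by rewrite ltcR.
pose gg (r : J0 * 'I_K) : L * bool * nat * nat :=
  (l r.1.1.1, r.1.1.2, r.1.2 : nat, r.2 : nat).
have Xout (r : J0 * 'I_K) : ~~ (((gg r).1.2 < dimL (gg r).1.1.1)%N &&
    ((gg r).2 < dimL (gg r).1.1.1)%N) -> x r.1 r.2 = 0.
  by move=> h; apply: (@x_out r.1 r.2); exact: h.
have XE' i j : X i j = \sum_r tens (egen R (gg r).1.1.1 (gg r).1.1.2 (gg r).1.2 (gg r).2)
    (x r.1 r.2 i j) by rewrite XE [RHS]sum_pair.
have := @min_pos_choi R I_ (BH H) n p q (l ord0) X _ gg (fun r => x r.1 r.2)
  Xout XE' psi psi_ucp (chm d) (rho d) d%:C%C (chm_cp d0) (chm_unit d) d0'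
  (rho_posdef d) X_min.
(* Test on the vector that pairs the index [s = (i, t)] of the first map with the
   index [t] of the compression. *)
move=> F_psd.
have := @fpsd_comp R V _ (fun s : V => (s.1, (mxtens_index s, s.2))) _ F_psd (fun=> 1).
congr (0 <= _).
transitivity (\sum_(s : V) \sum_(s' : V) \sum_(r : J0 * 'I_K)
  (D r.1 (r.1.1, r.2) s s' * ip ((x r.1 r.2 s.1 s'.1 : bop H) (e s'.2)) (e s.2) +
   d%:C%C * (g r.1.1.2 r.1.2 * g r.1.1.2 r.2 * (s == s')%:R *
  ip ((x r.1 r.2 s.1 s'.1 : bop H) (e s'.2)) (e s.2)))).
  apply: eq_bigr => s _; apply: eq_bigr => s' _.
  rewrite rmorph1 mul1r mulr1; apply: eq_bigr => r _ /=.
  rewrite psiE mxE pickE !mxtens_indexK (inj_eq (can_inj (@mxtens_indexK _ _))).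
  rewrite mulrDl; congr (_ * _ + _); last by rewrite -!mulrA.
  by apply: eq_bigr => t _; case: r => [[[a eps] b] b'] /=; rewrite !cnE.
transitivity (\sum_(s : V) \sum_(s' : V) \sum_(r : J0 * 'I_K)
  D r.1 (r.1.1, r.2) s s' * ip ((x r.1 r.2 s.1 s'.1 : bop H) (e s'.2)) (e s.2) +
  d%:C%C * w).
  rewrite /w mulr_sumr -big_split; apply: eq_bigr => s _ /=.
  rewrite mulr_sumr -big_split; apply: eq_bigr => s' _ /=.
  by rewrite mulr_sumr -big_split.
congr (_ + _).
rewrite -(sum_pair (fun r : J0 * 'I_K => \sum_s \sum_s'
   D r.1 (r.1.1, r.2) s s' * ip ((x r.1 r.2 s.1 s'.1 : bop H) (e s'.2)) (e s.2))).
rewrite [RHS]exchange_big; apply: eq_bigr => s _.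
by rewrite exchange_big.
Qed.

End positivity.
End decomposition.

(** * Decomposition of min-positive elements *)

Section polarization.
Variables (R : realType) (H : hilbert R) (J : finType).
Local Notation C := R[i].
Local Notation Y := (J -> J -> bop H).
Implicit Types (s : seq ((J -> H) * (J -> H))) (N : set Y).

Let pol s : seq (R * (J -> H)) :=
  [seq (1, r.1 + r.2) | r <- s] ++ [seq (-1, r.1 - r.2) | r <- s].

Let comb_pol s (z : Y) : comb (pol s) z =
  2 * (\sum_(r <- s) opform z r.1 r.2 + \sum_(r <- s) opform z r.2 r.1).
Proof.
rewrite comb_cat /comb !big_map -!big_split mulr_sumr; apply: eq_bigr => r _ /=.
rewrite rmorphN1 !opformDl !opformDr !opformNl !opformNr; ring.
Qed.

(** Polarisation: agreement on the quadratic combinations killing [N] implies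
    agreement on the sesquilinear combinations killing [N] together with their
    adjoints. *)
Lemma comb_polarization N (z z' : Y) :
  (forall t, (forall y, N y -> comb t y = 0) -> comb t z = comb t z') ->
  forall s, (forall y, N y -> \sum_(r <- s) opform y r.1 r.2 = 0) ->
    (forall y, N y -> \sum_(r <- s) opform y r.2 r.1 = 0) ->
    \sum_(r <- s) opform z r.1 r.2 = \sum_(r <- s) opform z' r.1 r.2.
Proof.
move=> zz' s s1 s2.
pose s' := [seq (r.1, 'i%C *: r.2) | r <- s] : seq ((J -> H) * (J -> H)).
have iC := conj_i R.
have sr y : \sum_(r <- s') opform y r.1 r.2 = - 'i%C * \sum_(r <- s) opform y r.1 r.2.
  by rewrite big_map mulr_sumr; apply: eq_bigr => r _; rewrite opformZr iC.
have sl y : \sum_(r <- s') opform y r.2 r.1 = 'i%C * \sum_(r <- s) opform y r.2 r.1.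
  by rewrite big_map mulr_sumr; apply: eq_bigr => r _; rewrite opformZl.
have h1 : comb (pol s) z = comb (pol s) z'.
  by apply: zz' => y Ny; rewrite comb_pol s1// s2// addr0 mulr0.
have h2 : comb (pol s') z = comb (pol s') z'.
  by apply: zz' => y Ny; rewrite comb_pol sr sl s1// s2// !mulr0 addr0 mulr0.
move: h1 h2; rewrite !comb_pol !sr !sl.
set a := \sum_(r <- s) opform z r.1 r.2; set b := \sum_(r <- s) opform z r.2 r.1.
set c := \sum_(r <- s) opform z' r.1 r.2; set d := \sum_(r <- s) opform z' r.2 r.1.
move: a b c d => a b c d h1 h2.
have two : (2 : C) != 0 by rewrite pnatr_eq0.
have i0 : ('i%C : C) != 0 by rewrite eq_complex /= oner_eq0 andbF.
have e1 : a + b = c + d by apply: (mulfI two).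
have e2 : - a + b = - c + d.
  apply: (mulfI (mulf_neq0 two i0)).
  transitivity (2 * (- 'i%C * a + 'i%C * b)); first by ring.
  by rewrite h2; ring.
apply: (mulfI two); transitivity ((a + b) - (- a + b)); first by ring.
rewrite e1 e2; ring.
Qed.

End polarization.

Section min_decomposition.
Variables (R : realType) (I_ : nat -> Type) (H : hilbert R) (n m K : nat).
Local Notation C := R[i].
Local Notation L := {k : nat & I_ k}.
Local Notation CI := (frakC R I_).
Local Notation J0 := ('I_m.+1 * bool * 'I_K)%type.
Local Notation J := (J0 * 'I_n)%type.
Local Notation Y := (J -> J -> bop H).
Variables (X : 'M[tensor CI (BH H)]_n) (l : 'I_m.+1 -> L).
Variable x : J0 -> 'I_K -> 'M[BH H]_n.
Hypothesis l_inj : injective l.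
Hypothesis l_K : forall a, (dimL (l a) <= K)%N.
Hypothesis x_out : forall (P : J0) (b : 'I_K),
  ~~ ((P.2 < dimL (l P.1.1))%N && (b < dimL (l P.1.1))%N) -> x P b = 0.
Hypothesis XE : forall i j, X i j =
  \sum_(P : J0) \sum_(b < K) tens (egen R (l P.1.1) P.1.2 P.2 b) (x P b i j).
Hypothesis X_min : min_pos X.

Lemma blocks_pos (S0 : finType) (v : S0 -> J -> H) :
  (forall z, null_blocks l z -> \sum_t opform z (v t) (v t) = 0) ->
  0 <= \sum_t opform (blocks x) (v t) (v t).
Proof.
move=> v0; have [q [e [oe [cf cfE]]]] :=
  orthonormal_basis (fun rp : S0 * J => v rp.1 rp.2).
apply: (blocks_pos_basis l_inj l_K x_out XE X_min v0 oe) => r p.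
exact: (cfE (r, p)).
Qed.

Let zero_K : 'I_K := Ordinal (leq_trans (ltn0Sn _) (l_K ord0)).

(** Elements of [null_blocks] represent 0 in the tensor product. *)
Lemma null_blocks_sum (y : 'I_m.+1 -> 'I_n -> 'I_n -> bop H) i j :
  (forall i j, \sum_a y a i j = 0) ->
  \sum_(P : J0) \sum_(b < K) tens (egen R (l P.1.1) P.1.2 P.2 b)
    ((if (P.2 == b) && (P.2 < dimL (l P.1.1))%N then y P.1.1 i j else 0) : BH H) = 0.
Proof.
move=> y0.
transitivity (\sum_a tens (os_unit CI) (y a i j : BH H)); last first.
  by rewrite -tens_sumr y0 tens0r.
rewrite sum_pair sum_pair; apply: eq_bigr => a _.
rewrite (frakC_unitE _ (l a)) (frakc_unit_gen R (leqnn _)) coprod_inj_sum tens_suml.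
apply: eq_bigr => eps _; rewrite coprod_inj_sum tens_suml.
rewrite (big_ord_widen K (fun b => tens (egen R (l a) eps b b) (y a i j : BH H)))//.
rewrite [RHS]big_mkcond; apply: eq_bigr => b _.
rewrite (bigD1 b) // [X in _ X = _]big1 => [|b' /negPf bb]; last first.
  by rewrite [b == b']eq_sym bb tens0r.
rewrite [LHS]addr0 eqxx.
by case: (b < dimL (l a))%N; rewrite ?tens0r.
Qed.

(** A min-positive element is a sum of positive elements of the summands: the
    positive matrix [Q] provided by the extension theorem differs from the
    coefficients of [X] by an element of [null_blocks]. *)
Lemma min_decomposition : exists Q : Y, oppos Q /\ forall i j, X i j =
  \sum_(P : J0) \sum_(b < K) tens (egen R (l P.1.1) P.1.2 P.2 b)
    (Q (P, i) ((P.1, b), j) : BH H).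
Proof.
have [Q [Qpos QE]] := @positive_extension R H J (null_blocks l) (blocks x)
  (@weight R I_ n m K l) (@null_blocks_i _ _ _ _ _ _ l) (@weight_gt0 _ _ _ _ _ l)
  (null_blocks_weight l_K) blocks_pos.
have Qpol := comb_polarization QE.
(* [Q - blocks x] vanishes off the diagonals of the blocks, its diagonal blocks
   have the form [1 (x) y_a], and [sum_a y_a = 0]: each of these equations
   between entries holds on [null_blocks]. *)
have Qout (p q : J) : p.1.1 = q.1.1 ->
    ~~ ((p.1.2 == q.1.2) && (p.1.2 < dimL (l p.1.1.1))%N) -> Q p q = blocks x p q.
  move=> pq out; apply: bop_eqP => h; apply: ip_inj => h'.
  have := Qpol [:: (at_ q h, at_ p h')]; rewrite !big_seq1 !opform_at; apply.
    move=> z [y y0 zE]; rewrite big_seq1 opform_at zE// (negPf out).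
    by rewrite bop_0E ip0l.
  move=> z [y y0 zE]; rewrite big_seq1 opform_at zE//.
  case: ifP => [/andP[/eqP E lt]|_]; last by rewrite bop_0E ip0l.
  by rewrite pq E eqxx -E lt in out.
pose P0 a : J0 := (a, false, zero_K).
pose y a i j : bop H := Q (P0 a, i) (P0 a, j) - blocks x (P0 a, i) (P0 a, j).
have yE (P : J0) i j : (P.2 < dimL (l P.1.1))%N ->
    Q (P, i) (P, j) - blocks x (P, i) (P, j) = y P.1.1 i j.
  move=> lt; apply: bop_eqP => h; apply: ip_inj => h'.
  pose s : seq ((J -> H) * (J -> H)) := [:: (at_ (P, j) h, at_ (P, i) h');
    (- at_ (P0 P.1.1, j) h, at_ (P0 P.1.1, i) h')].
  have two (z : Y) : \sum_(r <- s) opform z r.1 r.2 =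
      ip (z (P, i) (P, j) h) h' - ip (z (P0 P.1.1, i) (P0 P.1.1, j) h) h'.
    rewrite -(opform_at z (P, i)) -(opform_at z (P0 P.1.1, i)) -opformNl.
    by rewrite big_cons big_seq1.
  have two' (z : Y) : \sum_(r <- s) opform z r.2 r.1 =
      ip (z (P, j) (P, i) h') h - ip (z (P0 P.1.1, j) (P0 P.1.1, i) h') h.
    rewrite -(opform_at z (P, j)) -(opform_at z (P0 P.1.1, j)) -opformNr.
    by rewrite big_cons big_seq1.
  have E : ip (Q (P, i) (P, j) h) h' - ip (Q (P0 P.1.1, i) (P0 P.1.1, j) h) h' =
      ip (blocks x (P, i) (P, j) h) h' - ip (blocks x (P0 P.1.1, i) (P0 P.1.1, j) h) h'.
    rewrite -!two; apply: Qpol => z [t t0 zE]; rewrite ?two ?two' !zE//= !eqxx lt /=.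
      by rewrite subrr.
    by rewrite subrr.
  rewrite /y !bop_DE !bop_NE !ipDl !ipNl; move: E.
  set u1 := ip (Q (P, i) (P, j) h) h'; set u2 := ip (Q (P0 _, i) _ h) h'.
  by move=> E; rewrite -[u1](subrK u2) E; ring.
have y0 i j : \sum_a y a i j = 0.
  apply: bop_eqP => h; apply: ip_inj => h'.
  pose s := [seq (at_ (P0 a, j) h, at_ (P0 a, i) h') | a <- index_enum 'I_m.+1].
  have sE (z : Y) : \sum_(r <- s) opform z r.1 r.2 =
      \sum_a ip (z (P0 a, i) (P0 a, j) h) h'.
    by rewrite big_map; apply: eq_bigr => a _; rewrite opform_at.
  have sE' (z : Y) : \sum_(r <- s) opform z r.2 r.1 =
      \sum_a ip (z (P0 a, j) (P0 a, i) h') h.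
    by rewrite big_map; apply: eq_bigr => a _; rewrite opform_at.
  have E : \sum_a ip (Q (P0 a, i) (P0 a, j) h) h' =
      \sum_a ip (blocks x (P0 a, i) (P0 a, j) h) h'.
    rewrite -!sE; apply: Qpol => z [t t0 zE]; rewrite ?sE ?sE'.
      transitivity (\sum_a ip (t a i j h) h').
        by apply: eq_bigr => a _; rewrite zE//= eqxx.
      by rewrite -ip_suml -bop_sumE t0 bop_0E ip0l.
    transitivity (\sum_a ip (t a j i h') h).
      by apply: eq_bigr => a _; rewrite zE//= eqxx.
    by rewrite -ip_suml -bop_sumE t0 bop_0E ip0l.
  rewrite bop_sumE bop_0E ip0l ip_suml.
  transitivity (\sum_a (ip (Q (P0 a, i) (P0 a, j) h) h' -
                        ip (blocks x (P0 a, i) (P0 a, j) h) h')).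
    by apply: eq_bigr => a _; rewrite /y bop_DE bop_NE ipDl ipNl.
  by rewrite sumrB E subrr.
exists Q; split=> // i j.
rewrite XE; apply: etrans (esym (addr0 _)) _.
rewrite -[X in _ + X = _](null_blocks_sum i j y0) -big_split.
apply: eq_bigr => P _; rewrite -big_split; apply: eq_bigr => b _.
apply: etrans (esym (tensDr _ _ _)) _; congr (tens _ _).
have bE : blocks x (P, i) ((P.1, b), j) = x P b i j by rewrite /blocks eqxx.
case: ifP => [/andP[/eqP Pb lt]|/negbT out].
  rewrite -(yE P i j lt) -bE -Pb -surjective_pairing.
  by rewrite addrC subrK.
by rewrite [LHS]addr0 (Qout (P, i) ((P.1, b), j)) ?bE.
Qed.

End min_decomposition.

(** * Max-positivity, and equality of the cones *)

Lemma sum_mxtens_enum (V : nmodType) (A B : finType) (G : 'I_(#|A| * #|B|) -> V) :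
  \sum_k G k = \sum_a \sum_b G (mxtens_index (enum_rank a, enum_rank b)).
Proof.
rewrite -(sum_pair (fun ab : A * B =>
  G (mxtens_index (enum_rank ab.1, enum_rank ab.2)))).
apply: reindex; exists (fun k => (enum_val (mxtens_unindex k).1,
  enum_val (mxtens_unindex k).2)) => [[a b] _|k _].
  by rewrite mxtens_indexK /= !enum_rankK.
by case: (mxtens_unindex k) (mxtens_unindexK k) => a b /= <-; rewrite !enum_valK.
Qed.

Section max_positive.
Variables (R : realType) (I_ : nat -> Type) (H : hilbert R) (n m K : nat).
Local Notation C := R[i].
Local Notation L := {k : nat & I_ k}.
Local Notation CI := (frakC R I_).
Local Notation J0 := ('I_m.+1 * bool * 'I_K)%type.
Local Notation J := (J0 * 'I_n)%type.
Variables (l : 'I_m.+1 -> L).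
Hypothesis l_inj : injective l.

(** The block diagonal matrix of the generators, with one block for each summand
    and each endpoint. *)
Definition gen_entry (P P' : J0) : CI :=
  if P.1 == P'.1 then egen R (l P.1.1) P.1.2 P.2 P'.2 else 0.
Definition gen_blocks : 'M[CI]_#|{: J0}| :=
  \matrix_(s, s') gen_entry (enum_val s) (enum_val s').

(** At every [t] each block is a rank one positive matrix multiplied by the value
    at [t] of a function that is nonnegative on the unit interval. *)
Lemma gen_blocks_pos : os_pos gen_blocks.
Proof.
pose xe (a : 'I_m.+1) (P P' : J0) : frakc R (dimL (l a)) :=
  if (P.1 == P'.1) && (P.1.1 == a) then gen R (dimL (l a)) P.1.2 P.2 P'.2 else 0.
pose x (a : 'I_m.+1) : 'M[frakc R (dimL (l a))]_#|{: J0}| :=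
  \matrix_(s, s') xe a (enum_val s) (enum_val s').
exists m.+1, l, x; split=> //.
  apply/matrixP => s s'; rewrite [LHS]mxE [RHS]mxE.
  transitivity (\sum_a @coprod_inj R L (fun i => frakc R (tag i).+1) (l a)
      (xe a (enum_val s) (enum_val s'))); last first.
    by apply: eq_bigr => a _; rewrite mxE.
  move: (enum_val s) (enum_val s') => P P'; rewrite /gen_entry.
  rewrite (bigD1 P.1.1) // [X in _ = _ X]big1 => [|a /negPf aP]; last first.
    by rewrite /xe [P.1.1 == a]eq_sym aP andbF coprod_inj0.
  rewrite [RHS]addr0 /xe eqxx andbT.
  by case: (P.1 == P'.1); rewrite ?coprod_inj0.
move=> omega om_state _; apply: sumr_ge0 => a _; apply: (om_state a).2.
apply/frakc_posP => t.
have h (eps : bool) := fpsdZ (hat_ge0 eps t) (fpsd_rank_one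
  (fun P : 'I_#|{: J0}| * 'I_(dimL (l a)) => (((enum_val P.1).1 == (a, eps)) &&
     (P.2 == (enum_val P.1).2 :> nat))%:R : C)).
apply: fpsd_ext (fpsd_sum h) => -[s i] [s' i'] /=.
rewrite mxE /xe; move: (enum_val s) (enum_val s') => [[b eps] p] [[b' eps'] p'] /=.
rewrite (bigD1 eps)//= [X in _ + X]big1 ?addr0 => [|eps1 /negPf ee]; last first.
  by rewrite !xpair_eqE (eq_sym eps) ee andbF mul0r mulr0.
rewrite !xpair_eqE eqxx andbT rmorph_nat.
case: (eqVneq b a) => [->|ba]; last first.
  by rewrite /= andbF frakc0E mul0r mulr0.
rewrite andbT (eq_sym a) (eq_sym eps).
case: ifP => _; last by rewrite frakc0E /= !mulr0.
by rewrite genE /= mulrC -natrM mulnb.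
Qed.

(** A sum of positive elements of the summands has the form required by the max
    cones, with the matrix units as the first factor. *)
Lemma max_factorization (Q : J -> J -> bop H) (X : 'M[tensor CI (BH H)]_n) : oppos Q ->
  (forall i j, X i j = \sum_(P : J0) \sum_(b < K)
     tens (egen R (l P.1.1) P.1.2 P.2 b) (Q (P, i) ((P.1, b), j) : BH H)) ->
  exists k k' (P : 'M[CI]_k) (Q' : 'M[BH H]_k') (A : 'M[C]_(n, k * k')),
    [/\ os_pos P, os_pos Q' & X = mxcongr A (mxtens P Q')].
Proof.
move=> Qpos XE.
pose Q' : 'M[BH H]_#|{: J}| := \matrix_(t, t') (Q (enum_val t) (enum_val t') : BH H).
(* The row [i] of [A] selects the pairs of an index [P] of the first factor and
   the index [(P, i)] of the second. *)
pose A : 'M[C]_(n, #|{: J0}| * #|{: J}|) := \matrix_(i, k)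
  (enum_val (mxtens_unindex k).2 == (enum_val (mxtens_unindex k).1, i))%:R.
exists #|{: J0}|, #|{: J}|, gen_blocks, Q', A; split.
- exact: gen_blocks_pos.
- move=> h; have := Qpos (h \o enum_rank); congr (0 <= _).
  rewrite /opform (reindex_onto enum_val enum_rank)/=; last by move=> *; rewrite enum_rankK.
  under eq_bigl do rewrite enum_valK eqxx.
  apply: eq_bigr => t _.
  rewrite (reindex_onto enum_val enum_rank)/=; last by move=> *; rewrite enum_rankK.
  under eq_bigl do rewrite enum_valK eqxx.
  by apply: eq_bigr => t' _; rewrite !enum_valK mxE.
apply/matrixP => i j; rewrite XE mxE sum_mxtens_enum.
apply: eq_bigr => P _.
have AE i' (u : J0) (w : J) :
    A i' (mxtens_index (enum_rank u, enum_rank w)) = (w == (u, i'))%:R.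
  by rewrite mxE mxtens_indexK /= !enum_rankK.
have col (w : J) : w != (P, i) -> \sum_k' (A i (mxtens_index (enum_rank P, enum_rank w)) *
    (A j k')^*) *: mxtens gen_blocks Q' (mxtens_index (enum_rank P, enum_rank w)) k' = 0.
  by move=> /negPf wP; rewrite big1// => k' _; rewrite AE wP mul0r scale0r.
rewrite (bigD1 (P, i)) // [X in _ = _ X]big1 => [|w wP]; last exact: col.
rewrite [RHS]addr0 sum_mxtens_enum.
pose F (P' : J0) : tensor CI (BH H) :=
  tens (egen R (l P.1.1) P.1.2 P.2 P'.2) (Q (P, i) (P', j) : BH H).
transitivity (\sum_(P' : J0) (if P'.1 == P.1 then F P' else 0)).
  exact: esym (sum_pair_fst F P.1).
apply: eq_bigr => P' _; rewrite (bigD1 (P', j)) // [X in _ = _ X]big1 => [|w /negPf wP].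
  rewrite [RHS]addr0 !AE !eqxx mul1r rmorph_nat scale1r mxE !mxtens_indexK !mxE.
  by rewrite !enum_rankK /gen_entry eq_sym; case: (P.1 == P'.1); rewrite // tens0l.
by rewrite !AE wP rmorph_nat mulr0 scale0r.
Qed.

End max_positive.

Theorem theorem4p1 (R : realType) (I : Type) (I_ : nat -> Type)
    (I_nonempty : inhabited I)
    (I_card : forall k, ([set: I_ k] #= [set: I])%card)
    (H : hilbert R) (n : nat)
    (X : 'M[tensor (frakC R I_) (BH H)]_n) :
  @os_pos R (min_tensor (frakC R I_) (BH H)) n X <->
  @os_pos R (max_tensor (frakC R I_) (BH H)) n X.
Proof.
split; last exact: max_pos_min_pos.
move=> Xmin e e0.
have [l0] : inhabited {k : nat & I_ k}.
  apply: contrapT => noL; case: I_nonempty => i0.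
  have E : [set: I_ 0%N] = set0.
    by apply/seteqP; split=> // i _; apply: noL; split; exists 0%N.
  have := I_card 0%N; rewrite E card_eq_sym card_eq0 => /eqP I0.
  by have : [set: I] i0 by []; rewrite I0.
have X'min := min_pos_unit e0 Xmin.
set X' := X + _ in X'min *.
have [m [K [l [x [l_inj l_K x_out X'E]]]]] := frakC_representation X' l0.
have [Q [Qpos QE]] := min_decomposition l_inj l_K x_out X'E X'min.
have [k [k' [P [Q' [A [Pp Qp E]]]]]] := max_factorization l_inj Qpos QE.
by exists k, k', P, Q', A.
Qed.
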